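(* Let $\mathcal{H}(T,A,\mu)$ be a Cauchy--de Branges space of finite order. Let $$G(z)=A(z)\Big(\gamma+\sum_n\frac{a_n}{z-t_n}\Big),$$ where $\gamma\in\mathbb{C}\setminus\{0\}$ and $(a_n)\subset\mathbb{C}$ satisfies $\sum_n\frac{|a_n|}{|t_n|+1}<\infty$. Then $\mathcal{Z}(G)$ (counting multiplicities) is a uniqueness set for $\mathcal{H}(T,A,\mu)$: the only function in the space vanishing on $\mathcal{Z}(G)$ with at least the corresponding multiplicities is $0$.
   Context: Let $T=\{t_n\}_{n\ge1}\subset\mathbb{C}$ be a set of distinct points with $|t_n|\to\infty$, and let $\mu_n>0$ satisfy $\sum_n\frac{\mu_n}{|t_n|^2+1}<\infty$. Let $A$ be an entire function with simple zeros exactly at $T$ and no other zeros. The Cauchy--de Branges space is $\mathcal{H}(T,A,\mu)=\{F(z)=A(z)\sum_n\frac{c_n\mu_n^{1/2}}{z-t_n}:(c_n)\in\ell^2\}$ with norm $\|F\|=\|(c_n)\|_{\ell^2}$. It is of finite order if all its elements are entire functions of finite order (equivalently, $A$ has finite order). *)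

(* Defs.v *)
From Stdlib Require Import Reals.
From Coquelicot Require Import Coquelicot.
Open Scope R_scope.

Definition entire (f : C -> C) : Prop :=
  forall z : C, ex_derive (K:=C_AbsRing) (V:=C_NormedModule) f z.

Definition is_cseries (a : nat -> C) (s : C) : Prop :=
  is_series (K:=C_AbsRing) (V:=C_NormedModule) a s.

Definition finite_order (f : C -> C) : Prop :=
  entire f /\
  exists rho R0 : R, 0 < rho /\ 0 < R0 /\
    forall z : C, R0 <= Cmod z -> Cmod (f z) <= exp (Rpower (Cmod z) rho).

Definition in_range (T : nat -> C) (z : C) : Prop := exists n, z = T n.

(* membership in the Cauchy--de Branges space H(T,A,mu):
   F(z) = A(z) sum_n c_n mu_n^{1/2} / (z - t_n), (c_n) in l^2.
   F is required entire; off T it is given by the (convergent) series,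
   at the points t_n its value is then forced by continuity. *)
Definition in_CdB (T : nat -> C) (A : C -> C) (mu : nat -> R) (F : C -> C) : Prop :=
  entire F /\
  exists c : nat -> C,
    ex_series (fun n => (Cmod (c n)) ^ 2) /\
    forall z : C, ~ in_range T z ->
      is_cseries (fun n => (A z * (c n * RtoC (sqrt (mu n)))) / (z - T n))%C (F z).

Definition CdB_finite_order (T : nat -> C) (A : C -> C) (mu : nat -> R) : Prop :=
  forall F, in_CdB T A mu F -> finite_order F.

Definition vanishes_to_order (f : C -> C) (w : C) (m : nat) : Prop :=
  exists h : C -> C, entire h /\ forall z, f z = ((z - w) ^ m * h z)%C.

(* Main.v *)
(** Since [F] vanishes on the zeros of [G], the quotient [H = F / G] is entire. Off [T] it is a quotient
    of two Cauchy transforms whose absolute values are controlled by [S(w) = sum_n b_n / |w - t_n|] with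
    [b_n = |c_n| mu_n^(1/2) + |a_n|], so that [|H|] is small wherever [S] is small: the subharmonic function
    [u = ln (1 + |H|^2)] satisfies [u <= eta + (M / lambda) S] on a disc where [u <= M]. On suitable circles of
    radius between [R] and [3R] the mean of [S] tends to 0, hence
    [sup_{|z| <= R} u <= 2 eta + kappa sup_{|z| <= 4R} u] for [R] large, with [eta] and [kappa] as small as
    we please. As [H] has finite order, [u] grows at most polynomially, and iterating forces [u = 0].

    Subharmonicity of functions [Phi (|K|^2)] is used in logarithmic polar coordinates around [z]: the integral
    over [theta] of [Phi (|K (z + e^(s + i theta))|^2)] has second derivative in [s] equal to the integral of the
    Laplacian. That [H] has finite order is proved by integrating
    [u + ln (|G|^2 + eps) <= ln (|F|^2 + |G|^2 + eps (1 + |H|^2))] over a circle centred at a point where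
    [G <> 0], and transferring the bound off centre by a Moebius map. *)

Require Import Defs.
From Stdlib Require Import Reals Lra Lia Classical ClassicalEpsilon.
From Coquelicot Require Import Coquelicot.
Open Scope R_scope.

(** * Complex derivatives *)

(** The obstacle is that [G] has no lower bound on circles given in advance: its zeros and the
    points of [T] may cluster in any way. Off [T] the common factor [A] cancels from [F / G], and
    [gamma <> 0] keeps the remaining denominator away from 0 wherever [S] is small; elsewhere only
    [u <= M] is used. So only a mean of [S] has to be controlled, and since [1 / |w|] is integrable
    in the plane, averaging over an annulus yields a radius on which the poles do no harm. The
    function [ln (1 + |H|^2)] is preferred to [ln |H|] because it is smooth, nonnegative and zero
    exactly where [H] is, so that a bound tending to 0 ends the proof. The factor 4 arises because
    circles of radius at most [3R] about points of [|z| <= R] stay in [|w| <= 4R]; a contraction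
    constant below [4^(-k)] then beats growth of degree [k]. Finite order is assumed for elements of
    the space only: the growth of [A] is read off from a single element, and that of [G] from the
    same good circles applied to [|G|]. *)

Definition ccont (f : C -> C) (z : C) : Prop :=
  forall eps : R, 0 < eps -> exists delta : R, 0 < delta /\
    forall w, Cmod (w - z) < delta -> Cmod (f w - f z) < eps.

(* Caratheodory's form of the derivative. In [is_derive (K := C_AbsRing) (V := C_NormedModule)] source and
   target carry different (though equivalent) uniform structures, so that the library rules for products and
   compositions do not apply to it; [cderiv_is_derive] relates the two. *)
Definition cderiv (f : C -> C) (z l : C) : Prop :=
  exists q : C -> C, ccont q z /\ q z = l /\ forall w, f w = (f z + q w * (w - z))%C.

Lemma Cmod_sub_self z : Cmod (z - z) = 0.
Proof. replace (z - z)%C with (RtoC 0) by ring. apply Cmod_0. Qed.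

Lemma Cmod_sub_sym z w : Cmod (z - w) = Cmod (w - z).
Proof. rewrite <- Cmod_opp. f_equal. ring. Qed.

Lemma Cmod_triangle_sub z w : Cmod (z - w) <= Cmod z + Cmod w.
Proof. rewrite <- (Cmod_opp w). apply Cmod_triangle. Qed.

Lemma Cmod_triangle_inv z w : Cmod z - Cmod w <= Cmod (z - w).
Proof.
  pose proof (Cmod_triangle (z - w) w) as H.
  replace (z - w + w)%C with z in H by ring. lra.
Qed.

Lemma Cmod_pos_sub z w : z <> w -> 0 < Cmod (z - w).
Proof.
  intros H. apply Cmod_gt_0. intros E. apply H.
  replace z with (z - w + w)%C by ring. rewrite E. ring.
Qed.

Lemma Csub_neq_0 (z w : C) : z <> w -> (z - w)%C <> 0%C.
Proof. intros H. apply Cmod_gt_0, Cmod_pos_sub, H. Qed.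

Lemma ccont_const c z : ccont (fun _ => c) z.
Proof.
  intros eps He. exists 1. split; [lra|]. intros w _. rewrite Cmod_sub_self. exact He.
Qed.

Lemma ccont_id z : ccont (fun w => w) z.
Proof. intros eps He. exists eps. split; auto. Qed.

Lemma ccont_plus f g z : ccont f z -> ccont g z -> ccont (fun w => (f w + g w)%C) z.
Proof.
  intros Hf Hg eps He.
  destruct (Hf (eps / 2)) as [d1 [Hd1 H1]]; [lra|].
  destruct (Hg (eps / 2)) as [d2 [Hd2 H2]]; [lra|].
  exists (Rmin d1 d2). split; [apply Rmin_pos; auto|].
  intros w Hw.
  pose proof (Rmin_l d1 d2). pose proof (Rmin_r d1 d2).
  specialize (H1 w ltac:(lra)). specialize (H2 w ltac:(lra)).
  replace (f w + g w - (f z + g z))%C with ((f w - f z) + (g w - g z))%C by ring.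
  eapply Rle_lt_trans; [apply Cmod_triangle|]. lra.
Qed.

Lemma ccont_bound f z : ccont f z ->
  exists delta, 0 < delta /\ forall w, Cmod (w - z) < delta -> Cmod (f w) <= Cmod (f z) + 1.
Proof.
  intros Hf. destruct (Hf 1) as [d [Hd H]]; [lra|].
  exists d. split; auto. intros w Hw. specialize (H w Hw).
  pose proof (Cmod_triangle_inv (f w) (f z)). lra.
Qed.

Lemma ccont_mult f g z : ccont f z -> ccont g z -> ccont (fun w => (f w * g w)%C) z.
Proof.
  intros Hf Hg eps He.
  destruct (ccont_bound g z Hg) as [d0 [Hd0 H0]].
  pose proof (Cmod_ge_0 (f z)) as Pf. pose proof (Cmod_ge_0 (g z)) as Pg.
  destruct (Hf (eps / 2 / (Cmod (g z) + 1))) as [d1 [Hd1 H1]].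
  { apply Rdiv_lt_0_compat; lra. }
  destruct (Hg (eps / 2 / (Cmod (f z) + 1))) as [d2 [Hd2 H2]].
  { apply Rdiv_lt_0_compat; lra. }
  exists (Rmin d0 (Rmin d1 d2)). split; [repeat apply Rmin_pos; auto|].
  intros w Hw.
  pose proof (Rmin_l d0 (Rmin d1 d2)). pose proof (Rmin_r d0 (Rmin d1 d2)).
  pose proof (Rmin_l d1 d2). pose proof (Rmin_r d1 d2).
  specialize (H0 w ltac:(lra)). specialize (H1 w ltac:(lra)). specialize (H2 w ltac:(lra)).
  replace (f w * g w - f z * g z)%C with ((f w - f z) * g w + f z * (g w - g z))%C by ring.
  eapply Rle_lt_trans; [apply Cmod_triangle|]. rewrite !Cmod_mult.
  apply Rle_lt_trans with (Cmod (f w - f z) * (Cmod (g z) + 1)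
                           + (Cmod (f z) + 1) * Cmod (g w - g z)).
  { apply Rplus_le_compat; [apply Rmult_le_compat_l|apply Rmult_le_compat_r];
      try apply Cmod_ge_0; lra. }
  apply (Rmult_lt_compat_r (Cmod (g z) + 1)) in H1; [|lra].
  apply (Rmult_lt_compat_l (Cmod (f z) + 1)) in H2; [|lra].
  replace (eps / 2 / (Cmod (g z) + 1) * (Cmod (g z) + 1)) with (eps / 2) in H1 by (field; lra).
  replace ((Cmod (f z) + 1) * (eps / 2 / (Cmod (f z) + 1))) with (eps / 2) in H2 by (field; lra).
  lra.
Qed.

Lemma ccont_opp f z : ccont f z -> ccont (fun w => (- f w)%C) z.
Proof.
  intros Hf eps He. destruct (Hf eps He) as [d [Hd H]]. exists d. split; auto.
  intros w Hw. specialize (H w Hw). rewrite <- Cmod_opp.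
  replace (- (- f w - - f z))%C with (f w - f z)%C by ring. exact H.
Qed.

Lemma ccont_minus f g z : ccont f z -> ccont g z -> ccont (fun w => (f w - g w)%C) z.
Proof. intros Hf Hg. apply (ccont_plus f (fun w => (- g w)%C)); auto. apply ccont_opp; auto. Qed.

Lemma ccont_inv f z : ccont f z -> f z <> 0%C -> ccont (fun w => (/ f w)%C) z.
Proof.
  intros Hf Hz eps He.
  assert (Pz : 0 < Cmod (f z)) by (apply Cmod_gt_0; auto).
  destruct (Hf (Cmod (f z) / 2)) as [d1 [Hd1 H1]]; [lra|].
  destruct (Hf (eps * (Cmod (f z) / 2 * Cmod (f z)))) as [d2 [Hd2 H2]].
  { repeat apply Rmult_lt_0_compat; lra. }
  exists (Rmin d1 d2). split; [apply Rmin_pos; auto|].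
  intros w Hw.
  pose proof (Rmin_l d1 d2). pose proof (Rmin_r d1 d2).
  specialize (H1 w ltac:(lra)). specialize (H2 w ltac:(lra)).
  pose proof (Cmod_triangle_inv (f z) (f z - f w)) as H3.
  replace (f z - (f z - f w))%C with (f w) in H3 by ring.
  rewrite (Cmod_sub_sym (f z)) in H3.
  assert (Pw : 0 < Cmod (f w)) by lra.
  assert (Hw0 : f w <> 0%C) by (apply Cmod_gt_0; auto).
  replace (/ f w - / f z)%C with ((f z - f w) / (f w * f z))%C by (field; auto).
  rewrite Cmod_div by (apply Cmult_neq_0; auto).
  rewrite Cmod_mult, Cmod_sub_sym.
  apply Rmult_lt_reg_r with (Cmod (f w) * Cmod (f z)); [apply Rmult_lt_0_compat; auto|].
  replace (Cmod (f w - f z) / (Cmod (f w) * Cmod (f z)) * (Cmod (f w) * Cmod (f z)))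
    with (Cmod (f w - f z)) by (field; lra).
  eapply Rlt_le_trans; [exact H2|].
  apply Rmult_le_compat_l; [lra|]. apply Rmult_le_compat_r; lra.
Qed.

Lemma ccont_comp f g z : ccont g z -> ccont f (g z) -> ccont (fun w => f (g w)) z.
Proof.
  intros Hg Hf eps He. destruct (Hf eps He) as [d [Hd H]].
  destruct (Hg d Hd) as [d' [Hd' H']]. exists d'. split; auto.
Qed.

Lemma ccont_ext_loc f g z r : 0 < r -> (forall w, Cmod (w - z) < r -> f w = g w) ->
  ccont f z -> ccont g z.
Proof.
  intros Hr E Hf eps He. destruct (Hf eps He) as [d [Hd H]].
  exists (Rmin r d). split; [apply Rmin_pos; auto|].
  pose proof (Rmin_l r d). pose proof (Rmin_r r d).
  intros w Hw. rewrite <- (E w) by lra. rewrite <- (E z) by (rewrite Cmod_sub_self; auto).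
  apply H. lra.
Qed.

Lemma cderiv_ccont f z l : cderiv f z l -> ccont f z.
Proof.
  intros [q [Hq [_ E]]].
  apply (ccont_ext_loc (fun w => (f z + q w * (w - z))%C) f z 1); [lra|intros; symmetry; apply E|].
  apply ccont_plus; [apply ccont_const|apply ccont_mult; auto].
  apply ccont_minus; [apply ccont_id|apply ccont_const].
Qed.

Lemma cderiv_const c z : cderiv (fun _ => c) z 0%C.
Proof. exists (fun _ => 0%C). split; [apply ccont_const|]. split; auto. intros; ring. Qed.

Lemma cderiv_id z : cderiv (fun w => w) z 1%C.
Proof. exists (fun _ => 1%C). split; [apply ccont_const|]. split; auto. intros; ring. Qed.

Lemma cderiv_plus f g z l m : cderiv f z l -> cderiv g z m ->
  cderiv (fun w => (f w + g w)%C) z (l + m)%C.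
Proof.
  intros [q [Hq [E1 E2]]] [p [Hp [E3 E4]]].
  exists (fun w => (q w + p w)%C). split; [apply ccont_plus; auto|].
  split; [rewrite E1, E3; auto|]. intros w. rewrite E2, E4. ring.
Qed.

Lemma cderiv_mult f g z l m : cderiv f z l -> cderiv g z m ->
  cderiv (fun w => (f w * g w)%C) z (l * g z + f z * m)%C.
Proof.
  intros Hf Hg. pose proof (cderiv_ccont _ _ _ Hg) as Cg.
  destruct Hf as [q [Hq [E1 E2]]]. destruct Hg as [p [Hp [E3 E4]]].
  exists (fun w => (q w * g w + f z * p w)%C).
  split; [apply ccont_plus; apply ccont_mult; auto; apply ccont_const|].
  split; [rewrite E1, E3; auto|]. intros w. rewrite (E2 w), (E4 w). ring.
Qed.

Lemma cderiv_scal c f z l : cderiv f z l -> cderiv (fun w => (c * f w)%C) z (c * l)%C.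
Proof.
  intros H. replace (c * l)%C with (0 * f z + c * l)%C by ring.
  apply (cderiv_mult (fun _ => c)); auto. apply cderiv_const.
Qed.

Lemma cderiv_minus f g z l m : cderiv f z l -> cderiv g z m ->
  cderiv (fun w => (f w - g w)%C) z (l - m)%C.
Proof.
  intros [q [Hq [E1 E2]]] [p [Hp [E3 E4]]].
  exists (fun w => (q w - p w)%C). split; [apply ccont_minus; auto|].
  split; [rewrite E1, E3; auto|]. intros w. rewrite E2, E4. ring.
Qed.

Lemma cderiv_comp f g z l m : cderiv g z m -> cderiv f (g z) l ->
  cderiv (fun w => f (g w)) z (l * m)%C.
Proof.
  intros Hg Hf. pose proof (cderiv_ccont _ _ _ Hg) as Cg.
  destruct Hf as [q [Hq [E1 E2]]]. destruct Hg as [p [Hp [E3 E4]]].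
  exists (fun w => (q (g w) * p w)%C).
  split; [apply ccont_mult; auto; apply (ccont_comp q g); auto|].
  split; [rewrite E1, E3; auto|]. intros w. rewrite (E2 (g w)).
  rewrite (E4 w) at 2. ring.
Qed.

Lemma cderiv_ext_loc f g z l r : 0 < r -> (forall w, Cmod (w - z) < r -> f w = g w) ->
  cderiv f z l -> cderiv g z l.
Proof.
  intros Hr E [q [Hq [E1 E2]]].
  assert (Ez : f z = g z) by (apply E; rewrite Cmod_sub_self; auto).
  (* The slope must satisfy its identity for every [w]. Outside the disc it is the difference
     quotient of [g], which does not affect continuity at [z]. *)
  exists (fun w => match Rlt_dec (Cmod (w - z)) r with
           | left _ => q w | right _ => ((g w - g z) / (w - z))%C end).
  split; [|split].
  - apply (ccont_ext_loc q _ z r); auto. intros w Hw. destruct (Rlt_dec _ r); auto. lra.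
  - rewrite Cmod_sub_self. destruct (Rlt_dec 0 r); auto. lra.
  - intros w. destruct (Rlt_dec _ r) as [H|H].
    + rewrite <- E, <- Ez by auto. apply E2.
    + field. apply Cmod_gt_0. lra.
Qed.

Lemma cderiv_inv f z l : cderiv f z l -> f z <> 0%C ->
  cderiv (fun w => (/ f w)%C) z (- l / (f z * f z))%C.
Proof.
  intros Hf Hz. pose proof (cderiv_ccont _ _ _ Hf) as Cf.
  destruct (Cf (Cmod (f z))) as [d [Hd H]]; [apply Cmod_gt_0; auto|].
  assert (Hn : forall w, Cmod (w - z) < d -> f w <> 0%C).
  { intros w Hw E. specialize (H w Hw). rewrite E in H.
    replace (0 - f z)%C with (- f z)%C in H by ring. rewrite Cmod_opp in H. lra. }
  destruct Hf as [q [Hq [E1 E2]]].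
  exists (fun w => match Rlt_dec (Cmod (w - z)) d with
           | left _ => (- q w * / (f w * f z))%C | right _ => ((/ f w - / f z) / (w - z))%C end).
  split; [|split].
  - apply (ccont_ext_loc (fun w => (- q w * / (f w * f z))%C) _ z d); auto.
    + intros w Hw. destruct (Rlt_dec _ d); auto. lra.
    + apply ccont_mult; [apply ccont_opp; auto|].
      apply (ccont_inv (fun w => (f w * f z)%C)); [|apply Cmult_neq_0; auto].
      apply ccont_mult; auto. apply ccont_const.
  - rewrite Cmod_sub_self. destruct (Rlt_dec 0 d); [rewrite E1; reflexivity|lra].
  - intros w. destruct (Rlt_dec _ d) as [Hw|Hw].
    + specialize (Hn w Hw). pose proof (E2 w) as Ew.
      assert (Eq : (f z = f w - q w * (w - z))%C) by (rewrite Ew; ring).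
      replace (- q w * / (f w * f z) * (w - z))%C with (((f w - q w * (w - z)) - f w) * /
        (f w * f z))%C by ring.
      rewrite <- Eq. field. auto.
    (* Away from [z] the value [f w] may be 0. With both inverses abstracted, [field] asks only for
       [w - z <> 0]. *)
    + generalize (/ f w)%C (/ f z)%C. intros u v. field. apply Cmod_gt_0. lra.
Qed.

Lemma cderiv_intro f z l :
  (forall eps, 0 < eps -> exists d, 0 < d /\ forall w, Cmod (w - z) < d ->
     Cmod (f w - f z - (w - z) * l) <= eps * Cmod (w - z)) -> cderiv f z l.
Proof.
  intros D.
  exists (fun w => match excluded_middle_informative (w = z) with
           | left _ => l | right _ => ((f w - f z) / (w - z))%C end).
  split; [|split].
  - intros eps He. destruct (D (eps / 2)) as [d [Hd0 Hd]]; [lra|].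
    exists d. split; auto. intros w Hw.
    destruct (excluded_middle_informative (z = z)) as [_|N]; [|tauto].
    destruct (excluded_middle_informative (w = z)) as [->|N].
    + rewrite Cmod_sub_self. auto.
    + specialize (Hd w Hw).
      assert (Nz := Csub_neq_0 w z N).
      replace ((f w - f z) / (w - z) - l)%C with (((f w - f z) - (w - z) * l) / (w - z))%C
        by (field; auto).
      rewrite Cmod_div by auto. assert (P := Cmod_pos_sub w z N).
      apply Rle_lt_trans with (eps / 2); [|lra].
      apply Rmult_le_reg_r with (Cmod (w - z)); auto.
      match goal with |- ?a / ?b * ?b <= _ => replace (a / b * b) with a by (field; lra) end.
      auto.
  - destruct (excluded_middle_informative (z = z)); tauto.
  - intros w. destruct (excluded_middle_informative (w = z)) as [->|N]; [ring|].
    field. apply Csub_neq_0; auto.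
Qed.

Lemma cderiv_is_derive f z l :
  cderiv f z l <-> is_derive (K:=C_AbsRing) (V:=C_NormedModule) f z l.
Proof.
  split.
  - intros [q [Hq [E1 E2]]]. split.
    + apply is_linear_scal_l.
    + intros x Hx. apply (is_filter_lim_locally_unique (K:=C_AbsRing)
      (V:=AbsRing_NormedModule C_AbsRing)) in Hx. subst x.
      intros eps. destruct (Hq eps (cond_pos eps)) as [d [Hd H]].
      exists (mkposreal d Hd). intros w Hw.
      change (Cmod (w - z) < d) in Hw.
      change (Cmod ((f w - f z) - ((w - z) * l)) <= eps * Cmod (w - z)).
      rewrite (E2 w), <- E1.
      replace (f z + q w * (w - z) - f z - (w - z) * q z)%C with ((q w - q z) * (w - z))%C by ring.
      rewrite Cmod_mult. apply Rmult_le_compat_r; [apply Cmod_ge_0|]. left; auto.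
  - intros [_ H]. apply cderiv_intro. intros eps He.
    destruct (H z (fun P HP => HP) (mkposreal eps He)) as [d Hd].
    exists d. split; [apply cond_pos|]. intros w Hw. apply (Hd w Hw).
Qed.

Definition cexp (z : C) : C := (exp (fst z) * cos (snd z), exp (fst z) * sin (snd z)).
Definition cis (t : R) : C := (cos t, sin t).

(** * Integrals of complex-valued functions and over rectangles *)

Definition rcont (g : R -> C) (t : R) : Prop :=
  forall eps : R, 0 < eps -> exists delta : R, 0 < delta /\
    forall s, Rabs (s - t) < delta -> Cmod (g s - g t) < eps.

Notation CR := C_R_CompleteNormedModule.
Notation cint := (RInt (V := CR)).

Lemma norm_Cmod (z : CR) : norm z = Cmod z.
Proof.
  unfold Cmod. change (norm z) with (sqrt (Rabs (fst z) ^ 2 + Rabs (snd z) ^ 2)).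
  f_equal. rewrite !pow2_abs. reflexivity.
Qed.

Lemma rcont_continuous g t : rcont g t <-> continuous (U := CR) g t.
Proof.
  split.
  - intros H. apply filterlim_locally. intros eps.
    destruct (H eps (cond_pos eps)) as [d [Hd K]]. exists (mkposreal d Hd).
    intros s Hs. apply C_NormedModule_mixin_compat1. apply (K s Hs).
  - intros H eps He. 
    (* Balls of the product structure are squares, so the modulus can exceed the radius by a factor
       [sqrt 2]; halving [eps] pays for it. *)
    assert (He2 : 0 < eps / 2) by lra.
    destruct (proj1 (filterlim_locally (F := locally t) (U := CR) g (g t)) H (mkposreal _ He2)) as [d Hd].
    exists d. split; [apply cond_pos|]. intros s Hs.
    eapply Rlt_le_trans; [apply C_NormedModule_mixin_compat2; apply (Hd s Hs)|].
    simpl. assert (sqrt 2 <= 2); [|nra].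
    rewrite <- (sqrt_square 2) at 2 by lra. apply sqrt_le_1; lra.
Qed.

Lemma rcont_comp f g t : rcont g t -> ccont f (g t) -> rcont (fun s => f (g s)) t.
Proof.
  intros Hg Hf eps He. destruct (Hf eps He) as [d [Hd H]].
  destruct (Hg d Hd) as [d' [Hd' H']]. exists d'. split; auto.
Qed.

(** Again Caratheodory's form, so that the chain rule with [cderiv] is a multiplication of
    slopes. *)
Definition rderiv (g : R -> C) (t : R) (l : C) : Prop :=
  exists q : R -> C, rcont q t /\ q t = l /\ forall s, g s = (g t + q s * (RtoC (s - t)))%C.

(** Transfers the continuity rules proved for [ccont] to functions of a real variable. *)
Lemma rcont_ccont (g : R -> C) t : rcont g t <-> ccont (fun w => g (fst w)) (RtoC t).
Proof.
  split; intros H eps He; destruct (H eps He) as [d [Hd K]]; exists d; split; auto.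
  - intros w Hw. apply K. eapply Rle_lt_trans; [|exact Hw].
    apply (re_le_Cmod (w - RtoC t)).
  - intros s Hs. apply (K (RtoC s)). rewrite <- RtoC_minus, Cmod_R. exact Hs.
Qed.

Lemma rderiv_comp f g t l m : rderiv g t m -> cderiv f (g t) l ->
  rderiv (fun s => f (g s)) t (l * m)%C.
Proof.
  intros [p [Hp [E3 E4]]] [q [Hq [E1 E2]]].
  assert (Cg : rcont g t).
  { apply rcont_ccont.
    apply (ccont_ext_loc (fun w => (g t + p (fst w) * RtoC (fst w - t))%C) _ _ 1); [lra|intros; symmetry;
      apply E4|].
    apply rcont_ccont in Hp.
    apply ccont_plus; [apply ccont_const|]. apply ccont_mult; auto.
    intros eps He. exists eps. split; auto. intros w Hw. simpl.
    rewrite <- RtoC_minus, Cmod_R. eapply Rle_lt_trans; [|exact Hw].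
    replace (fst w - t - (t - t)) with (fst (w - RtoC t)%C) by (simpl; ring).
    apply (re_le_Cmod (w - RtoC t)). }
  exists (fun s => (q (g s) * p s)%C). split; [|split].
  - apply rcont_ccont. apply (ccont_mult (fun w => q (g (fst w))) (fun w => p (fst w))).
    + apply (ccont_comp q (fun w => g (fst w))); [apply rcont_ccont; auto|auto].
    + apply rcont_ccont; auto.
  - rewrite E1, E3; auto.
  - intros s. rewrite (E2 (g s)). rewrite (E4 s) at 2. ring.
Qed.

Lemma CR_increment (u v l : C) (w t : R) :
  minus (minus (G := CR) u v) (scal (V := CR) (minus w t) l) = (u - v - RtoC (w - t) * l)%C.
Proof.
  change (minus (minus (G := CR) u v) (scal (V:=CR) (minus w t) l))
    with (u - v - (((w - t) * fst l)%R, ((w - t) * snd l)%R))%C.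
  f_equal. f_equal. unfold RtoC, Cmult; simpl. f_equal; ring.
Qed.

Lemma rderiv_is_derive g t l : rderiv g t l <-> is_derive (V := CR) g t l.
Proof.
  split.
  - intros [q [Hq [E1 E2]]]. split.
    + apply (is_linear_scal_l (V := CR)).
    + intros x Hx. apply (is_filter_lim_locally_unique (K:=R_AbsRing) (V:=R_NormedModule)) in Hx. subst x.
      intros eps. destruct (Hq eps (cond_pos eps)) as [d [Hd H]].
      exists (mkposreal d Hd). intros w Hw.
      change (Rabs (w - t) < d) in Hw.
      change (norm (minus (minus (G := CR) (g w) (g t)) (scal (V := CR) (minus w t) l)) <= eps * Rabs (w - t)).
      rewrite norm_Cmod, CR_increment, (E2 w), <- E1.
      replace (g t + q w * RtoC (w - t) - g t - RtoC (w - t) * q t)%C with ((q w - q t) * RtoC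
        (w - t))%C by ring.
      rewrite Cmod_mult, Cmod_R. apply Rmult_le_compat_r; [apply Rabs_pos|]. left; auto.
  - intros H.
    assert (D : forall eps : posreal,
      locally (T := R_UniformSpace) t (fun w => Cmod ((g w - g t) - (RtoC (w - t) * l)) <= eps * Rabs (w - t))).
    { intros eps. destruct H as [_ H]. destruct (H t (fun P HP => HP) eps) as [d Hd].
      exists d. intros w Hw. specialize (Hd w Hw). simpl in Hd. rewrite norm_Cmod in Hd.
      rewrite CR_increment in Hd. exact Hd. }
    exists (fun w => match Req_EM_T w t with
             | left _ => l | right _ => ((g w - g t) / RtoC (w - t))%C end).
    split; [|split].
    + intros eps He. destruct (D (mkposreal (eps/2) ltac:(lra))) as [d Hd].
      exists d. split; [apply cond_pos|]. intros w Hw.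
      destruct (Req_EM_T t t) as [_|N]; [|tauto].
      destruct (Req_EM_T w t) as [->|N].
      * rewrite Cmod_sub_self. auto.
      * specialize (Hd w Hw). simpl in Hd.
        assert (Nz : RtoC (w - t) <> 0%C) by (intros E; apply RtoC_inj in E; lra).
        replace ((g w - g t) / RtoC (w - t) - l)%C with (((g w - g t) - RtoC (w - t) * l) / RtoC (w - t))%C
          by (field; auto).
        rewrite Cmod_div by auto. rewrite Cmod_R.
        assert (P : 0 < Rabs (w - t)) by (apply Rabs_pos_lt; lra).
        apply Rle_lt_trans with (eps / 2); [|lra].
        apply Rmult_le_reg_r with (Rabs (w - t)); auto.
        match goal with |- ?a / ?b * ?b <= _ => replace (a / b * b) with a by (field; lra) end. auto.
    + destruct (Req_EM_T t t); tauto.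
    + intros w. destruct (Req_EM_T w t) as [->|N]; [rewrite Rminus_diag; ring|].
      field. intros E; apply RtoC_inj in E; lra.
Qed.

Lemma rderiv_rcont g t l : rderiv g t l -> rcont g t.
Proof.
  intros H. apply rcont_continuous. apply rderiv_is_derive in H.
  apply (ex_derive_continuous (V := CR) g). exists l. auto.
Qed.

Lemma Cmod_le_abs (x y : R) : Cmod (x, y) <= Rabs x + Rabs y.
Proof.
  replace ((x, y) : C) with (RtoC x + Ci * RtoC y)%C.
  - eapply Rle_trans; [apply Cmod_triangle|]. rewrite Cmod_mult, Cmod_Ci, !Cmod_R. lra.
  - unfold RtoC, Ci, Cmult, Cplus; simpl. f_equal; ring.
Qed.

Lemma rderiv_pair (p q : R -> R) t p' q' : is_derive p t p' -> is_derive q t q' ->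
  rderiv (fun s => (p s, q s)) t (p', q').
Proof.
  intros Hp Hq. apply is_derive_Reals in Hp. apply is_derive_Reals in Hq.
  exists (fun s => match Req_EM_T s t with left _ => (p', q')
     | right _ => ((p s - p t) / (s - t), (q s - q t) / (s - t)) end).
  split; [|split].
  - intros eps He. destruct (Hp (eps / 2)) as [d1 H1]; [lra|]. destruct (Hq (eps / 2)) as [d2 H2]; [lra|].
    exists (Rmin d1 d2). split; [apply Rmin_pos; apply cond_pos|].
    intros s Hs. pose proof (Rmin_l d1 d2). pose proof (Rmin_r d1 d2).
    destruct (Req_EM_T t t) as [_|]; [|tauto].
    destruct (Req_EM_T s t) as [->|N]; [rewrite Cmod_sub_self; auto|].
    specialize (H1 (s - t) ltac:(lra) ltac:(lra)). specialize (H2 (s - t) ltac:(lra) ltac:(lra)).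
    replace (t + (s - t)) with s in H1, H2 by ring.
    eapply Rle_lt_trans; [apply Cmod_le_abs|]. simpl. unfold Rminus in *. lra.
  - destruct (Req_EM_T t t); tauto.
  - intros s. destruct (Req_EM_T s t) as [->|N].
    + unfold RtoC, Cmult, Cplus; simpl. f_equal; ring.
    + unfold RtoC, Cmult, Cplus; simpl. f_equal; field; lra.
Qed.

Lemma rderiv_fst g t l : rderiv g t l -> is_derive (fun s => fst (g s)) t (fst l).
Proof.
  intros H. apply rderiv_is_derive in H.
  apply (filterdiff_comp (K := R_AbsRing) (U := R_NormedModule) (V := CR) (W := R_NormedModule)
    g (@fst R R) (fun y => scal (V:=CR) y l) (@fst R R)) in H.
  2: apply filterdiff_linear, is_linear_fst.
  exact H.
Qed.

Lemma rderiv_snd g t l : rderiv g t l -> is_derive (fun s => snd (g s)) t (snd l).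
Proof.
  intros H. apply rderiv_is_derive in H.
  apply (filterdiff_comp (K := R_AbsRing) (U := R_NormedModule) (V := CR) (W := R_NormedModule)
    g (@snd R R) (fun y => scal (V:=CR) y l) (@snd R R)) in H.
  2: apply filterdiff_linear, is_linear_snd.
  exact H.
Qed.

Lemma ex_cint g a b : a <= b -> (forall t, a <= t <= b -> rcont g t) -> ex_RInt (V := CR) g a b.
Proof.
  intros Hab H. apply (ex_RInt_continuous (V := CR)). intros t Ht.
  rewrite Rmin_left, Rmax_right in Ht by auto. apply rcont_continuous; auto.
Qed.

Lemma cint_bound g a b M : a <= b -> (forall t, a <= t <= b -> rcont g t) ->
  (forall t, a <= t <= b -> Cmod (g t) <= M) -> Cmod (cint g a b) <= M * (b - a).
Proof.
  intros Hab Hc HM. rewrite <- norm_Cmod, Rmult_comm.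
  replace ((b - a) * M) with (scal (V := R_NormedModule) (b - a) M) by reflexivity.
  apply (norm_RInt_le (V := CR) g (fun _ => M) a b); auto.
  - intros t Ht. rewrite norm_Cmod. auto.
  - apply RInt_correct, ex_cint; auto.
  - apply (is_RInt_const (V := R_NormedModule)).
Qed.

Lemma is_RInt_Cmult (g : R -> C) a b l c : is_RInt (V := CR) g a b l ->
  is_RInt (V := CR) (fun t => (c * g t)%C) a b (c * l)%C.
Proof.
  intros H.
  pose proof (is_RInt_fct_extend_fst g a b l H) as H1.
  pose proof (is_RInt_fct_extend_snd g a b l H) as H2.
  apply (is_RInt_fct_extend_pair (U := R_NormedModule) (V := R_NormedModule)).
  - apply (is_RInt_ext (fun t => minus (scal (fst c) (fst (g t))) (scal (snd c) (snd (g t))))).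
    + intros t _. reflexivity.
    + apply (is_RInt_minus (V := R_NormedModule)); apply (is_RInt_scal (V := R_NormedModule)); auto.
  - apply (is_RInt_ext (fun t => plus (scal (fst c) (snd (g t))) (scal (snd c) (fst (g t))))).
    + intros t _. reflexivity.
    + apply (is_RInt_plus (V := R_NormedModule)); apply (is_RInt_scal (V := R_NormedModule)); auto.
Qed.

Lemma cint_Cmult g a b c : ex_RInt (V := CR) g a b -> cint (fun t => (c * g t)%C) a b = (c * cint g a b)%C.
Proof. intros H. apply is_RInt_unique, is_RInt_Cmult, RInt_correct, H. Qed.

Lemma cint_deriv (g h : R -> C) a b : a <= b ->
  (forall t, a <= t <= b -> rderiv g t (h t)) -> (forall t, a <= t <= b -> rcont h t) ->
  cint h a b = (g b - g a)%C.
Proof.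
  intros Hab H1 H2. apply is_RInt_unique. apply (is_RInt_derive (V := CR) g h);
    intros t Ht; rewrite Rmin_left, Rmax_right in Ht by auto.
  - apply rderiv_is_derive; auto.
  - apply rcont_continuous; auto.
Qed.

Lemma rderiv_horizontal c t : rderiv (fun x => (x, c)) t 1%C.
Proof. apply (rderiv_pair (fun x => x) (fun _ => c));
[apply (is_derive_id (K:=R_AbsRing))|apply (is_derive_const (K:=R_AbsRing)(V:=R_NormedModule))]. Qed.

Lemma rderiv_vertical c t : rderiv (fun y => (c, y)) t Ci.
Proof. apply (rderiv_pair (fun _ => c) (fun x => x));
[apply (is_derive_const (K:=R_AbsRing)(V:=R_NormedModule))|apply (is_derive_id (K:=R_AbsRing))]. Qed.

(** The counterclockwise contour integral over the boundary; [Ci] stands for [dz = i dy] on the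
    vertical sides. *)
Definition rect_int (f : C -> C) (a b c d : R) : C :=
  (cint (fun x => f (x, c)) a b - cint (fun x => f (x, d)) a b
   + Ci * (cint (fun y => f (b, y)) c d - cint (fun y => f (a, y)) c d))%C.

Definition ccont_rect (f : C -> C) a b c d :=
  forall x y, a <= x <= b -> c <= y <= d -> ccont f (x, y).

Lemma ex_cint_horizontal f a b c : a <= b -> (forall x, a <= x <= b -> ccont f (x, c)) ->
  ex_RInt (V := CR) (fun x => f (x, c)) a b.
Proof.
  intros Hab H. apply ex_cint; auto. intros t Ht.
  apply (rcont_comp f (fun x => (x, c))); auto. eapply rderiv_rcont, rderiv_horizontal.
Qed.

Lemma ex_cint_vertical f a b c : a <= b -> (forall x, a <= x <= b -> ccont f (c, x)) ->
  ex_RInt (V := CR) (fun x => f (c, x)) a b.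
Proof.
  intros Hab H. apply ex_cint; auto. intros t Ht.
  apply (rcont_comp f (fun x => (c, x))); auto. eapply rderiv_rcont, rderiv_vertical.
Qed.

(** The sides telescope through the values of [F] at the corners. Goursat's argument applies this to
    affine functions only, so a primitive on the whole plane may be demanded. *)
Lemma rect_int_primitive F f a b c d : a <= b -> c <= d ->
  (forall w, cderiv F w (f w)) -> (forall w, ccont f w) -> rect_int f a b c d = 0%C.
Proof.
  intros Hab Hcd HF Hf.
  assert (Hh : forall e, cint (fun x => f (x, e)) a b = (F (b, e) - F (a, e))%C).
  { intros e. apply (cint_deriv (fun x => F (x, e))); auto.
    - intros t _. replace (f (t, e)) with (f (t, e) * 1)%C by ring.
      apply (rderiv_comp F (fun x => (x, e))); auto. apply rderiv_horizontal.
    - intros t _. apply (rcont_comp f (fun x => (x, e))); auto. eapply rderiv_rcont, rderiv_horizontal. }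
  assert (Hv : forall e, (Ci * cint (fun x => f (e, x)) c d)%C = (F (e, d) - F (e, c))%C).
  { intros e. rewrite <- cint_Cmult by (apply ex_cint_vertical; auto).
    apply (cint_deriv (fun x => F (e, x))); auto.
    - intros t _. replace (Ci * f (e, t))%C with (f (e, t) * Ci)%C by ring.
      apply (rderiv_comp F (fun x => (e, x))); auto. apply rderiv_vertical.
    - intros t _. apply (rcont_comp (fun w => Ci * f w)%C (fun x => (e, x))); auto.
      + eapply rderiv_rcont, rderiv_vertical.
      + apply ccont_mult; auto. apply ccont_const. }
  unfold rect_int.
  replace (Ci * (cint (fun y => f (b, y)) c d - cint (fun y => f (a, y)) c d))%C
    with (Ci * cint (fun y => f (b, y)) c d - Ci * cint (fun y => f (a, y)) c d)%C by ring.
  rewrite !Hh, !Hv. ring.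
Qed.

Lemma cint_minus g h a b : ex_RInt (V := CR) g a b -> ex_RInt (V := CR) h a b ->
  cint (fun t => (g t - h t)%C) a b = (cint g a b - cint h a b)%C.
Proof. intros Hg Hh. apply (RInt_minus (V := CR) g h a b Hg Hh). Qed.

Lemma rect_int_minus f g a b c d : a <= b -> c <= d ->
  ccont_rect f a b c d -> ccont_rect g a b c d ->
  rect_int (fun w => (f w - g w)%C) a b c d = (rect_int f a b c d - rect_int g a b c d)%C.
Proof.
  intros Hab Hcd Hf Hg.
  assert (Hh : forall e, c <= e <= d -> cint (fun x => (f (x, e) - g (x, e))%C) a b =
     (cint (fun x => f (x, e)) a b - cint (fun x => g (x, e)) a b)%C).
  { intros e He. apply (cint_minus (fun x => f (x, e)) (fun x => g (x, e)));
      apply ex_cint_horizontal; auto. }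
  assert (Hv : forall e, a <= e <= b -> cint (fun x => (f (e, x) - g (e, x))%C) c d =
     (cint (fun x => f (e, x)) c d - cint (fun x => g (e, x)) c d)%C).
  { intros e He. apply (cint_minus (fun x => f (e, x)) (fun x => g (e, x)));
      apply ex_cint_vertical; auto. }
  unfold rect_int. rewrite (Hh c), (Hh d), (Hv a), (Hv b) by lra. ring.
Qed.

Lemma rect_int_bound f a b c d M : a <= b -> c <= d -> ccont_rect f a b c d ->
  (forall x y, a <= x <= b -> c <= y <= d -> Cmod (f (x, y)) <= M) ->
  Cmod (rect_int f a b c d) <= 2 * M * ((b - a) + (d - c)).
Proof.
  intros Hab Hcd Hf HM. unfold rect_int.
  assert (Hh : forall e, c <= e <= d -> Cmod (cint (fun x => f (x, e)) a b) <= M * (b - a)).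
  { intros e He. apply cint_bound; auto. intros t Ht.
    apply (rcont_comp f (fun x => (x, e))); auto. eapply rderiv_rcont, rderiv_horizontal. }
  assert (Hv : forall e, a <= e <= b -> Cmod (cint (fun x => f (e, x)) c d) <= M * (d - c)).
  { intros e He. apply cint_bound; auto. intros t Ht.
    apply (rcont_comp f (fun x => (e, x))); auto. eapply rderiv_rcont, rderiv_vertical. }
  eapply Rle_trans; [apply Cmod_triangle|].
  rewrite Cmod_mult, Cmod_Ci.
  pose proof (Cmod_triangle_sub (cint (fun x => f (x, c)) a b) (cint (fun x => f (x, d)) a b)).
  pose proof (Cmod_triangle_sub (cint (fun x => f (b, x)) c d) (cint (fun x => f (a, x)) c d)).
  pose proof (Hh c ltac:(lra)). pose proof (Hh d ltac:(lra)).
  pose proof (Hv a ltac:(lra)). pose proof (Hv b ltac:(lra)). lra.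
Qed.

Lemma rect_int_split_x f a m b c d : a <= m <= b -> c <= d -> ccont_rect f a b c d ->
  rect_int f a b c d = (rect_int f a m c d + rect_int f m b c d)%C.
Proof.
  intros Hm Hcd Hf. unfold rect_int.
  assert (E : forall e, c <= e <= d -> cint (fun x => f (x, e)) a b =
     (cint (fun x => f (x, e)) a m + cint (fun x => f (x, e)) m b)%C).
  { intros e He. symmetry. apply (RInt_Chasles (V := CR));
      apply ex_cint_horizontal; try lra; intros; apply Hf; lra. }
  rewrite !E by lra. ring.
Qed.

Lemma rect_int_split_y f a b c m d : a <= b -> c <= m <= d -> ccont_rect f a b c d ->
  rect_int f a b c d = (rect_int f a b c m + rect_int f a b m d)%C.
Proof.
  intros Hab Hm Hf. unfold rect_int.
  assert (E : forall e, a <= e <= b -> cint (fun x => f (e, x)) c d =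
     (cint (fun x => f (e, x)) c m + cint (fun x => f (e, x)) m d)%C).
  { intros e He. symmetry. apply (RInt_Chasles (V := CR));
      apply ex_cint_vertical; try lra; intros; apply Hf; lra. }
  rewrite !E by lra. ring.
Qed.

(** * Goursat's theorem *)

Lemma nested_intervals (u v : nat -> R) :
  (forall n, u n <= u (S n)) -> (forall n, v (S n) <= v n) -> (forall n, u n <= v n) ->
  exists x, forall n, u n <= x <= v n.
Proof.
  intros Hu Hv Huv.
  assert (Mu : forall n m, (n <= m)%nat -> u n <= u m).
  { intros n m H. induction H; [lra|]. specialize (Hu m). lra. }
  assert (Mv : forall n m, (n <= m)%nat -> v m <= v n).
  { intros n m H. induction H; [lra|]. specialize (Hv m). lra. }
  assert (Hb : forall n m, u n <= v m).
  { intros n m. apply Rle_trans with (u (max n m)); [apply Mu; lia|].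
    apply Rle_trans with (v (max n m)); [auto|apply Mv; lia]. }
  destruct (completeness (fun x => exists n, x = u n)) as [x [Hx1 Hx2]].
  - exists (v 0%nat). intros x [n ->]. auto.
  - exists (u 0%nat), 0%nat. auto.
  - exists x. intros n. split.
    + apply Hx1. exists n. auto.
    + apply Hx2. intros y [m ->]. auto.
Qed.

(** The integrals over the four quarters add up to the whole one, so they cannot all have modulus
    below a quarter of it. *)
Lemma quarter_rect f x y h k : 0 <= h -> 0 <= k -> ccont_rect f x (x + h) y (y + k) ->
  exists x' y', x <= x' /\ x' + h / 2 <= x + h /\ y <= y' /\ y' + k / 2 <= y + k /\
    Cmod (rect_int f x (x + h) y (y + k)) <=
    4 * Cmod (rect_int f x' (x' + h / 2) y' (y' + k / 2)).
Proof.
  intros Hh Hk Hf. apply NNPP. intros N.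
  assert (A : forall x' y', x <= x' -> x' + h / 2 <= x + h -> y <= y' -> y' + k / 2 <= y + k ->
     4 * Cmod (rect_int f x' (x' + h / 2) y' (y' + k / 2)) < Cmod (rect_int f x (x + h) y (y + k))).
  { intros x' y' H1 H2 H3 H4. apply Rnot_le_lt. intros H. apply N. exists x', y'. auto. }
  pose proof (A x y ltac:(lra) ltac:(lra) ltac:(lra) ltac:(lra)) as A1.
  pose proof (A x (y + k / 2) ltac:(lra) ltac:(lra) ltac:(lra) ltac:(lra)) as A2.
  pose proof (A (x + h / 2) y ltac:(lra) ltac:(lra) ltac:(lra) ltac:(lra)) as A3.
  pose proof (A (x + h / 2) (y + k / 2) ltac:(lra) ltac:(lra) ltac:(lra) ltac:(lra)) as A4.
  replace (y + k / 2 + k / 2) with (y + k) in * by field.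
  replace (x + h / 2 + h / 2) with (x + h) in * by field.
  assert (E : rect_int f x (x + h) y (y + k) =
    (rect_int f x (x + h / 2) y (y + k / 2) + rect_int f x (x + h / 2) (y + k / 2) (y + k)
     + (rect_int f (x + h / 2) (x + h) y (y + k / 2) + rect_int f (x + h / 2) (x + h) (y + k / 2) (y + k)))%C).
  { rewrite (rect_int_split_x f x (x + h / 2) (x + h)) by (auto; lra).
    rewrite (rect_int_split_y f x (x + h / 2) y (y + k / 2) (y + k)),
      (rect_int_split_y f (x + h / 2) (x + h) y (y + k / 2) (y + k)); try lra; auto;
      intros s t Hs Ht; apply Hf; lra. }
  pose proof (f_equal Cmod E) as E'.
  pose proof (Cmod_triangle (rect_int f x (x + h / 2) y (y + k / 2) + rect_int f x (x + h / 2) (y + k / 2)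
    (y + k))
    (rect_int f (x + h / 2) (x + h) y (y + k / 2) + rect_int f (x + h / 2) (x + h) (y + k / 2) (y + k))).
  pose proof (Cmod_triangle (rect_int f x (x + h / 2) y (y + k / 2)) (rect_int f x (x + h / 2) (y + k / 2)
    (y + k))).
  pose proof (Cmod_triangle (rect_int f (x + h / 2) (x + h) y (y + k / 2)) (rect_int f (x + h / 2) (x + h)
    (y + k / 2) (y + k))).
  lra.
Qed.

Theorem goursat f x0 y0 h k : 0 <= h -> 0 <= k ->
  (forall x y, x0 <= x <= x0 + h -> y0 <= y <= y0 + k -> exists l, cderiv f (x, y) l) ->
  rect_int f x0 (x0 + h) y0 (y0 + k) = 0%C.
Proof.
  intros Hh Hk Hf.
  assert (Cf : ccont_rect f x0 (x0 + h) y0 (y0 + k)).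
  { intros x y Hx Hy. destruct (Hf x y Hx Hy) as [l Hl]. eapply cderiv_ccont; eauto. }
  set (J0 := Cmod (rect_int f x0 (x0 + h) y0 (y0 + k))).
  set (Inv := fun (n : nat) (p : R * R) =>
    x0 <= fst p /\ fst p + h / 2 ^ n <= x0 + h /\ y0 <= snd p /\ snd p + k / 2 ^ n <= y0 + k /\
    J0 <= 4 ^ n * Cmod (rect_int f (fst p) (fst p + h / 2 ^ n) (snd p) (snd p + k / 2 ^ n))).
  assert (P2 : forall n, 0 < 2 ^ n) by (intros; apply pow_lt; lra).
  assert (Hdiv : forall c n, c / 2 ^ S n = c / 2 ^ n / 2).
  { intros c n. specialize (P2 n). simpl. field. lra. }
  assert (Hpos : forall c n, 0 <= c -> 0 <= c / 2 ^ n).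
  { intros c n Hc. apply Rmult_le_pos; [auto|]. left. apply Rinv_0_lt_compat; auto. }
  (* The invariant sits under the existential quantifier, so that choice produces a total step
     function. *)
  assert (Hstep : forall (n : nat) (p : R * R), exists p' : R * R, Inv n p ->
    Inv (S n) p' /\ fst p <= fst p' /\ fst p' + h / 2 ^ S n <= fst p + h / 2 ^ n /\
    snd p <= snd p' /\ snd p' + k / 2 ^ S n <= snd p + k / 2 ^ n).
  { intros n p. destruct (classic (Inv n p)) as [I|I]; [|exists p; tauto].
    destruct I as [I1 [I2 [I3 [I4 I5]]]].
    destruct (quarter_rect f (fst p) (snd p) (h / 2 ^ n) (k / 2 ^ n)) as [x' [y' [Q1 [Q2 [Q3 [Q4 Q5]]]]]]; auto.
    { intros s t Hs Ht. apply Cf; lra. }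
    exists (x', y'). intros _. unfold Inv. rewrite !Hdiv. cbn [fst snd].
    repeat split; try lra.
    change (4 ^ S n) with (4 * 4 ^ n). eapply Rle_trans; [exact I5|].
    rewrite (Rmult_comm 4), Rmult_assoc. apply Rmult_le_compat_l; [|exact Q5].
    apply pow_le; lra. }
  set (next := fun n p => proj1_sig (constructive_indefinite_description _ (Hstep n p))).
  set (p := fix p n := match n with O => (x0, y0) | S n => next n (p n) end).
  assert (HI : forall n, Inv n (p n)).
  { induction n as [|n IH].
    - unfold Inv. cbn [fst snd p pow]. unfold Rdiv. rewrite Rinv_1, !Rmult_1_r, Rmult_1_l. fold J0. lra.
    - apply (proj2_sig (constructive_indefinite_description _ (Hstep n (p n)))); auto. }
  assert (HN : forall n, fst (p n) <= fst (p (S n)) /\ fst (p (S n)) + h / 2 ^ S n <= fst (p n) + h / 2 ^ n /\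
    snd (p n) <= snd (p (S n)) /\ snd (p (S n)) + k / 2 ^ S n <= snd (p n) + k / 2 ^ n).
  { intros n. apply (proj2_sig (constructive_indefinite_description _ (Hstep n (p n)))); auto. }
  destruct (nested_intervals (fun n => fst (p n)) (fun n => fst (p n) + h / 2 ^ n)) as [x Hx].
  { intros n. apply HN. } { intros n. apply HN. } { intros n. specialize (Hpos h n Hh). lra. }
  destruct (nested_intervals (fun n => snd (p n)) (fun n => snd (p n) + k / 2 ^ n)) as [y Hy].
  { intros n. apply HN. } { intros n. apply HN. } { intros n. specialize (Hpos k n Hk). lra. }
  destruct (Hf x y) as [l [q [Hq [El E]]]].
  { specialize (Hx 0%nat). simpl in Hx. lra. } { specialize (Hy 0%nat). simpl in Hy. lra. }
  apply Cmod_eq_0. fold J0.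
  destruct (Rle_lt_or_eq_dec 0 J0) as [JP|JP]; [apply Cmod_ge_0| |auto]. exfalso.
  (* A bound for the diameter, positive even for a degenerate rectangle. With the tolerance
     [J0 / (4 * D * D)] the estimate below closes as [J0 <= J0 / 2]. *)
  set (D := h + k + 1). assert (HD : 0 < D) by (unfold D; lra).
  destruct (Hq (J0 / (4 * D * D))) as [d [Hd Hd']].
  { apply Rdiv_lt_0_compat; [auto|]. repeat apply Rmult_lt_0_compat; lra. }
  (* Then [m = n + 1] exceeds [D / d], and [2 ^ m > m] makes the [m]-th rectangle fit into the disc
     of radius [d]. *)
  destruct (nfloor_ex (D / d)) as [n Hn]; [apply Rlt_le, Rdiv_lt_0_compat; lra|].
  set (m := S n).
  assert (Hm : D / 2 ^ m < d).
  { assert (INR m < 2 ^ m).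
    { clear. unfold m. induction (S n) as [|j IH]; [simpl; lra|].
      rewrite S_INR. simpl pow. assert (1 <= 2 ^ j) by (apply pow_R1_Rle; lra).
      destruct j; [simpl; lra|]. rewrite S_INR in *. pose proof (pos_INR j). simpl pow in *. lra. }
    unfold m in *. rewrite S_INR in H. specialize (P2 (S n)).
    apply Rmult_lt_reg_r with (2 ^ S n); auto.
    unfold Rdiv. rewrite Rmult_assoc, Rinv_l, Rmult_1_r by lra.
    apply Rmult_lt_reg_r with (/ d); [apply Rinv_0_lt_compat; auto|].
    replace (d * 2 ^ S n * / d) with (2 ^ S n) by (field; lra). unfold Rdiv in Hn. lra. }
  specialize (Hx m). specialize (Hy m). destruct (HI m) as [I1 [I2 [I3 [I4 I5]]]].
  set (a := fst (p m)) in *. set (b := snd (p m)) in *.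
  set (hm := h / 2 ^ m) in *. set (km := k / 2 ^ m) in *.
  assert (Hhm : 0 <= hm) by (apply Hpos; auto). assert (Hkm : 0 <= km) by (apply Hpos; auto).
  assert (Hsum : hm + km < D / 2 ^ m).
  { unfold hm, km, D. specialize (P2 m). apply Rmult_lt_reg_r with (2 ^ m); auto. field_simplify; lra. }
  set (w0 := (x, y) : C).
  (* The affine part of [f] at the limit point has a primitive and integrates to 0; only the
     remainder, small compared with the side lengths, is left. *)
  set (lin := fun w : C => (f w0 + l * (w - w0))%C).
  assert (Cl : forall w, ccont lin w).
  { intros w. apply ccont_plus; [apply ccont_const|]. apply ccont_mult; [apply ccont_const|].
    apply ccont_minus; [apply ccont_id|apply ccont_const]. }
  assert (L0 : rect_int lin a (a + hm) b (b + km) = 0%C).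
  { apply (rect_int_primitive (fun w => (f w0 * w + (l / 2) * ((w - w0) * (w - w0)))%C)); try lra; auto.
    intros w. replace (lin w) with (f w0 * 1 + (l / 2) * ((1 - 0) * (w - w0) + (w - w0) * (1 - 0)))%C.
    - apply cderiv_plus; [apply cderiv_scal, cderiv_id|]. apply cderiv_scal.
      apply (cderiv_mult (fun w => (w - w0)%C) (fun w => (w - w0)%C)); apply cderiv_minus;
        try apply cderiv_id; apply cderiv_const.
    - unfold lin. field. }
  assert (CfR : ccont_rect f a (a + hm) b (b + km)) by (intros s t Hs Ht; apply Cf; lra).
  assert (ClR : ccont_rect lin a (a + hm) b (b + km)) by (intros s t Hs Ht; apply Cl).
  assert (B : Cmod (rect_int (fun w => (f w - lin w)%C) a (a + hm) b (b + km))
     <= 2 * (J0 / (4 * D * D) * (D / 2 ^ m)) * ((a + hm - a) + (b + km - b))).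
  { apply rect_int_bound; try lra.
    - intros s t Hs Ht. apply ccont_minus; auto.
    - intros s t Hs Ht. unfold lin. rewrite (E (s, t)). fold w0.
      replace (f w0 + q (s, t) * ((s, t) - w0) - (f w0 + l * ((s, t) - w0)))%C
        with ((q (s, t) - l) * ((s, t) - w0))%C by ring.
      assert (Dw : Cmod ((s, t) - w0) < D / 2 ^ m).
      { eapply Rle_lt_trans; [|exact Hsum]. unfold w0.
        replace ((s, t) - (x, y))%C with ((s - x, t - y)%R : C) by (unfold Cminus, Cplus, Copp; simpl; f_equal).
        eapply Rle_trans; [apply Cmod_le_abs|].
        apply Rplus_le_compat; apply Rabs_le; lra. }
      rewrite Cmod_mult. apply Rmult_le_compat; try apply Cmod_ge_0; [|lra].
      rewrite <- El. left. apply (Hd' (s, t)). fold w0. lra. }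
  rewrite rect_int_minus, L0 in B by (auto; lra).
  replace (rect_int f a (a + hm) b (b + km) - 0)%C with (rect_int f a (a + hm) b (b + km)) in B by ring.
  assert (B2 : J0 <= 4 ^ m * (2 * (J0 / (4 * D * D) * (D / 2 ^ m)) * (D / 2 ^ m))).
  { eapply Rle_trans; [exact I5|]. apply Rmult_le_compat_l; [apply pow_le; lra|].
    eapply Rle_trans; [exact B|]. apply Rmult_le_compat_l; [|lra].
    specialize (P2 m). assert (0 < J0 / (4 * D * D)) by (apply Rdiv_lt_0_compat; [auto|];
    repeat apply Rmult_lt_0_compat; lra).
    assert (0 < D / 2 ^ m) by (apply Rdiv_lt_0_compat; auto).
    apply Rmult_le_pos; [lra|]. apply Rmult_le_pos; lra. }
  replace (4 ^ m) with (2 ^ m * 2 ^ m) in B2 by (rewrite <- Rpow_mult_distr; f_equal; ring).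
  replace (2 ^ m * 2 ^ m * (2 * (J0 / (4 * D * D) * (D / 2 ^ m)) * (D / 2 ^ m))) with (J0 / 2) in B2.
  - lra.
  - specialize (P2 m). field. split; lra.
Qed.

(** * Circular means of holomorphic functions *)

Lemma cexp_plus z w : cexp (z + w) = (cexp z * cexp w)%C.
Proof.
  unfold cexp, Cmult, Cplus; simpl. rewrite exp_plus, cos_plus, sin_plus. f_equal; ring.
Qed.

Lemma Cmod_cis t : Cmod (cis t) = 1.
Proof.
  transitivity (sqrt 1); [|apply sqrt_1]. unfold Cmod, cis. f_equal.
  pose proof (sin2_cos2 t). unfold Rsqr in *. simpl. lra.
Qed.

Lemma cexp_cis z : cexp z = (RtoC (exp (fst z)) * cis (snd z))%C.
Proof. unfold cexp, cis, RtoC, Cmult; simpl. f_equal; ring. Qed.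

Lemma Cmod_cexp z : Cmod (cexp z) = exp (fst z).
Proof. rewrite cexp_cis, Cmod_mult, Cmod_cis, Cmod_R, Rabs_pos_eq by (left; apply exp_pos). ring. Qed.

Lemma derive_bound (f : R -> R) x l : is_derive f x l ->
  forall eps, 0 < eps -> exists d, 0 < d /\ forall y, Rabs (y - x) < d ->
    Rabs (f y - f x - (y - x) * l) <= eps * Rabs (y - x).
Proof.
  intros [_ H] eps He. destruct (H x (fun P HP => HP) (mkposreal eps He)) as [d Hd].
  exists d. split; [apply cond_pos|]. intros y Hy. apply (Hd y Hy).
Qed.

Lemma abs_fst_le (z : C) : Rabs (fst z) <= Cmod z.
Proof. apply (re_le_Cmod z). Qed.

Lemma abs_snd_le (z : C) : Rabs (snd z) <= Cmod z.
Proof. eapply Rle_trans; [|apply Rmax_Cmod]. apply Rmax_r. Qed.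

Lemma cderiv_cexp_0 : cderiv cexp 0%C 1%C.
Proof.
  apply cderiv_intro. intros eps He.
  (* The error at [(x, y)] splits into five products bounded by 1, 2, 1, 2 and 1 times [e * m], and
     7 is below 8. The cap at 1 keeps [1 + x] below 2. *)
  set (e := Rmin 1 (eps / 8)).
  assert (E1 : 0 < e) by (apply Rmin_pos; lra).
  assert (E2 : e <= 1) by apply Rmin_l. assert (E3 : e <= eps / 8) by apply Rmin_r. clearbody e.
  destruct (derive_bound exp 0 (exp 0) (is_derive_exp 0) e E1) as [d1 [P1 H1]].
  destruct (derive_bound cos 0 (- sin 0) (is_derive_cos 0) e E1) as [d2 [P2 H2]].
  destruct (derive_bound sin 0 (cos 0) (is_derive_sin 0) e E1) as [d3 [P3 H3]].
  rewrite exp_0 in H1. rewrite sin_0, cos_0 in H2, H3.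
  exists (Rmin e (Rmin d1 (Rmin d2 d3))). split; [repeat apply Rmin_pos; auto|].
  intros w Hw.
  assert (W : Cmod w < e /\ Cmod w < d1 /\ Cmod w < d2 /\ Cmod w < d3).
  { replace (w - 0)%C with w in Hw by ring.
    pose proof (Rmin_l e (Rmin d1 (Rmin d2 d3))). pose proof (Rmin_r e (Rmin d1 (Rmin d2 d3))).
    pose proof (Rmin_l d1 (Rmin d2 d3)). pose proof (Rmin_r d1 (Rmin d2 d3)).
    pose proof (Rmin_l d2 d3). pose proof (Rmin_r d2 d3). lra. }
  destruct w as [x y].
  assert (Ax : Rabs x <= Cmod (x, y)) by apply (abs_fst_le (x, y)).
  assert (Ay : Rabs y <= Cmod (x, y)) by apply (abs_snd_le (x, y)).
  specialize (H1 x). specialize (H2 y). specialize (H3 y).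
  rewrite Rminus_0_r in H1, H2, H3.
  specialize (H1 ltac:(lra)). specialize (H2 ltac:(lra)). specialize (H3 ltac:(lra)).
  replace ((x, y) - 0)%C with ((x, y) : C) by (unfold Cminus, Cplus, Copp, RtoC; simpl; f_equal; ring).
  replace (cexp (x, y) - cexp 0 - (x, y) * 1)%C with
    (((exp x - 1 - x * 1) * cos y + (1 + x) * (cos y - 1 - y * - 0),
      (exp x - 1 - x * 1) * sin y + x * sin y + (sin y - 0 - y * 1))%R : C).
  2:{ unfold cexp, Cminus, Cplus, Copp, Cmult, RtoC; simpl. rewrite exp_0, cos_0, sin_0. f_equal; ring. }
  eapply Rle_trans; [apply Cmod_le_abs|].
  set (m := Cmod (x, y)) in *.
  assert (Hm : 0 <= m) by apply Cmod_ge_0.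
  assert (Bs : Rabs (sin y) <= 2 * m).
  { replace (sin y) with ((sin y - 0 - y * 1) + y) by ring.
    eapply Rle_trans; [apply Rabs_triang|]. pose proof (Rabs_pos y). nra. }
  assert (Bc : Rabs (cos y) <= 1) by (apply Rabs_le; pose proof (COS_bound y); lra).
  pose proof (Rabs_pos x) as Px. pose proof (Rabs_pos y) as Py.
  set (A := exp x - 1 - x * 1) in *. set (B := cos y - 1 - y * - 0) in *. set (D := sin y - 0 - y * 1) in *.
  assert (T1 : Rabs (A * cos y) <= e * m).
  { rewrite Rabs_mult. pose proof (Rabs_pos A). nra. }
  assert (T2 : Rabs ((1 + x) * B) <= 2 * (e * m)).
  { rewrite Rabs_mult. apply Rmult_le_compat; try apply Rabs_pos; [|nra].
    eapply Rle_trans; [apply Rabs_triang|]. rewrite Rabs_R1. lra. }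
  assert (T3 : Rabs (A * sin y) <= e * m).
  { rewrite Rabs_mult. pose proof (Rabs_pos A). pose proof (Rabs_pos (sin y)).
    assert (Rabs (sin y) <= 1) by (apply Rabs_le; pose proof (SIN_bound y); lra). nra. }
  assert (T4 : Rabs (x * sin y) <= 2 * (e * m)).
  { rewrite Rabs_mult. pose proof (Rabs_pos (sin y)).
    apply Rle_trans with (e * (2 * m)); [|lra]. apply Rmult_le_compat; lra. }
  assert (T5 : Rabs D <= e * m) by nra.
  pose proof (Rabs_triang (A * cos y) ((1 + x) * B)).
  pose proof (Rabs_triang (A * sin y + x * sin y) D).
  pose proof (Rabs_triang (A * sin y) (x * sin y)).
  assert (8 * (e * m) <= eps * m) by nra. nra.
Qed.

Lemma cderiv_cexp z : cderiv cexp z (cexp z).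
Proof.
  assert (H : cderiv (fun w => (cexp z * cexp (w - z))%C) z (cexp z * (1 * (1 - 0)))%C).
  { apply cderiv_scal. apply (cderiv_comp cexp (fun w => (w - z)%C)).
    - apply cderiv_minus; [apply cderiv_id|apply cderiv_const].
    - replace (z - z)%C with (RtoC 0) by ring. apply cderiv_cexp_0. }
  replace (cexp z * (1 * (1 - 0)))%C with (cexp z) in H by ring.
  refine (cderiv_ext_loc _ _ _ _ 1 Rlt_0_1 _ H).
  intros w _. rewrite <- cexp_plus. f_equal. ring.
Qed.

Lemma exp_le x y : x <= y -> exp x <= exp y.
Proof. intros [H| ->]; [left; apply exp_increasing; auto|lra]. Qed.

(* Not divided by [2 PI]; the same holds for [rmean] below. *)
Definition cmean (f : C -> C) (z : C) (r : R) : C :=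
  cint (fun t => f (z + RtoC r * cis t)%C) 0 (2 * PI).

Lemma two_PI_pos : 0 < 2 * PI.
Proof. pose proof PI_RGT_0. lra. Qed.

Lemma rderiv_cis t : rderiv cis t (Ci * cis t)%C.
Proof.
  replace (Ci * cis t)%C with ((- sin t, cos t) : C).
  - apply (rderiv_pair cos sin); [apply is_derive_cos|apply is_derive_sin].
  - unfold Ci, cis, Cmult; simpl. f_equal; ring.
Qed.

Lemma rcont_circle z r t : rcont (fun t => (z + RtoC r * cis t)%C) t.
Proof.
  apply (rcont_comp (fun w => (z + RtoC r * w)%C) cis).
  - eapply rderiv_rcont, rderiv_cis.
  - apply ccont_plus; [apply ccont_const|]. apply ccont_mult; [apply ccont_const|apply ccont_id].
Qed.

Lemma Cmod_circle z r t : Cmod (z + RtoC r * cis t - z) = Rabs r.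
Proof.
  replace (z + RtoC r * cis t - z)%C with (RtoC r * cis t)%C by ring.
  rewrite Cmod_mult, Cmod_R, Cmod_cis. ring.
Qed.

Lemma ex_cint_circle f z r : (forall w, Cmod (w - z) = Rabs r -> ccont f w) ->
  ex_RInt (V := CR) (fun t => f (z + RtoC r * cis t)%C) 0 (2 * PI).
Proof.
  intros H. apply ex_cint; [pose proof two_PI_pos; lra|]. intros t _.
  apply (rcont_comp f (fun t => (z + RtoC r * cis t)%C)); [apply rcont_circle|].
  apply H, Cmod_circle.
Qed.

(** The substitution [z + e^(s + i t)] turns the annulus into a rectangle of height [2 * PI]. In
    Goursat's theorem the horizontal sides cancel by periodicity, and the vertical sides are the two
    means. *)
Lemma cmean_annulus f z r1 r2 : 0 < r1 -> r1 <= r2 ->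
  (forall w, r1 <= Cmod (w - z) <= r2 -> exists l, cderiv f w l) ->
  cmean f z r1 = cmean f z r2.
Proof.
  intros H1 H2 Hf.
  assert (L : ln r1 <= ln r2).
  { destruct H2 as [H2| ->]; [|lra]. left. apply ln_increasing; auto. }
  pose proof two_PI_pos.
  set (g := fun w => f (z + cexp w)%C).
  assert (Hg : rect_int g (ln r1) (ln r1 + (ln r2 - ln r1)) 0 (0 + 2 * PI) = 0%C).
  { apply goursat; try lra. intros x y Hx Hy. unfold g.
    destruct (Hf (z + cexp (x, y))%C) as [l Hl].
    { replace (z + cexp (x, y) - z)%C with (cexp (x, y)) by ring. rewrite Cmod_cexp. simpl.
      split; [rewrite <- (exp_ln r1) at 1 by lra|rewrite <- (exp_ln r2) by lra]; apply exp_le; lra. }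
    exists (l * (0 + cexp (x, y)))%C.
    apply (cderiv_comp f (fun w => (z + cexp w)%C)); auto.
    apply cderiv_plus; [apply cderiv_const|apply cderiv_cexp]. }
  replace (ln r1 + (ln r2 - ln r1)) with (ln r2) in Hg by ring.
  rewrite Rplus_0_l in Hg. unfold rect_int in Hg.
  assert (P : cint (fun x => g (x, 0)) (ln r1) (ln r2) = cint (fun x => g (x, 2 * PI)) (ln r1) (ln r2)).
  { apply RInt_ext. intros x _. unfold g, cexp. simpl fst. simpl snd.
    rewrite cos_2PI, sin_2PI, cos_0, sin_0. reflexivity. }
  assert (Q : forall r, 0 < r -> cint (fun y => g (ln r, y)) 0 (2 * PI) = cmean f z r).
  { intros r Hr. apply RInt_ext. intros t _. unfold g. rewrite cexp_cis. simpl.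
    rewrite exp_ln by auto. reflexivity. }
  rewrite P, !Q in Hg by lra.
  assert (E : (Ci * (cmean f z r2 - cmean f z r1))%C = 0%C) by (rewrite <- Hg; ring).
  (* The vanishing contour integral carries a factor [Ci]; a second factor, with a sign, removes
     it. *)
  assert (E' : (cmean f z r2 - cmean f z r1)%C = (- (Ci * (Ci * (cmean f z r2 - cmean f z r1))))%C).
  { generalize (cmean f z r2 - cmean f z r1)%C. intros [a b]. unfold Ci, Cmult, Copp; simpl. f_equal; ring. }
  rewrite E in E'. 
  replace (cmean f z r1) with (cmean f z r2 - (cmean f z r2 - cmean f z r1))%C by ring.
  rewrite E'. ring.
Qed.

(** * Dependence of the circular mean on its radius *)

Definition ccont2 (g : R -> R -> C) (x y : R) : Prop :=
  forall eps, 0 < eps -> exists d, 0 < d /\ forall u v, Rabs (u - x) < d -> Rabs (v - y) < d ->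
    Cmod (g u v - g x y) < eps.

Lemma ccont2_comp f g x y : ccont2 g x y -> ccont f (g x y) -> ccont2 (fun u v => f (g u v)) x y.
Proof.
  intros Hg Hf eps He. destruct (Hf eps He) as [d [Hd H]].
  destruct (Hg d Hd) as [d' [Hd' H']]. exists d'. split; auto.
Qed.

Lemma ccont2_fst g x y : ccont2 g x y -> continuity_2d_pt (fun u v => fst (g u v)) x y.
Proof.
  intros H eps. destruct (H eps (cond_pos eps)) as [d [Hd K]]. exists (mkposreal d Hd).
  intros u v Hu Hv. eapply Rle_lt_trans; [|apply (K u v Hu Hv)].
  apply (abs_fst_le (g u v - g x y)).
Qed.

Lemma ccont2_snd g x y : ccont2 g x y -> continuity_2d_pt (fun u v => snd (g u v)) x y.
Proof.
  intros H eps. destruct (H eps (cond_pos eps)) as [d [Hd K]]. exists (mkposreal d Hd).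
  intros u v Hu Hv. eapply Rle_lt_trans; [|apply (K u v Hu Hv)].
  apply (abs_snd_le (g u v - g x y)).
Qed.

Lemma ccont2_pair p q x y : continuity_2d_pt p x y -> continuity_2d_pt q x y ->
  ccont2 (fun u v => (p u v, q u v)) x y.
Proof.
  intros Hp Hq eps He.
  destruct (Hp (mkposreal (eps / 2) ltac:(lra))) as [d1 H1].
  destruct (Hq (mkposreal (eps / 2) ltac:(lra))) as [d2 H2].
  exists (Rmin d1 d2). split; [apply Rmin_pos; apply cond_pos|].
  pose proof (Rmin_l d1 d2). pose proof (Rmin_r d1 d2).
  intros u v Hu Hv. specialize (H1 u v ltac:(lra) ltac:(lra)). specialize (H2 u v ltac:(lra) ltac:(lra)).
  eapply Rle_lt_trans; [apply Cmod_le_abs|]. simpl in *. unfold Rminus in *. lra.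
Qed.

Lemma ccont2_circle z r t : ccont2 (fun r t => (z + RtoC r * cis t)%C) r t.
Proof.
  apply (ccont2_comp (fun w => (z + w)%C) (fun r t => (RtoC r * cis t)%C)).
  2: apply ccont_plus; [apply ccont_const|apply ccont_id].
  assert (H : ccont2 (fun r t => (r * cos t, r * sin t)) r t).
  { apply ccont2_pair; apply continuity_2d_pt_mult; try apply continuity_2d_pt_id1;
      apply (continuity_1d_2d_pt_comp _ (fun _ v => v)); try apply continuity_2d_pt_id2;
      [apply continuity_cos|apply continuity_sin]. }
  intros eps He. destruct (H eps He) as [d [Hd K]]. exists d. split; auto.
  intros u v Hu Hv. specialize (K u v Hu Hv).
  replace (RtoC u * cis v)%C with ((u * cos v, u * sin v) : C) by (unfold RtoC, cis, Cmult; simpl; f_equal;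
    ring).
  replace (RtoC r * cis t)%C with ((r * cos t, r * sin t) : C) by (unfold RtoC, cis, Cmult; simpl; f_equal;
    ring).
  exact K.
Qed.

Lemma uniform_ccont2 (g : R -> R -> C) a b c : (forall x, a <= x <= b -> ccont2 g c x) ->
  forall eps, 0 < eps -> exists d, 0 < d /\ forall r t, a <= t <= b -> Rabs (r - c) < d ->
    Cmod (g r t - g c t) < eps.
Proof.
  intros H eps He.
  destruct (uniform_continuity_2d_1d' (fun u v => fst (g u v)) a b c
    (fun x Hx => ccont2_fst _ _ _ (H x Hx)) (mkposreal (eps / 2) ltac:(lra))) as [d1 H1].
  destruct (uniform_continuity_2d_1d' (fun u v => snd (g u v)) a b c
    (fun x Hx => ccont2_snd _ _ _ (H x Hx)) (mkposreal (eps / 2) ltac:(lra))) as [d2 H2].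
  pose proof (cond_pos d1). pose proof (cond_pos d2).
  exists (Rmin d1 d2). split; [apply Rmin_pos; auto|].
  intros r t Ht Hr. pose proof (Rmin_l d1 d2). pose proof (Rmin_r d1 d2).
  apply Rabs_def2 in Hr.
  specialize (H1 t c t r Ht ltac:(lra) Ht ltac:(lra)). specialize (H2 t c t r Ht ltac:(lra) Ht ltac:(lra)).
  rewrite Rminus_diag, Rabs_R0 in H1, H2. specialize (H1 ltac:(lra)). specialize (H2 ltac:(lra)).
  replace (g r t - g c t)%C with ((fst (g r t) - fst (g c t), snd (g r t) - snd (g c t))%R : C)
    by (unfold Cminus, Cplus, Copp; simpl; f_equal; ring).
  eapply Rle_lt_trans; [apply Cmod_le_abs|]. simpl in *. lra.
Qed.

Lemma cmean_cont f z r0 rho : Rabs r0 < rho -> (forall w, Cmod (w - z) < rho -> ccont f w) ->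
  forall eps, 0 < eps -> exists d, 0 < d /\ forall r, Rabs (r - r0) < d ->
    Cmod (cmean f z r - cmean f z r0) <= eps.
Proof.
  intros Hr Hf eps He. pose proof two_PI_pos as HP.
  destruct (uniform_ccont2 (fun r t => f (z + RtoC r * cis t)%C) 0 (2 * PI) r0) with (eps := eps /
    (2 * PI)) as [d [Hd H]].
  - intros t Ht. apply (ccont2_comp f (fun r t => (z + RtoC r * cis t)%C)); [apply ccont2_circle|].
    apply Hf. rewrite Cmod_circle. auto.
  - apply Rdiv_lt_0_compat; lra.
  - exists (Rmin d (rho - Rabs r0)). split; [apply Rmin_pos; lra|].
    intros r Hrr. pose proof (Rmin_l d (rho - Rabs r0)). pose proof (Rmin_r d (rho - Rabs r0)).
    assert (Hr' : Rabs r < rho).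
    { pose proof (Rabs_triang (r - r0) r0). replace (r - r0 + r0) with r in * by ring. lra. }
    unfold cmean. rewrite <- cint_minus by (apply ex_cint_circle; intros w Hw; apply Hf; lra).
    replace eps with (eps / (2 * PI) * (2 * PI - 0)) by (field; lra).
    apply cint_bound; [lra| |].
    + intros t Ht.
      assert (A : forall r, Rabs r < rho -> rcont (fun t => f (z + RtoC r * cis t)%C) t).
      { intros r1 Hr1. apply (rcont_comp f (fun t => (z + RtoC r1 * cis t)%C)); [apply rcont_circle|].
        apply Hf. rewrite Cmod_circle. auto. }
      apply rcont_ccont.
      apply (ccont_minus (fun w => f (z + RtoC r * cis (fst w))%C) (fun w => f (z + RtoC r0 * cis (fst w))%C));
        [apply (proj1 (rcont_ccont _ _) (A r Hr'))|apply (proj1 (rcont_ccont _ _) (A r0 Hr))].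
    + intros t Ht. left. apply H; auto. lra.
Qed.

Lemma cmean_0 f z : cmean f z 0 = (RtoC (2 * PI) * f z)%C.
Proof.
  unfold cmean. rewrite (RInt_ext (V := CR) _ (fun _ => f z)).
  - rewrite (RInt_const (V := CR)). rewrite Rminus_0_r.
    change (((2 * PI) * fst (f z), (2 * PI) * snd (f z))%R = (RtoC (2 * PI) * f z)%C).
    unfold RtoC, Cmult; simpl. f_equal; ring.
  - intros t _. f_equal. ring.
Qed.

(* A single exceptional point costs nothing: the means are locally constant off its radius and
   continuous across it. *)
Lemma cmean_value f z p rho r : (forall w, Cmod (w - z) < rho -> ccont f w) ->
  (forall w, Cmod (w - z) < rho -> w <> p -> exists l, cderiv f w l) ->
  0 <= r < rho -> cmean f z r = (RtoC (2 * PI) * f z)%C.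
Proof.
  intros Hc Hd Hr. rewrite <- cmean_0.
  (* With no exceptional radius in [(a, b]], the mean at [b] equals the means just above [a], and
     continuity carries this to [a], which may be 0 or the exceptional radius. *)
  assert (Step : forall a b, 0 <= a -> a < b -> b < rho -> (forall s, a < s <= b -> s <> Cmod (p - z)) ->
    cmean f z b = cmean f z a).
  { intros a b Ha Hab Hb Hs.
    assert (K : forall eps, 0 < eps -> Cmod (cmean f z b - cmean f z a) <= eps).
    { intros eps He.
      destruct (cmean_cont f z a rho) with (eps := eps) as [d [Hd0 H]]; auto.
      { rewrite Rabs_pos_eq; lra. }
      set (s := Rmin b (a + d / 2)).
      assert (S1 : s <= b) by apply Rmin_l. assert (S2 : s <= a + d / 2) by apply Rmin_r.
      assert (S3 : a < s) by (apply Rmin_glb_lt; lra).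
      rewrite <- (cmean_annulus f z s b); try lra.
      - apply H. rewrite Rabs_pos_eq; lra.
      - intros w Hw. apply Hd; [lra|]. intros ->. apply (Hs (Cmod (p - z))); [lra|auto]. }
    assert (Z : Cmod (cmean f z b - cmean f z a) = 0).
    { apply Rle_antisym; [|apply Cmod_ge_0]. apply Rnot_lt_le. intros N.
      specialize (K (Cmod (cmean f z b - cmean f z a) / 2)). lra. }
    apply Cmod_eq_0 in Z.
    replace (cmean f z b) with ((cmean f z b - cmean f z a) + cmean f z a)%C by ring.
    rewrite Z. ring. }
  (* Here [b] is the exceptional radius and is approached from below. *)
  assert (Left : forall a b, 0 <= a -> a < b -> b < rho -> b = Cmod (p - z) ->
    cmean f z b = cmean f z a).
  { intros a b Ha Hab Hb Eb.
    assert (K : forall eps, 0 < eps -> Cmod (cmean f z b - cmean f z a) <= eps).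
    { intros eps He.
      destruct (cmean_cont f z b rho) with (eps := eps) as [d [Hd0 H]]; auto.
      { rewrite Rabs_pos_eq; lra. }
      set (s := Rmax (a + (b - a) / 2) (b - d / 2)).
      assert (S1 : a + (b - a) / 2 <= s) by apply Rmax_l. assert (S2 : b - d / 2 <= s) by apply Rmax_r.
      assert (S3 : s < b) by (apply Rmax_lub_lt; lra).
      rewrite <- (Step a s); try lra.
      - rewrite Cmod_sub_sym. apply H. rewrite Rabs_left; lra.
      - intros s' Hs'. lra. }
    assert (Z : Cmod (cmean f z b - cmean f z a) = 0).
    { apply Rle_antisym; [|apply Cmod_ge_0]. apply Rnot_lt_le. intros N.
      specialize (K (Cmod (cmean f z b - cmean f z a) / 2)). lra. }
    apply Cmod_eq_0 in Z.
    replace (cmean f z b) with ((cmean f z b - cmean f z a) + cmean f z a)%C by ring.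
    rewrite Z. ring. }
  destruct (Rle_lt_or_eq_dec 0 r) as [R0|R0]; [lra| |rewrite R0; auto].
  set (m := Cmod (p - z)) in *. assert (Pm : 0 <= m) by apply Cmod_ge_0.
  destruct (Rtotal_order r m) as [L|[L|L]].
  - apply Step; try lra. intros s Hs. lra.
  - apply Left; lra.
  - destruct (Rle_lt_or_eq_dec 0 m Pm) as [M|M].
    + rewrite (Step m r); try lra. { apply Left; lra. } intros s Hs. lra.
    + apply Step; try lra. intros s Hs. lra.
Qed.

(** * Cauchy's formula *)

Definition holo (f : C -> C) (z0 : C) (rho : R) : Prop :=
  forall w, Cmod (w - z0) < rho -> exists l, cderiv f w l.

Lemma cderiv_C_derive f z l : cderiv f z l -> C_derive f z = l.
Proof. intros H. apply is_C_derive_unique, cderiv_is_derive, H. Qed.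

Lemma entire_cderiv f : entire f <-> forall z, exists l, cderiv f z l.
Proof.
  split; intros H z; destruct (H z) as [l Hl]; exists l; apply cderiv_is_derive; auto.
Qed.

Lemma cmean_ext f g z r : 0 <= r -> (forall w, Cmod (w - z) = r -> f w = g w) ->
  cmean f z r = cmean g z r.
Proof.
  intros Hr H. apply (RInt_ext (V := CR)). intros t _. apply H. rewrite Cmod_circle. apply Rabs_pos_eq, Hr.
Qed.

Lemma cmean_plus f g z r : 0 <= r -> (forall w, Cmod (w - z) = r -> ccont f w) ->
  (forall w, Cmod (w - z) = r -> ccont g w) ->
  cmean (fun w => (f w + g w)%C) z r = (cmean f z r + cmean g z r)%C.
Proof.
  intros Hr Hf Hg. apply (RInt_plus (V := CR) (fun t => f (z + RtoC r * cis t)%C) (fun t => g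
  (z + RtoC r * cis t)%C));
    apply ex_cint_circle; rewrite Rabs_pos_eq by auto; auto.
Qed.

Lemma cmean_minus f g z r : 0 <= r -> (forall w, Cmod (w - z) = r -> ccont f w) ->
  (forall w, Cmod (w - z) = r -> ccont g w) ->
  cmean (fun w => (f w - g w)%C) z r = (cmean f z r - cmean g z r)%C.
Proof.
  intros Hr Hf Hg. apply (RInt_minus (V := CR) (fun t => f (z + RtoC r * cis t)%C) (fun t => g
  (z + RtoC r * cis t)%C));
    apply ex_cint_circle; rewrite Rabs_pos_eq by auto; auto.
Qed.

Lemma cmean_Cmult c f z r : 0 <= r -> (forall w, Cmod (w - z) = r -> ccont f w) ->
  cmean (fun w => (c * f w)%C) z r = (c * cmean f z r)%C.
Proof.
  intros Hr Hf. apply (cint_Cmult (fun t => f (z + RtoC r * cis t)%C)).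
  apply ex_cint_circle; rewrite Rabs_pos_eq by auto; auto.
Qed.

Lemma cmean_bound f z r M : 0 <= r -> (forall w, Cmod (w - z) = r -> ccont f w) ->
  (forall w, Cmod (w - z) = r -> Cmod (f w) <= M) -> Cmod (cmean f z r) <= M * (2 * PI).
Proof.
  intros Hr Hf HM. pose proof two_PI_pos.
  replace (M * (2 * PI)) with (M * (2 * PI - 0)) by ring.
  assert (A : forall t, Cmod (z + RtoC r * cis t - z) = r).
  { intros t. rewrite Cmod_circle. apply Rabs_pos_eq, Hr. }
  apply cint_bound; [lra| |]; intros t _; [|auto].
  apply (rcont_comp f (fun t => (z + RtoC r * cis t)%C)); [apply rcont_circle|auto].
Qed.

Lemma cmean_1 z r : cmean (fun _ => 1%C) z r = RtoC (2 * PI).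
Proof.
  unfold cmean. rewrite (RInt_const (V := CR)), Rminus_0_r.
  change (((2 * PI) * 1, (2 * PI) * 0)%R = RtoC (2 * PI)). unfold RtoC. f_equal; ring.
Qed.

Lemma circle_neq z w v r : Cmod (w - z) = r -> Cmod (v - z) < r -> (w - v)%C <> 0%C.
Proof.
  intros H1 H2. apply Csub_neq_0. intros ->. lra.
Qed.

Lemma circle_dist z w v r : Cmod (w - z) = r -> r - Cmod (v - z) <= Cmod (w - v).
Proof.
  intros <-. pose proof (Cmod_triangle_inv (w - z) (v - z)) as H.
  replace (w - z - (v - z))%C with (w - v)%C in H by ring. exact H.
Qed.

Lemma ccont_sub v w : ccont (fun u => (u - v)%C) w.
Proof. apply ccont_minus; [apply ccont_id|apply ccont_const]. Qed.

Lemma cderiv_sub v w : cderiv (fun u => (u - v)%C) w 1%C.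
Proof.
  replace (RtoC 1) with (1 - 0)%C by ring. apply cderiv_minus; [apply cderiv_id|apply cderiv_const].
Qed.

Lemma ccont_inv_sub v w : (w - v)%C <> 0%C -> ccont (fun u => (/ (u - v))%C) w.
Proof. intros H. apply (ccont_inv (fun u => (u - v)%C)); auto. apply ccont_sub. Qed.

(** The mean does not depend on the radius, and the kernel tends to 1 at infinity: on the circle of
    radius [s] it differs from 1 by at most [m / (s - m)]. *)
Lemma cmean_kernel z0 w r : Cmod (w - z0) < r ->
  cmean (fun u => ((u - z0) * / (u - w))%C) z0 r = RtoC (2 * PI).
Proof.
  intros Hw. set (m := Cmod (w - z0)) in *. assert (Hm : 0 <= m) by apply Cmod_ge_0.
  pose proof two_PI_pos as HP.
  set (k := fun u => ((u - z0) * / (u - w))%C).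
  assert (Ck : forall s u, m < s -> Cmod (u - z0) = s -> ccont k u).
  { intros s u Hs Hu. apply ccont_mult; [apply ccont_sub|].
    apply ccont_inv_sub. eapply circle_neq; eauto. }
  assert (B : forall s, r < s -> Cmod (cmean k z0 r - RtoC (2 * PI)) <= m / (s - m) * (2 * PI)).
  { intros s Hs. rewrite (cmean_annulus k z0 r s); try lra.
    - rewrite <- (cmean_1 z0 s). rewrite <- cmean_minus; try lra.
      2: intros u Hu; apply (Ck s); auto; lra. 2: intros; apply ccont_const.
      apply cmean_bound; try lra.
      + intros u Hu. apply ccont_minus; [apply (Ck s); auto; lra|apply ccont_const].
      + intros u Hu. unfold k. assert (N : (u - w)%C <> 0%C) by (eapply circle_neq; [eauto|unfold m in *; lra]).
        replace ((u - z0) * / (u - w) - 1)%C with ((w - z0) / (u - w))%C by (field; auto).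
        rewrite Cmod_div by auto. fold m. pose proof (circle_dist z0 u w s Hu) as D. fold m in D.
        apply Rmult_le_compat_l; auto. apply Rinv_le_contravar; lra.
    - intros u Hu. assert (N : (u - w)%C <> 0%C) by (apply (circle_neq z0 u w (Cmod (u - z0)));
      [reflexivity|unfold m in *; lra]).
      eexists. apply cderiv_mult; [apply cderiv_sub|]. apply (cderiv_inv (fun u => (u - w)%C)); auto.
      apply cderiv_sub. }
  assert (Z : Cmod (cmean k z0 r - RtoC (2 * PI)) = 0).
  { apply Rle_antisym; [|apply Cmod_ge_0]. apply Rnot_lt_le. intros N.
    set (e := Cmod (cmean k z0 r - RtoC (2 * PI))) in *.
    (* Chosen so that [e * (s - m)] exceeds [2 * m * (2 * PI)], against the bound [m * (2 * PI)]
       just obtained. *)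
    set (s := r + 1 + m * (2 * PI) / e * 2).
    assert (P0 : 0 <= m * (2 * PI) / e * 2).
    { apply Rmult_le_pos; [|lra]. apply Rmult_le_pos; [nra|]. left. apply Rinv_0_lt_compat; auto. }
    specialize (B s ltac:(unfold s; lra)).
    assert (S1 : 0 < s - m) by (unfold s; lra).
    assert (B' : e * (s - m) <= m * (2 * PI)).
    { apply Rmult_le_compat_r with (r := s - m) in B; [|lra].
      replace (m / (s - m) * (2 * PI) * (s - m)) with (m * (2 * PI)) in B by (field; lra). exact B. }
    assert (B2 : e * (s - m) = e * (r + 1 - m) + m * (2 * PI) * 2) by (unfold s; field; lra).
    assert (0 < e * (r + 1 - m)) by (apply Rmult_lt_0_compat; lra). nra. }
  apply Cmod_eq_0 in Z. fold k.
  replace (cmean k z0 r) with (cmean k z0 r - RtoC (2 * PI) + RtoC (2 * PI))%C by ring.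
  rewrite Z. ring.
Qed.

(** Write [f u = f w + q u * (u - w)]. The constant part is [cmean_kernel]; in the rest the kernel
    leaves [(u - z0) * q u], which is continuous, differentiable off [w] and zero at the centre, so
    its mean is 0 by [cmean_value] with exceptional point [w]. The factor [u - z0] is what [du]
    becomes in the angle, up to [i]. *)
Lemma cauchy_formula f z0 rho r w : holo f z0 rho -> Cmod (w - z0) < r -> r < rho ->
  cmean (fun u => (f u * ((u - z0) * / (u - w)))%C) z0 r = (RtoC (2 * PI) * f w)%C.
Proof.
  intros Hf Hw Hr. pose proof (Cmod_ge_0 (w - z0)) as Pw.
  destruct (Hf w ltac:(lra)) as [l [q [Hq [El E]]]].
  assert (Dq : forall u, Cmod (u - z0) < rho -> u <> w -> exists m, cderiv q u m).
  { intros u Hu N. destruct (Hf u Hu) as [m Hm].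
    assert (N' := Csub_neq_0 u w N).
    eexists. apply (cderiv_ext_loc (fun v => ((f v - f w) * / (v - w))%C) q u _ (Cmod (u - w))).
    - apply Cmod_pos_sub; auto.
    - intros v Hv. rewrite (E v). assert ((v - w)%C <> 0%C).
      { apply Csub_neq_0. intros ->. rewrite Cmod_sub_sym in Hv. lra. }
      field. auto.
    - apply cderiv_mult.
      + apply cderiv_minus; [eauto|apply cderiv_const].
      + apply (cderiv_inv (fun u => (u - w)%C)); auto. apply cderiv_sub. }
  assert (Cq : forall u, Cmod (u - z0) < rho -> ccont q u).
  { intros u Hu. destruct (classic (u = w)) as [->|N]; auto.
    destruct (Dq u Hu N) as [m Hm]. eapply cderiv_ccont; eauto. }
  assert (H0 : cmean (fun u => ((u - z0) * q u)%C) z0 r = 0%C).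
  { rewrite (cmean_value _ z0 w rho); try lra.
    - replace (z0 - z0)%C with (RtoC 0) by ring. ring.
    - intros u Hu. apply ccont_mult; auto. apply ccont_sub.
    - intros u Hu N. destruct (Dq u Hu N) as [m Hm]. eexists. apply cderiv_mult; [apply cderiv_sub|eauto]. }
  assert (Ck : forall u, Cmod (u - z0) = r -> ccont (fun u => ((u - z0) * / (u - w))%C) u).
  { intros u Hu. apply ccont_mult; [apply ccont_sub|]. apply ccont_inv_sub. eapply circle_neq; eauto. }
  rewrite (cmean_ext _ (fun u => (f w * ((u - z0) * / (u - w)) + (u - z0) * q u)%C)); try lra.
  - rewrite (cmean_plus (fun u => (f w * ((u - z0) * / (u - w)))%C) (fun u => ((u - z0) * q u)%C)); try lra.
    + rewrite (cmean_Cmult (f w) (fun u => ((u - z0) * / (u - w))%C)), cmean_kernel, H0 by (auto; lra). ring.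
    + intros u Hu. apply ccont_mult; [apply ccont_const|auto].
    + intros u Hu. apply ccont_mult; [apply ccont_sub|apply Cq; lra].
  - intros u Hu. rewrite (E u). assert (N : (u - w)%C <> 0%C) by (eapply circle_neq; eauto). field. auto.
Qed.

(** A maximum principle with a loss: on the half disc the Cauchy kernel has modulus at most 2. The
    factor 2 is harmless wherever this is used. *)
Lemma holo_bound f z0 rho r w M : holo f z0 rho -> 0 < r < rho -> Cmod (w - z0) <= r / 2 ->
  (forall u, Cmod (u - z0) = r -> Cmod (f u) <= M) -> Cmod (f w) <= 2 * M.
Proof.
  intros Hf Hr Hw HM. pose proof two_PI_pos as HP.
  pose proof (cauchy_formula f z0 rho r w Hf ltac:(lra) ltac:(lra)) as E.
  assert (B : Cmod (RtoC (2 * PI) * f w) <= (2 * M) * (2 * PI)).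
  { rewrite <- E. apply cmean_bound; try lra.
    - intros u Hu. destruct (Hf u ltac:(lra)) as [l Hl]. apply ccont_mult; [eapply cderiv_ccont; eauto|].
      apply ccont_mult; [apply ccont_sub|]. apply ccont_inv_sub. eapply circle_neq; eauto. lra.
    - intros u Hu. assert (N : (u - w)%C <> 0%C) by (eapply circle_neq; eauto; lra).
      rewrite !Cmod_mult, Cmod_inv, Hu by auto. pose proof (circle_dist z0 u w r Hu) as D.
      specialize (HM u Hu). pose proof (Cmod_ge_0 (f u)).
      assert (r * / Cmod (u - w) <= 2).
      { apply Rmult_le_reg_r with (Cmod (u - w)); [lra|]. rewrite Rmult_assoc, Rinv_l by lra. lra. }
      assert (0 <= r * / Cmod (u - w)).
      { apply Rmult_le_pos; [lra|]. left. apply Rinv_0_lt_compat. lra. }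
      nra. }
  rewrite Cmod_mult, Cmod_R, Rabs_pos_eq in B by lra.
  apply Rmult_le_reg_l with (2 * PI); lra.
Qed.

Lemma rcont_bounded g a b : a <= b -> (forall t, a <= t <= b -> rcont g t) ->
  exists M, 0 <= M /\ forall t, a <= t <= b -> Cmod (g t) <= M.
Proof.
  intros Hab H. destruct (continuity_ab_maj (fun t => Cmod (g t)) a b Hab) as [x [Hx _]].
  - intros t Ht. apply continuity_pt_filterlim. intros P [e HP].
    destruct (H t Ht e (cond_pos e)) as [d [Hd K]]. exists (mkposreal d Hd). intros s Hs. apply HP.
    apply Rle_lt_trans with (Cmod (g s - g t)); [|apply K; auto].
    apply Rabs_le. change (minus (Cmod (g s)) (Cmod (g t))) with (Cmod (g s) - Cmod (g t)).
    pose proof (Cmod_triangle_inv (g s) (g t)). pose proof (Cmod_triangle_inv (g t) (g s)) as H1.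
    rewrite Cmod_sub_sym in H1. lra.
  - exists (Cmod (g x)). split; [apply Cmod_ge_0|auto].
Qed.

(** Lets bounds along the parametrised circle speak about all points at a given distance. *)
Lemma cis_polar w : exists t, 0 <= t <= 2 * PI /\ w = (RtoC (Cmod w) * cis t)%C.
Proof.
  pose proof PI_RGT_0.
  destruct (Req_dec (Cmod w) 0) as [Z|Z].
  { exists 0. split; [lra|]. rewrite Z. rewrite (Cmod_eq_0 w Z). ring. }
  assert (P : 0 < Cmod w) by (pose proof (Cmod_ge_0 w); lra).
  destruct w as [x y]. set (m := Cmod (x, y)) in *.
  assert (Em : m * m = x * x + y * y).
  { unfold m, Cmod. simpl. rewrite sqrt_sqrt; [ring|]. nra. }
  assert (Bx : -1 <= x / m <= 1).
  { pose proof (abs_fst_le (x, y)) as A. fold m in A. simpl in A.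
    assert (A' := Rabs_def2 x (m * 1 + 0)). apply Rabs_le_between in A.
    split; apply Rmult_le_reg_r with m; auto; unfold Rdiv; rewrite Rmult_assoc, Rinv_l by lra; lra. }
  assert (Sy : sin (acos (x / m)) = Rabs y / m).
  { rewrite sin_acos by auto. apply Rsqr_inj; [apply sqrt_pos| |].
    - apply Rmult_le_pos; [apply Rabs_pos|]. left. apply Rinv_0_lt_compat; auto.
    - assert (Q : Rsqr (x / m) <= 1). { unfold Rsqr. nra. }
      rewrite Rsqr_sqrt by lra. unfold Rsqr.
      replace (Rabs y / m * (Rabs y / m)) with (Rabs y * Rabs y / (m * m)) by (field; lra).
      replace (Rabs y * Rabs y) with (m * m - x * x).
      + field. lra.
      + rewrite <- Rabs_mult, Rabs_pos_eq by nra. lra. }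
  pose proof (acos_bound (x / m)) as AB.
  destruct (Rle_dec 0 y) as [Y|Y].
  - exists (acos (x / m)). split; [lra|]. unfold cis. rewrite cos_acos, Sy, Rabs_pos_eq by auto.
    unfold RtoC, Cmult; simpl. f_equal; field; lra.
  - exists (2 * PI - acos (x / m)). split; [lra|]. unfold cis.
    replace (cos (2 * PI - acos (x / m))) with (x / m).
    2:{ rewrite cos_minus, cos_2PI, sin_2PI, cos_acos by auto. ring. }
    replace (sin (2 * PI - acos (x / m))) with (y / m).
    2:{ rewrite sin_minus, cos_2PI, sin_2PI, Sy, Rabs_left by lra. field. lra. }
    unfold RtoC, Cmult; simpl. f_equal; field; lra.
Qed.

Lemma circle_bounded f z r : 0 <= r -> (forall w, Cmod (w - z) = r -> ccont f w) ->
  exists M, 0 <= M /\ forall w, Cmod (w - z) = r -> Cmod (f w) <= M.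
Proof.
  intros Hr Hf. pose proof two_PI_pos.
  destruct (rcont_bounded (fun t => f (z + RtoC r * cis t)%C) 0 (2 * PI)) as [M [M0 HM]]; [lra| |].
  - intros t _. apply (rcont_comp f (fun t => (z + RtoC r * cis t)%C)); [apply rcont_circle|].
    apply Hf. rewrite Cmod_circle. apply Rabs_pos_eq; auto.
  - exists M. split; auto. intros w Hw. destruct (cis_polar (w - z)) as [t [Ht E]].
    specialize (HM t Ht). rewrite Hw in E. rewrite <- E in HM.
    replace (z + (w - z))%C with w in HM by ring. exact HM.
Qed.

(** * Differentiation of integrals of Cauchy type *)

Lemma cderiv_cmean (phi dphi : C -> C -> C) z r w s B : 0 <= r -> 0 < s ->
  (forall u, Cmod (u - z) = r -> ccont (fun u => dphi u w) u) ->
  (forall v u, Cmod (v - w) < s -> Cmod (u - z) = r -> ccont (fun u => phi u v) u) ->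
  (forall v u, Cmod (v - w) < s -> Cmod (u - z) = r ->
    Cmod (phi u v - phi u w - (v - w) * dphi u w) <= B * (Cmod (v - w) * Cmod (v - w))) ->
  cderiv (fun v => cmean (fun u => phi u v) z r) w (cmean (fun u => dphi u w) z r).
Proof.
  intros Hr Hs C1 C2 HB. pose proof two_PI_pos as HP. apply cderiv_intro. intros eps He.
  (* [B] comes without a sign; a positive constant is needed to divide by. *)
  set (B' := Rabs B + 1). assert (PB : 0 < B') by (pose proof (Rabs_pos B); unfold B'; lra).
  exists (Rmin s (eps / (B' * (2 * PI)))). split.
  { apply Rmin_pos; auto. apply Rdiv_lt_0_compat; auto. nra. }
  intros v Hv. pose proof (Rmin_l s (eps / (B' * (2 * PI)))). pose proof (Rmin_r s (eps / (B' * (2 * PI)))).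
  assert (W : Cmod (w - w) < s) by (rewrite Cmod_sub_self; auto).
  assert (Hvs : Cmod (v - w) < s) by lra.
  rewrite <- (cmean_minus (fun u => phi u v) (fun u => phi u w)); auto.
  rewrite <- (cmean_Cmult (v - w) (fun u => dphi u w)); auto.
  rewrite <- (cmean_minus (fun u => phi u v - phi u w)%C (fun u => (v - w) * dphi u w)%C); auto.
  2: intros u Hu; apply ccont_minus; auto.
  2: intros u Hu; apply ccont_mult; auto; apply ccont_const.
  eapply Rle_trans; [apply (cmean_bound _ z r (B' * (Cmod (v - w) * Cmod (v - w)))); auto|].
  - intros u Hu. apply ccont_minus; [apply ccont_minus; auto|]. apply ccont_mult; auto; apply ccont_const.
  - intros u Hu. eapply Rle_trans; [apply HB; auto|]. apply Rmult_le_compat_r.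
    + apply Rmult_le_pos; apply Cmod_ge_0.
    + unfold B'. pose proof (Rle_abs B). lra.
  - pose proof (Cmod_ge_0 (v - w)) as P.
    replace (B' * (Cmod (v - w) * Cmod (v - w)) * (2 * PI)) with ((Cmod (v - w) * (B' * (2 * PI))) * Cmod
      (v - w)) by ring.
    apply Rmult_le_compat_r; auto.
    apply Rle_trans with (eps / (B' * (2 * PI)) * (B' * (2 * PI))).
    + apply Rmult_le_compat_r; [nra|lra].
    + right. field. split; lra.
Qed.

Section cauchy_type.
Variables (k : C -> C) (z : C) (r : R).
Hypothesis Hk : forall u, Cmod (u - z) = r -> ccont k u.

Lemma ccont_cauchy_kernel v u : Cmod (v - z) < r -> Cmod (u - z) = r -> ccont (fun u => (k u * / (u - v))%C) u.
Proof.
  intros Hv Hu. apply ccont_mult; auto. apply ccont_inv_sub. eapply circle_neq; eauto.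
Qed.

Lemma ccont_cauchy_kernel2 v u : Cmod (v - z) < r -> Cmod (u - z) = r ->
  ccont (fun u => (k u * (/ (u - v) * / (u - v)))%C) u.
Proof.
  intros Hv Hu. apply ccont_mult; auto. apply ccont_mult; apply ccont_inv_sub; eapply circle_neq; eauto.
Qed.

Lemma cauchy_type_dist w v u : Cmod (w - z) < r -> Cmod (v - w) < (r - Cmod (w - z)) / 2 ->
  Cmod (u - z) = r ->
  Cmod (v - z) < r /\ / Cmod (u - v) <= / ((r - Cmod (w - z)) / 2) /\ / Cmod (u - w) <=
    / ((r - Cmod (w - z)) / 2).
Proof.
  intros Hw Hv Hu. pose proof (Cmod_triangle (v - w) (w - z)) as T.
  replace (v - w + (w - z))%C with (v - z)%C in T by ring.
  pose proof (circle_dist z u v r Hu). pose proof (circle_dist z u w r Hu).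
  repeat split; try lra; apply Rinv_le_contravar; lra.
Qed.

Lemma cderiv_cauchy_type w : Cmod (w - z) < r ->
  cderiv (fun v => cmean (fun u => (k u * / (u - v))%C) z r) w
    (cmean (fun u => (k u * (/ (u - w) * / (u - w)))%C) z r).
Proof.
  intros Hw. pose proof (Cmod_ge_0 (w - z)) as P0.
  destruct (circle_bounded k z r ltac:(lra) Hk) as [M [M0 HM]].
  set (s := (r - Cmod (w - z)) / 2). assert (Ps : 0 < s) by (unfold s; lra).
  assert (Pi : 0 < / s) by (apply Rinv_0_lt_compat; auto).
  apply (cderiv_cmean (fun u v => (k u * / (u - v))%C) (fun u w => (k u * (/ (u - w) * / (u - w)))%C) z r w s
    (M * (/ s * / s * / s))); try lra.
  - intros u Hu. apply ccont_cauchy_kernel2; auto.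
  - intros v u Hv Hu. apply ccont_cauchy_kernel; auto. eapply cauchy_type_dist; eauto.
  - intros v u Hv Hu. destruct (cauchy_type_dist w v u Hw Hv Hu) as [D1 [D2 D3]]. fold s in D2, D3.
    assert (N1 : (u - v)%C <> 0%C) by (eapply circle_neq; eauto).
    assert (N2 : (u - w)%C <> 0%C) by (eapply circle_neq; eauto).
    replace (k u * / (u - v) - k u * / (u - w) - (v - w) * (k u * (/ (u - w) * / (u - w))))%C
      with (k u * (/ (u - v) * / (u - w) * / (u - w)) * ((v - w) * (v - w)))%C by (field; auto).
    rewrite !Cmod_mult, !Cmod_inv by auto.
    assert (0 < / Cmod (u - v)) by (apply Rinv_0_lt_compat, Cmod_gt_0; auto).
    assert (0 < / Cmod (u - w)) by (apply Rinv_0_lt_compat, Cmod_gt_0; auto).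
    apply Rmult_le_compat_r; [apply Rmult_le_pos; apply Cmod_ge_0|].
    apply Rmult_le_compat; auto; [apply Cmod_ge_0|repeat apply Rmult_le_pos; lra|].
    apply Rmult_le_compat; try lra; [apply Rmult_le_pos; lra|]. apply Rmult_le_compat; lra.
Qed.

Lemma cderiv_cauchy_type2 w : Cmod (w - z) < r ->
  exists l, cderiv (fun v => cmean (fun u => (k u * (/ (u - v) * / (u - v)))%C) z r) w l.
Proof.
  intros Hw. pose proof (Cmod_ge_0 (w - z)) as P0.
  destruct (circle_bounded k z r ltac:(lra) Hk) as [M [M0 HM]].
  set (s := (r - Cmod (w - z)) / 2). assert (Ps : 0 < s) by (unfold s; lra).
  assert (Pi : 0 < / s) by (apply Rinv_0_lt_compat; auto).
  eexists. apply (cderiv_cmean (fun u v => (k u * (/ (u - v) * / (u - v)))%C)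
    (fun u w => (2 * (k u * (/ (u - w) * / (u - w)) * / (u - w)))%C) z r w s
    (M * (3 * (/ s * / s * / s * / s)))); try lra.
  - intros u Hu. apply ccont_mult; [apply ccont_const|]. apply ccont_mult; [apply ccont_cauchy_kernel2; auto|].
    apply ccont_inv_sub. eapply circle_neq; eauto.
  - intros v u Hv Hu. apply ccont_cauchy_kernel2; auto. eapply cauchy_type_dist; eauto.
  - intros v u Hv Hu. destruct (cauchy_type_dist w v u Hw Hv Hu) as [D1 [D2 D3]]. fold s in D2, D3.
    assert (N1 : (u - v)%C <> 0%C) by (eapply circle_neq; eauto).
    assert (N2 : (u - w)%C <> 0%C) by (eapply circle_neq; eauto).
    (* With [a = 1 / (u - w)], [b = 1 / (u - v)] and [h = v - w] one has [b - a = a b h], hence [b^2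
       - a^2 - 2 h a^3 = h^2 (a^2 b^2 + 2 a^3 b)]. These three quartic terms give the constant 3. *)
    replace (k u * (/ (u - v) * / (u - v)) - k u * (/ (u - w) * / (u - w)) - (v - w) * (2 * (k u * (/
      (u - w) * / (u - w)) * / (u - w))))%C
      with (k u * (/ (u - w) * / (u - w) * / (u - v) * / (u - v) + 2 * (/ (u - w) * / (u - w) * /
        (u - w) * / (u - v))) * ((v - w) * (v - w)))%C by (field; auto).
    rewrite !Cmod_mult.
    apply Rmult_le_compat_r; [apply Rmult_le_pos; apply Cmod_ge_0|].
    apply Rmult_le_compat; auto; try apply Cmod_ge_0.
    eapply Rle_trans; [apply Cmod_triangle|]. rewrite !Cmod_mult, !Cmod_inv by auto.
    rewrite Cmod_R, Rabs_pos_eq by lra.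
    assert (0 < / Cmod (u - v)) by (apply Rinv_0_lt_compat, Cmod_gt_0; auto).
    assert (0 < / Cmod (u - w)) by (apply Rinv_0_lt_compat, Cmod_gt_0; auto).
    set (a := / Cmod (u - w)) in *. set (b := / Cmod (u - v)) in *. set (c := / s) in *.
    assert (Q2 : a * a <= c * c) by (apply Rmult_le_compat; lra).
    assert (Q3 : b * b <= c * c) by (apply Rmult_le_compat; lra).
    assert (Q4 : a * b <= c * c) by (apply Rmult_le_compat; lra).
    assert (Q5 : a * a * (b * b) <= c * c * (c * c)) by (apply Rmult_le_compat; nra).
    assert (Q6 : a * a * (a * b) <= c * c * (c * c)) by (apply Rmult_le_compat; nra).
    lra.
Qed.
End cauchy_type.

Lemma holo_ccont f z0 rho w : holo f z0 rho -> Cmod (w - z0) < rho -> ccont f w.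
Proof. intros Hf Hw. destruct (Hf w Hw) as [l Hl]. eapply cderiv_ccont; eauto. Qed.

Lemma two_PI_neq_0 : RtoC (2 * PI) <> 0%C.
Proof. pose proof two_PI_pos. intros E. apply RtoC_inj in E. lra. Qed.

(** On an intermediate circle [f] is an integral of Cauchy type, with [/ (2 * PI)] and [u - z0]
    absorbed in the density. Its derivative is the integral with the squared kernel, which is
    differentiable in turn. *)
Lemma holo_C_derive f z0 rho : holo f z0 rho ->
  (forall w, Cmod (w - z0) < rho -> cderiv f w (C_derive f w)) /\ holo (C_derive f) z0 rho.
Proof.
  intros Hf. split.
  - intros w Hw. destruct (Hf w Hw) as [l Hl]. rewrite (cderiv_C_derive _ _ _ Hl). auto.
  - intros w Hw. pose proof (Cmod_ge_0 (w - z0)).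
    set (r := (Cmod (w - z0) + rho) / 2).
    set (k := fun u => (/ RtoC (2 * PI) * (f u * (u - z0)))%C).
    assert (Ck : forall u, Cmod (u - z0) = r -> ccont k u).
    { intros u Hu. apply ccont_mult; [apply ccont_const|]. apply ccont_mult; [|apply ccont_sub].
      apply (holo_ccont f z0 rho); auto. unfold r in Hu. lra. }
    assert (Ef : forall v, Cmod (v - z0) < r -> cmean (fun u => (k u * / (u - v))%C) z0 r = f v).
    { intros v Hv. rewrite (cmean_ext _ (fun u => (/ RtoC (2 * PI) * (f u * ((u - z0) * / (u - v))))%C)).
      - rewrite (cmean_Cmult _ (fun u => (f u * ((u - z0) * / (u - v)))%C)).
        + rewrite (cauchy_formula f z0 rho); auto; [|unfold r; lra]. field. apply two_PI_neq_0.
        + unfold r; lra.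
        + intros u Hu. apply ccont_mult; [apply (holo_ccont f z0 rho); auto; unfold r in Hu; lra|].
          apply ccont_mult; [apply ccont_sub|]. apply ccont_inv_sub. eapply circle_neq; eauto.
      - unfold r; lra.
      - intros u _. unfold k. ring. }
    destruct (cderiv_cauchy_type2 k z0 r Ck w) as [l Hl]; [unfold r; lra|].
    exists l.
    assert (In : forall v, Cmod (v - w) < r - Cmod (w - z0) -> Cmod (v - z0) < r).
    { intros v Hv. pose proof (Cmod_triangle (v - w) (w - z0)) as T.
      replace (v - w + (w - z0))%C with (v - z0)%C in T by ring. lra. }
    refine (cderiv_ext_loc _ _ _ _ (r - Cmod (w - z0)) _ _ Hl); [unfold r; lra|].
    intros v Hv. symmetry. apply cderiv_C_derive.
    refine (cderiv_ext_loc _ _ _ _ (r - Cmod (v - z0)) _ _ (cderiv_cauchy_type k z0 r Ck v _)).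
    + specialize (In v Hv). lra.
    + intros x Hx. apply Ef. pose proof (Cmod_triangle (x - v) (v - z0)) as T.
      replace (x - v + (v - z0))%C with (x - z0)%C in T by ring. lra.
    + auto.
Qed.

Lemma entire_holo f z0 rho : entire f -> holo f z0 rho.
Proof. intros Hf w _. apply entire_cderiv, Hf. Qed.

Lemma entire_ccont f w : entire f -> ccont f w.
Proof. intros Hf. apply (holo_ccont f w 1); [apply entire_holo; auto|rewrite Cmod_sub_self; lra]. Qed.

(** The slope of [f] at [p] is visibly differentiable off [p]. Near [p] it is the Cauchy integral of
    [f] itself, because [(u - p) / (u - v) - 1 = (v - p) / (u - v)]; this removes the
    singularity. *)
Lemma entire_factor f p : entire f ->
  exists g, entire g /\ forall w, f w = (f p + (w - p) * g w)%C.
Proof.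
  intros Hf. destruct (proj1 (entire_cderiv f) Hf p) as [l Hl].
  pose proof Hl as [q [Hq [El E]]].
  exists q. split; [|intros w; rewrite (E w); ring].
  apply entire_cderiv. intros w. destruct (classic (w = p)) as [->|N].
  - set (k := fun u => (/ RtoC (2 * PI) * f u)%C).
    assert (Cf : forall u, ccont f u) by (intros; apply entire_ccont; auto).
    assert (Ck : forall u, Cmod (u - p) = 1 -> ccont k u).
    { intros u Hu. apply ccont_mult; [apply ccont_const|auto]. }
    eexists. refine (cderiv_ext_loc _ _ _ _ 1 Rlt_0_1 _ (cderiv_cauchy_type k p 1 Ck p _)).
    2: rewrite Cmod_sub_self; lra.
    assert (A : forall v, Cmod (v - p) < 1 -> v <> p -> cmean (fun u => (k u * / (u - v))%C) p 1 = q v).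
    { intros v Hv Nv. assert (N' := Csub_neq_0 v p Nv).
      pose proof (cauchy_formula f p 2 1 v (entire_holo f p 2 Hf) Hv ltac:(lra)) as F1.
      pose proof (cauchy_formula f p 2 1 p (entire_holo f p 2 Hf) ltac:(rewrite Cmod_sub_self;
        lra) ltac:(lra)) as F2.
      assert (CK : forall v u,
        Cmod (v - p) < 1 -> Cmod (u - p) = 1 -> ccont (fun u => (f u * ((u - p) * / (u - v)))%C) u).
      { intros v' u Hv' Hu. apply ccont_mult; auto. apply ccont_mult; [apply ccont_sub|].
        apply ccont_inv_sub. eapply circle_neq; eauto. }
      assert (P0 : Cmod (p - p) < 1) by (rewrite Cmod_sub_self; lra).
      rewrite (cmean_ext _ (fun u => (/ (RtoC (2 * PI) * (v - p)) * (f u * ((u - p) * / (u - v)) - f u *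
        ((u - p) * / (u - p))))%C)); try lra.
      - rewrite (cmean_Cmult _ (fun u => (f u * ((u - p) * / (u - v)) - f u * ((u - p) * / (u - p)))%C));
        try lra.
        2: intros u Hu; apply ccont_minus; apply CK; auto.
        rewrite (cmean_minus (fun u => f u * ((u - p) * / (u - v)))%C (fun u => f u * ((u - p) * /
          (u - p)))%C); try lra; auto.
        rewrite F1, F2, (E v). field. split; auto. apply two_PI_neq_0.
      - intros u Hu. unfold k. assert ((u - v)%C <> 0%C) by (eapply circle_neq; eauto).
        assert ((u - p)%C <> 0%C) by (eapply circle_neq; eauto).
        field. repeat split; auto. apply two_PI_neq_0. }
    intros v Hv. destruct (classic (v = p)) as [->|Nv]; [|apply A; auto].
    (* Both sides are continuous at [p] and agree off [p]. *)
    apply NNPP. intros N.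
    set (J := fun v => cmean (fun u => (k u * / (u - v))%C) p 1) in *.
    assert (CJ : ccont J p).
    { eapply cderiv_ccont. apply (cderiv_cauchy_type k p 1 Ck p). rewrite Cmod_sub_self; lra. }
    assert (CD : ccont (fun v => (J v - q v)%C) p) by (apply ccont_minus; auto).
    destruct (CD (Cmod (J p - q p))) as [d [Hd H]]; [apply Cmod_pos_sub; exact N|].
    set (e := Rmin d 1 / 2). assert (e <= d / 2 /\ e <= 1 / 2 /\ 0 < e).
    { unfold e. pose proof (Rmin_l d 1). pose proof (Rmin_r d 1).
      assert (0 < Rmin d 1) by (apply Rmin_pos; lra). lra. }
    specialize (H (p + RtoC e)%C).
    assert (Ee : Cmod (p + RtoC e - p) = e).
    { replace (p + RtoC e - p)%C with (RtoC e) by ring. rewrite Cmod_R. apply Rabs_pos_eq; lra. }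
    rewrite Ee in H. specialize (H ltac:(lra)).
    assert (Eq : J (p + RtoC e)%C = q (p + RtoC e)%C).
    { assert (Np : (p + RtoC e)%C <> p) by (intros Ep; rewrite Ep, Cmod_sub_self in Ee; lra).
      assert (Lp : Cmod (p + RtoC e - p) < 1) by lra.
      exact (A _ Lp Np). }
    rewrite Eq in H. replace (q (p + e) - q (p + e) - (J p - q p))%C with (- (J p - q p))%C in H by ring.
    rewrite Cmod_opp in H. lra.
  - assert (N' := Csub_neq_0 w p N). destruct (proj1 (entire_cderiv f) Hf w) as [m Hm].
    eexists. apply (cderiv_ext_loc (fun v => ((f v - f p) * / (v - p))%C) q w _ (Cmod (w - p))).
    + apply Cmod_pos_sub; auto.
    + intros v Hv. rewrite (E v). assert ((v - p)%C <> 0%C).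
      { apply Csub_neq_0. intros ->. rewrite Cmod_sub_sym in Hv. lra. }
      field. auto.
    + apply cderiv_mult.
      * apply cderiv_minus; [eauto|apply cderiv_const].
      * apply (cderiv_inv (fun u => (u - p)%C)); auto. apply cderiv_sub.
Qed.

(** * Division of entire functions *)

(** On the circle of radius [R = 2 * (d + 1)] the cofactor of [(z - w)^m] is at most [M / R^m], so
    [|G z|] is at most [2 M (d / R)^m], which tends to 0. As [G] is entire the circle can enclose
    any [z], and no connectedness argument arises. *)
Lemma flat_zero G w : entire G -> (forall m, vanishes_to_order G w m) -> forall z, G z = 0%C.
Proof.
  intros HG Hv z. set (d := Cmod (z - w)). assert (Pd : 0 <= d) by apply Cmod_ge_0.
  set (R := 2 * (d + 1)).
  destruct (circle_bounded G w R) as [M [M0 HM]]; [unfold R; lra|intros; apply entire_ccont; auto|].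
  assert (B : forall m, Cmod (G z) <= 2 * M * (1 / 2) ^ m).
  { intros m. destruct (Hv m) as [h [Hh E]].
    assert (PR : 0 < R ^ m) by (apply pow_lt; unfold R; lra).
    assert (Bh : Cmod (h z) <= 2 * (M / R ^ m)).
    { apply (holo_bound h w (R + 1) R).
      - apply entire_holo; auto.
      - unfold R; lra.
      - fold d. unfold R; lra.
      - intros u Hu. specialize (HM u Hu). rewrite E, Cmod_mult, Cmod_pow, Hu in HM.
        apply Rmult_le_reg_l with (R ^ m); auto. replace (R ^ m * (M / R ^ m)) with M by (field; lra). auto. }
    rewrite E, Cmod_mult, Cmod_pow. fold d.
    apply Rle_trans with (d ^ m * (2 * (M / R ^ m))).
    { apply Rmult_le_compat_l; auto. apply pow_le; auto. }
    replace (d ^ m * (2 * (M / R ^ m))) with (2 * M * (d / R) ^ m).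
    2:{ unfold Rdiv. rewrite Rpow_mult_distr, pow_inv. ring. }
    apply Rmult_le_compat_l; [lra|]. apply pow_incr. unfold R. split.
    - apply Rmult_le_pos; [auto|]. left. apply Rinv_0_lt_compat; lra.
    - apply Rmult_le_reg_r with (2 * (d + 1)); [lra|]. field_simplify; lra. }
  apply Cmod_eq_0. apply Rle_antisym; [|apply Cmod_ge_0]. apply Rnot_lt_le. intros N.
  destruct (pow_lt_1_zero (1 / 2)) with (y := Cmod (G z) / (2 * M + 1)) as [m Hm].
  - rewrite Rabs_pos_eq; lra.
  - apply Rdiv_lt_0_compat; lra.
  - specialize (Hm m (le_n m)). specialize (B m).
    assert (P : 0 < (1 / 2) ^ m) by (apply pow_lt; lra). rewrite Rabs_pos_eq in Hm by lra.
    apply Rmult_lt_compat_r with (r := 2 * M + 1) in Hm; [|lra].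
    replace (Cmod (G z) / (2 * M + 1) * (2 * M + 1)) with (Cmod (G z)) in Hm by (field; lra). lra.
Qed.

(** By [flat_zero] the orders of vanishing are bounded. At the last one the cofactor is nonzero at
    [w], since otherwise [entire_factor] would split off one more power. *)
Lemma exact_order G z0 w : entire G -> G z0 <> 0%C ->
  exists m g, entire g /\ (forall z, G z = ((z - w) ^ m * g z)%C) /\ g w <> 0%C.
Proof.
  intros HG Hz.
  assert (V0 : vanishes_to_order G w 0) by (exists G; split; auto; intros; simpl; ring).
  assert (Ex : exists m, vanishes_to_order G w m /\ ~ vanishes_to_order G w (S m)).
  { apply NNPP. intros N. apply Hz. apply (flat_zero G w HG). intros m.
    induction m as [|m IH]; auto. apply NNPP. intros N'. apply N. exists m. auto. }
  destruct Ex as [m [[g [Hg E]] N]]. exists m, g. repeat split; auto.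
  intros Z. apply N. destruct (entire_factor g w Hg) as [g' [Hg' E']].
  exists g'. split; auto. intros z. rewrite E, E', Z. simpl. ring.
Qed.

Lemma entire_quotient F G z0 : entire F -> entire G -> G z0 <> 0%C ->
  (forall w m, vanishes_to_order G w m -> vanishes_to_order F w m) ->
  exists H, entire H /\ forall z, F z = (H z * G z)%C.
Proof.
  intros HF HG Hz HV.
  set (P := fun w v => exists m g h, entire g /\ entire h /\ (forall z, G z = ((z - w) ^ m * g z)%C) /\
    (forall z, F z = ((z - w) ^ m * h z)%C) /\ g w <> 0%C /\ v = (h w / g w)%C).
  assert (HP : forall w, exists v, P w v).
  { intros w. destruct (exact_order G z0 w HG Hz) as [m [g [Hg [Eg Ng]]]].
    destruct (HV w m) as [h [Hh Eh]]; [exists g; auto|].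
    exists (h w / g w)%C, m, g, h. repeat split; auto. }
  set (H := fun w => proj1_sig (constructive_indefinite_description _ (HP w))).
  assert (HH : forall w, P w (H w)).
  { intros w. apply (proj2_sig (constructive_indefinite_description _ (HP w))). }
  assert (E : forall z, F z = (H z * G z)%C).
  { intros z. destruct (HH z) as [m [g [h [_ [_ [Eg [Eh [Ng Ev]]]]]]]].
    rewrite Ev, Eg, Eh. field. auto. }
  exists H. split; auto. apply entire_cderiv. intros w.
  destruct (HH w) as [m [g [h [Hg [Hh [Eg [Eh [Ng Ev]]]]]]]].
  destruct (proj1 (entire_cderiv g) Hg w) as [lg Hlg]. destruct (proj1 (entire_cderiv h) Hh w) as [lh Hlh].
  destruct (cderiv_ccont _ _ _ Hlg (Cmod (g w))) as [d [Hd K]]; [apply Cmod_gt_0; auto|].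
  eexists. refine (cderiv_ext_loc (fun v => (h v * / g v)%C) H w _ d Hd _ _).
  (* Close to [w] the cofactor [g] does not vanish, so off [w] the identity [F = H G] determines
     [H v]; at [w] the chosen value is [h w / g w] by construction. *)
  - intros v Hv. destruct (classic (v = w)) as [->|N]; [rewrite Ev; reflexivity|].
    assert (Gv : g v <> 0%C).
    { intros Z. specialize (K v Hv). rewrite Z in K. replace (0 - g w)%C with (- g w)%C in K by ring.
      rewrite Cmod_opp in K. lra. }
    assert (Pw : ((v - w) ^ m)%C <> 0%C) by (apply Cpow_nz, Csub_neq_0; auto).
    assert (Ez := E v). rewrite Eg, Eh in Ez.
    assert (Ez' : h v = (H v * g v)%C).
    { replace (h v) with (/ ((v - w) ^ m) * ((v - w) ^ m * h v))%C by (field; auto).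
      rewrite Ez. field. auto. }
    rewrite Ez'. field. auto.
  - apply cderiv_mult; [eauto|]. apply cderiv_inv; eauto.
Qed.

(** * Laplacian in logarithmic polar coordinates *)

Definition nsq (z : C) : R := fst z * fst z + snd z * snd z.

Lemma nsq_Cmod z : nsq z = Cmod z * Cmod z.
Proof. pose proof (Cmod2_alt z) as H. simpl in H. unfold nsq, Re, Im in *. lra. Qed.

Lemma nsq_pos z : 0 <= nsq z.
Proof. unfold nsq. nra. Qed.

Lemma ccont_ccont2 k x y : ccont k (x, y) -> ccont2 (fun u v => k (u, v)) x y.
Proof.
  intros H eps He. destruct (H eps He) as [d [Hd K]]. exists (d / 2). split; [lra|].
  intros u v Hu Hv. apply K. eapply Rle_lt_trans; [apply Cmod_le_abs|]. simpl.
  unfold Rminus in *. lra.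
Qed.

Lemma continuity_2d_pt_section f x y : continuity_2d_pt f x y -> continuous (f x) y.
Proof.
  intros H. apply continuity_pt_filterlim. intros e He.
  destruct (H (mkposreal e He)) as [d Hd]. exists d. split; [apply cond_pos|].
  intros v [_ Hv]. apply Hd; [rewrite Rminus_diag, Rabs_R0; apply cond_pos|exact Hv].
Qed.

Lemma ex_RInt_section f x a b : a <= b -> (forall y, a <= y <= b -> continuity_2d_pt f x y) ->
  ex_RInt (f x) a b.
Proof.
  intros Hab H. apply (ex_RInt_continuous (V := R_CompleteNormedModule)). intros y Hy.
  rewrite Rmin_left, Rmax_right in Hy by auto. apply continuity_2d_pt_section, H, Hy.
Qed.

Lemma is_derive_RInt_parameter (f f1 : R -> R -> R) a b x S : a <= b -> x < S ->
  (forall u v, u < S -> is_derive (fun u => f u v) u (f1 u v)) ->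
  (forall u v, u < S -> continuity_2d_pt f u v) ->
  (forall u v, u < S -> continuity_2d_pt f1 u v) ->
  is_derive (fun u => RInt (f u) a b) x (RInt (f1 x) a b).
Proof.
  intros Hab Hx D C0 C1.
  assert (E : forall u v, u < S -> Derive (fun u => f u v) u = f1 u v).
  { intros u v Hu. apply is_derive_unique, D, Hu. }
  assert (L : locally x (fun u => u < S)).
  { exists (mkposreal (S - x) ltac:(lra)). intros u Hu.
    change (Rabs (u - x) < S - x) in Hu. apply Rabs_def2 in Hu. lra. }
  rewrite <- (RInt_ext (fun t => Derive (fun u => f u t) x) (f1 x)) by (intros; apply E, Hx).
  apply (is_derive_RInt_param f a b x).
  - revert L. apply filter_imp. intros u Hu t _. exists (f1 u t). apply D, Hu.
  - intros t _. apply (continuity_2d_pt_ext_loc f1); [|apply C1, Hx].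
    exists (mkposreal (S - x) ltac:(lra)). intros u v Hu _. simpl in Hu. apply Rabs_def2 in Hu.
    symmetry. apply E. lra.
  - revert L. apply filter_imp. intros u Hu. apply ex_RInt_section; auto.
Qed.

Section logpolar.
(** In use [k w] is [K (z + e^w)]: the real part of [w] is the logarithm of the radius, the
    imaginary part the angle, and [S] bounds the logarithmic radius. *)
Variables (k k1 k2 : C -> C) (S : R) (Phi Phi1 Phi2 : R -> R).
Hypothesis Dk : forall w, fst w < S -> cderiv k w (k1 w).
Hypothesis Dk1 : forall w, fst w < S -> cderiv k1 w (k2 w).
Hypothesis Ck2 : forall w, fst w < S -> ccont k2 w.
Hypothesis Pk : forall s, k (s, 2 * PI) = k (s, 0).
Hypothesis Pk1 : forall s, k1 (s, 2 * PI) = k1 (s, 0).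
Hypothesis DPhi : forall x, 0 <= x -> is_derive Phi x (Phi1 x).
Hypothesis DPhi1 : forall x, 0 <= x -> is_derive Phi1 x (Phi2 x).
Hypothesis CPhi2 : forall x, 0 <= x -> continuity_pt Phi2 x.

(** Here [x] is [|k|^2]. Derivatives in the angle are written with those in [s] through the
    Cauchy-Riemann equations: the [t]-derivatives of [p] and [q] are [- q1] and [p1]. *)
Let p s t := fst (k (s, t)).
Let q s t := snd (k (s, t)).
Let p1 s t := fst (k1 (s, t)).
Let q1 s t := snd (k1 (s, t)).
Let p2 s t := fst (k2 (s, t)).
Let q2 s t := snd (k2 (s, t)).
Let x s t := p s t * p s t + q s t * q s t.
Let xs s t := 2 * (p s t * p1 s t + q s t * q1 s t).
Let xt s t := 2 * (q s t * p1 s t - p s t * q1 s t).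
Let xss s t := 2 * (p1 s t * p1 s t + q1 s t * q1 s t + (p s t * p2 s t + q s t * q2 s t)).
Let xtt s t := 2 * (p1 s t * p1 s t + q1 s t * q1 s t - (p s t * p2 s t + q s t * q2 s t)).
Let f s t := Phi (x s t).
Let f1 s t := Phi1 (x s t) * xs s t.
Let f2 s t := Phi2 (x s t) * (xs s t * xs s t) + Phi1 (x s t) * xss s t.
Let g1 s t := Phi1 (x s t) * xt s t.
Let g2 s t := Phi2 (x s t) * (xt s t * xt s t) + Phi1 (x s t) * xtt s t.

Lemma horizontal_derive (h h1 : C -> C) s t : cderiv h (s, t) (h1 (s, t)) ->
  is_derive (fun s => fst (h (s, t))) s (fst (h1 (s, t))) /\
  is_derive (fun s => snd (h (s, t))) s (snd (h1 (s, t))).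
Proof.
  intros H. assert (D : rderiv (fun s => h (s, t)) s (h1 (s, t))).
  { replace (h1 (s, t)) with (h1 (s, t) * 1)%C by ring.
    apply (rderiv_comp h (fun s => (s, t))); auto. apply rderiv_horizontal. }
  split; [apply (rderiv_fst (fun s => h (s, t))); auto|apply (rderiv_snd (fun s => h (s, t))); auto].
Qed.

Lemma vertical_derive (h h1 : C -> C) s t : cderiv h (s, t) (h1 (s, t)) ->
  is_derive (fun t => fst (h (s, t))) t (- snd (h1 (s, t))) /\
  is_derive (fun t => snd (h (s, t))) t (fst (h1 (s, t))).
Proof.
  intros H. assert (D : rderiv (fun t => h (s, t)) t (h1 (s, t) * Ci)%C).
  { apply (rderiv_comp h (fun t => (s, t))); auto. apply rderiv_vertical. }
  replace (h1 (s, t) * Ci)%C with ((- snd (h1 (s, t)), fst (h1 (s, t))) : C) in D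
    by (unfold Ci, Cmult; simpl; f_equal; ring).
  split; [apply (rderiv_fst _ _ _ D)|apply (rderiv_snd _ _ _ D)].
Qed.

Lemma x_pos s t : 0 <= x s t. Proof. unfold x. nra. Qed.

Lemma is_derive_Rmult (a b : R -> R) u a' b' : is_derive a u a' -> is_derive b u b' ->
  is_derive (fun u => a u * b u) u (a' * b u + a u * b').
Proof. intros Ha Hb. apply (is_derive_mult (K := R_AbsRing) a b); auto. intros; apply Rmult_comm. Qed.

Lemma is_derive_Rplus (a b : R -> R) u a' b' : is_derive a u a' -> is_derive b u b' ->
  is_derive (fun u => a u + b u) u (a' + b').
Proof. intros Ha Hb. apply (is_derive_plus (K := R_AbsRing) (V := R_NormedModule) a b); auto. Qed.

Lemma is_derive_Rminus (a b : R -> R) u a' b' : is_derive a u a' -> is_derive b u b' ->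
  is_derive (fun u => a u - b u) u (a' - b').
Proof. intros Ha Hb. apply (is_derive_minus (K := R_AbsRing) (V := R_NormedModule) a b); auto. Qed.

Lemma is_derive_Rcomp (a b : R -> R) u a' b' : is_derive a (b u) a' -> is_derive b u b' ->
  is_derive (fun u => a (b u)) u (a' * b').
Proof.
  intros Ha Hb. replace (a' * b') with (scal (V := R_NormedModule) b' a') by apply Rmult_comm.
  apply (is_derive_comp (K := R_AbsRing) (V := R_NormedModule) a b); auto.
Qed.

Lemma is_derive_Rconst (c u : R) : is_derive (fun _ : R => c) u 0.
Proof. apply (is_derive_const (K := R_AbsRing) (V := R_NormedModule)). Qed.

Lemma is_derive_eq (a : R -> R) (u l l' : R) : is_derive a u l -> l = l' -> is_derive a u l'.
Proof. intros H <-. exact H. Qed.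

Lemma x_derive_s s t : s < S -> is_derive (fun s => x s t) s (xs s t).
Proof.
  intros Hs. destruct (horizontal_derive k k1 s t (Dk (s, t) Hs)) as [A B].
  eapply is_derive_eq; [apply is_derive_Rplus; apply is_derive_Rmult; eauto|]. unfold xs, p, q, p1, q1. ring.
Qed.

Lemma xs_derive_s s t : s < S -> is_derive (fun s => xs s t) s (xss s t).
Proof.
  intros Hs. destruct (horizontal_derive k k1 s t (Dk (s, t) Hs)) as [A B].
  destruct (horizontal_derive k1 k2 s t (Dk1 (s, t) Hs)) as [A1 B1].
  eapply is_derive_eq; [apply is_derive_Rmult; [apply is_derive_Rconst|apply is_derive_Rplus;
    apply is_derive_Rmult; eauto]|]. unfold xss, p, q, p1, q1, p2, q2. ring.
Qed.

Lemma x_derive_t s t : s < S -> is_derive (fun t => x s t) t (xt s t).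
Proof.
  intros Hs. destruct (vertical_derive k k1 s t (Dk (s, t) Hs)) as [A B].
  eapply is_derive_eq; [apply is_derive_Rplus; apply is_derive_Rmult; eauto|]. unfold xt, p, q, p1, q1. ring.
Qed.

Lemma xt_derive_t s t : s < S -> is_derive (fun t => xt s t) t (xtt s t).
Proof.
  intros Hs. destruct (vertical_derive k k1 s t (Dk (s, t) Hs)) as [A B].
  destruct (vertical_derive k1 k2 s t (Dk1 (s, t) Hs)) as [A1 B1].
  eapply is_derive_eq; [apply is_derive_Rmult; [apply is_derive_Rconst|apply is_derive_Rminus;
    apply is_derive_Rmult; eauto]|]. unfold xtt, p, q, p1, q1, p2, q2. ring.
Qed.

Lemma f_derive_s s t : s < S -> is_derive (fun s => f s t) s (f1 s t).
Proof. intros Hs. apply (is_derive_Rcomp Phi (fun s => x s t)); [apply DPhi, x_pos|apply x_derive_s, Hs]. Qed.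

Lemma f1_derive_s s t : s < S -> is_derive (fun s => f1 s t) s (f2 s t).
Proof.
  intros Hs. eapply is_derive_eq; [apply is_derive_Rmult; [apply (is_derive_Rcomp Phi1 (fun s => x s t));
  [apply DPhi1, x_pos|apply x_derive_s, Hs]|apply xs_derive_s, Hs]|].
  unfold f2. ring.
Qed.

Lemma g1_derive_t s t : s < S -> is_derive (fun t => g1 s t) t (g2 s t).
Proof.
  intros Hs. eapply is_derive_eq; [apply is_derive_Rmult; [apply (is_derive_Rcomp Phi1 (fun t => x s t));
  [apply DPhi1, x_pos|apply x_derive_t, Hs]|apply xt_derive_t, Hs]|].
  unfold g2. ring.
Qed.

Lemma k_cont s t : s < S -> ccont k (s, t). Proof. intros Hs. eapply cderiv_ccont, Dk, Hs. Qed.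
Lemma k1_cont s t : s < S -> ccont k1 (s, t). Proof. intros Hs. eapply cderiv_ccont, Dk1, Hs. Qed.

Lemma p_continuous s t : s < S -> continuity_2d_pt p s t.
Proof. intros Hs. apply (ccont2_fst (fun s t => k (s, t))), ccont_ccont2, k_cont, Hs. Qed.
Lemma q_continuous s t : s < S -> continuity_2d_pt q s t.
Proof. intros Hs. apply (ccont2_snd (fun s t => k (s, t))), ccont_ccont2, k_cont, Hs. Qed.
Lemma p1_continuous s t : s < S -> continuity_2d_pt p1 s t.
Proof. intros Hs. apply (ccont2_fst (fun s t => k1 (s, t))), ccont_ccont2, k1_cont, Hs. Qed.
Lemma q1_continuous s t : s < S -> continuity_2d_pt q1 s t.
Proof. intros Hs. apply (ccont2_snd (fun s t => k1 (s, t))), ccont_ccont2, k1_cont, Hs. Qed.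
Lemma p2_continuous s t : s < S -> continuity_2d_pt p2 s t.
Proof. intros Hs. apply (ccont2_fst (fun s t => k2 (s, t))), ccont_ccont2, Ck2, Hs. Qed.
Lemma q2_continuous s t : s < S -> continuity_2d_pt q2 s t.
Proof. intros Hs. apply (ccont2_snd (fun s t => k2 (s, t))), ccont_ccont2, Ck2, Hs. Qed.

Ltac c2d Hs := repeat first [ apply continuity_2d_pt_minus | apply continuity_2d_pt_plus | apply
  continuity_2d_pt_mult
  | apply continuity_2d_pt_const | apply p_continuous, Hs | apply q_continuous, Hs | apply p1_continuous,
    Hs | apply q1_continuous, Hs
  | apply p2_continuous, Hs | apply q2_continuous, Hs ].

Lemma x_continuous s t : s < S -> continuity_2d_pt x s t. Proof. intros Hs. unfold x. c2d Hs. Qed.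
Lemma xs_continuous s t : s < S -> continuity_2d_pt xs s t. Proof. intros Hs. unfold xs. c2d Hs. Qed.
Lemma xt_continuous s t : s < S -> continuity_2d_pt xt s t. Proof. intros Hs. unfold xt. c2d Hs. Qed.
Lemma xss_continuous s t : s < S -> continuity_2d_pt xss s t. Proof. intros Hs. unfold xss. c2d Hs. Qed.
Lemma xtt_continuous s t : s < S -> continuity_2d_pt xtt s t. Proof. intros Hs. unfold xtt. c2d Hs. Qed.

Lemma is_derive_continuity_pt (h : R -> R) u l : is_derive h u l -> continuity_pt h u.
Proof. intros H. apply continuity_pt_filterlim. apply (ex_derive_continuous (V := R_NormedModule)). exists l.
auto. Qed.

Lemma Phi_x_continuous s t : s < S -> continuity_2d_pt (fun s t => Phi (x s t)) s t.
Proof.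
  intros Hs. apply (continuity_1d_2d_pt_comp Phi x); [|apply x_continuous, Hs].
  eapply is_derive_continuity_pt, DPhi, x_pos.
Qed.
Lemma Phi1_x_continuous s t : s < S -> continuity_2d_pt (fun s t => Phi1 (x s t)) s t.
Proof.
  intros Hs. apply (continuity_1d_2d_pt_comp Phi1 x); [|apply x_continuous, Hs].
  eapply is_derive_continuity_pt, DPhi1, x_pos.
Qed.
Lemma Phi2_x_continuous s t : s < S -> continuity_2d_pt (fun s t => Phi2 (x s t)) s t.
Proof.
  intros Hs. apply (continuity_1d_2d_pt_comp Phi2 x); [|apply x_continuous, Hs]. apply CPhi2, x_pos.
Qed.

Lemma f1_continuous s t : s < S -> continuity_2d_pt f1 s t.
Proof. intros Hs. apply continuity_2d_pt_mult; [apply Phi1_x_continuous, Hs|apply xs_continuous, Hs]. Qed.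

Lemma f2_continuous s t : s < S -> continuity_2d_pt f2 s t.
Proof.
  intros Hs. apply continuity_2d_pt_plus; apply continuity_2d_pt_mult;
    [apply Phi2_x_continuous, Hs|apply continuity_2d_pt_mult;
      apply xs_continuous, Hs|apply Phi1_x_continuous, Hs|apply xss_continuous, Hs].
Qed.

Lemma g2_continuous s t : s < S -> continuity_2d_pt g2 s t.
Proof.
  intros Hs. apply continuity_2d_pt_plus; apply continuity_2d_pt_mult;
    [apply Phi2_x_continuous, Hs|apply continuity_2d_pt_mult;
      apply xt_continuous, Hs|apply Phi1_x_continuous, Hs|apply xtt_continuous, Hs].
Qed.

(** [g2] is the angular derivative of [g1], which has equal values at both ends of the period. *)
Lemma integral_g2 s : s < S -> is_RInt (g2 s) 0 (2 * PI) 0.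
Proof.
  intros Hs.
  replace 0 with (minus (G := R_NormedModule) (g1 s (2 * PI)) (g1 s 0)) at 2.
  - apply (is_RInt_derive (V := R_CompleteNormedModule) (g1 s) (g2 s)); intros t _.
    + apply g1_derive_t, Hs.
    + apply continuity_2d_pt_section, g2_continuous, Hs.
  - change (g1 s (2 * PI) - g1 s 0 = 0). unfold g1, xt, x, p, q, p1, q1. rewrite Pk, Pk1. ring.
Qed.

(** The Laplacian of [Phi (|k|^2)]: for holomorphic [k] one has [xss + xtt = 4 |k1|^2] and
    [xs^2 + xt^2 = 4 |k1|^2 |k|^2], and the second derivatives of [k] drop out. *)
Definition logpolar_density s t :=
  4 * nsq (k1 (s, t)) * (Phi1 (nsq (k (s, t))) + nsq (k (s, t)) * Phi2 (nsq (k (s, t)))).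

Definition logpolar_slope s t :=
  Phi1 (nsq (k (s, t))) * (2 * (fst (k (s, t)) * fst (k1 (s, t)) + snd (k (s, t)) * snd (k1 (s, t)))).

(* The angular part of the Laplacian integrates to zero by periodicity, so it may be added for free. *)
Lemma logpolar_mean s : s < S ->
  is_derive (fun s => RInt (fun t => Phi (nsq (k (s, t)))) 0 (2 * PI)) s (RInt (logpolar_slope s) 0 (2 * PI)) /\
  is_derive (fun s => RInt (logpolar_slope s) 0 (2 * PI)) s (RInt (logpolar_density s) 0 (2 * PI)).
Proof.
  intros Hs. pose proof two_PI_pos as HP. split.
  - apply (is_derive_RInt_parameter f f1 0 (2 * PI) s S); try lra.
    + intros; apply f_derive_s; auto.
    + intros; apply Phi_x_continuous; auto.
    + intros; apply f1_continuous; auto.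
  - replace (RInt (logpolar_density s) 0 (2 * PI)) with (RInt (f2 s) 0 (2 * PI)).
    + apply (is_derive_RInt_parameter f1 f2 0 (2 * PI) s S); try lra.
      * intros; apply f1_derive_s; auto.
      * intros; apply f1_continuous; auto.
      * intros; apply f2_continuous; auto.
    + symmetry. apply is_RInt_unique.
      apply (is_RInt_ext (fun t => plus (f2 s t) (g2 s t))).
      * intros t _. change (f2 s t + g2 s t = logpolar_density s t).
        unfold f2, g2, logpolar_density, xs, xt, xss, xtt, x, nsq.
        fold (p s t) (q s t) (p1 s t) (q1 s t) (p2 s t) (q2 s t). ring.
      * rewrite <- (Rplus_0_r (RInt (f2 s) 0 (2 * PI))).
        apply (is_RInt_plus (V := R_NormedModule)); [|apply integral_g2, Hs].
        apply (RInt_correct (V := R_CompleteNormedModule)). apply ex_RInt_section; [lra|].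
        intros; apply f2_continuous, Hs.
Qed.

Lemma ex_RInt_logpolar_density s : s < S -> ex_RInt (logpolar_density s) 0 (2 * PI).
Proof.
  intros Hs. pose proof two_PI_pos. apply (ex_RInt_ext (fun t => f2 s t + g2 s t)).
  - intros t _. change (f2 s t + g2 s t = logpolar_density s t).
    unfold f2, g2, logpolar_density, xs, xt, xss, xtt, x, nsq.
    fold (p s t) (q s t) (p1 s t) (q1 s t) (p2 s t) (q2 s t). ring.
  - apply (ex_RInt_plus (V := R_NormedModule) (f2 s) (g2 s)); apply ex_RInt_section; try lra; intros;
    [apply f2_continuous, Hs|apply g2_continuous, Hs].
Qed.

Lemma ex_RInt_logpolar_slope s : s < S -> ex_RInt (logpolar_slope s) 0 (2 * PI).
Proof.
  intros Hs. pose proof two_PI_pos. apply (ex_RInt_section f1); [lra|]. intros; apply f1_continuous, Hs.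
Qed.

Lemma ex_RInt_logpolar s : s < S -> ex_RInt (fun t => Phi (nsq (k (s, t)))) 0 (2 * PI).
Proof.
  intros Hs. pose proof two_PI_pos. apply (ex_RInt_section f); [lra|]. intros; apply Phi_x_continuous, Hs.
Qed.
End logpolar.

(** * Subharmonic means and good circles *)

Lemma mean_value (f df : R -> R) a b : a <= b -> (forall x, a <= x <= b -> is_derive f x (df x)) ->
  exists c, a <= c <= b /\ f b - f a = df c * (b - a).
Proof.
  intros Hab H. destruct (MVT_gen f a b df) as [c [Hc E]].
  - intros x Hx. rewrite Rmin_left, Rmax_right in Hx by auto. apply H. lra.
  - intros x Hx. rewrite Rmin_left, Rmax_right in Hx by auto. eapply is_derive_continuity_pt, H, Hx.
  - rewrite Rmin_left, Rmax_right in Hc by auto. exists c. auto.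
Qed.

(** A convex function with a finite limit at minus infinity is nondecreasing: a negative slope
    somewhere would be at least as steep everywhere to the left and drive [U] to infinity. *)
Lemma convex_ge_limit (U U1 U2 : R -> R) S L :
  (forall s, s < S -> is_derive U s (U1 s)) -> (forall s, s < S -> is_derive U1 s (U2 s)) ->
  (forall s, s < S -> 0 <= U2 s) ->
  (forall eps, 0 < eps -> exists s1, forall s, s <= s1 -> Rabs (U s - L) <= eps) ->
  forall s, s < S -> L <= U s.
Proof.
  intros D1 D2 Pos Lim.
  assert (Mon : forall a b, a <= b -> b < S -> U1 a <= U1 b).
  { intros a b Hab Hb. destruct (mean_value U1 U2 a b Hab) as [c [Hc E]].
    - intros x Hx. apply D2. lra.
    - specialize (Pos c ltac:(lra)). nra. }
  assert (Pos1 : forall s, s < S -> 0 <= U1 s).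
  { intros s Hs. apply Rnot_lt_le. intros N.
    destruct (Lim 1 Rlt_0_1) as [s1 H1].
    (* So far left that the slope at [s] already forces [U a - U s >= |U s - L| + 2], while [U a] is
       within 1 of [L]. *)
    set (a := Rmin s1 (s - (Rabs (U s - L) + 2) / - U1 s)).
    assert (A1 : a <= s1) by apply Rmin_l.
    assert (A2 : a <= s - (Rabs (U s - L) + 2) / - U1 s) by apply Rmin_r.
    pose proof (Rabs_pos (U s - L)) as PA.
    assert (Q : 0 < (Rabs (U s - L) + 2) / - U1 s) by (apply Rdiv_lt_0_compat; lra).
    destruct (mean_value U U1 a s) as [c [Hc E]]; [lra|intros; apply D1; lra|].
    specialize (Mon c s ltac:(lra) Hs). specialize (H1 a A1).
    assert (T : (Rabs (U s - L) + 2) / - U1 s * - U1 s = Rabs (U s - L) + 2) by (field; lra).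
    assert (T2 : (Rabs (U s - L) + 2) / - U1 s * - U1 s <= (s - a) * - U1 s) by (apply Rmult_le_compat_r; lra).
    assert (T3 : (s - a) * - U1 s <= (s - a) * - U1 c) by (apply Rmult_le_compat_l; lra).
    apply Rabs_le_between in H1. pose proof (Rle_abs (U s - L)). 
    pose proof (Rle_abs (- (U s - L))) as T4. rewrite Rabs_Ropp in T4. nra. }
  intros s Hs. apply Rnot_lt_le. intros N.
  destruct (Lim ((L - U s) / 2)) as [s1 H1]; [lra|].
  set (a := Rmin s1 s). assert (A1 : a <= s1) by apply Rmin_l. assert (A2 : a <= s) by apply Rmin_r.
  destruct (mean_value U U1 a s A2) as [c [Hc E]]; [intros; apply D1; lra|].
  specialize (Pos1 c ltac:(lra)). specialize (H1 a A1). apply Rabs_le_between in H1. nra.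
Qed.

Definition rmean (P : C -> R) (z : C) (r : R) : R := RInt (fun t => P (z + RtoC r * cis t)%C) 0 (2 * PI).

Lemma cexp_period s : cexp (s, 2 * PI) = cexp (s, 0).
Proof. unfold cexp. simpl. rewrite cos_2PI, sin_2PI, cos_0, sin_0. reflexivity. Qed.

(** [|K|^2] is the product of [K] with its conjugate, so the product rule for [ccont] applies. *)
Lemma nsq_ccont K z : ccont K z -> forall eps, 0 < eps -> exists d, 0 < d /\
  forall w, Cmod (w - z) < d -> Rabs (nsq (K w) - nsq (K z)) < eps.
Proof.
  intros H eps He. 
  assert (H2 : ccont (fun w => (K w * Cconj (K w))%C) z).
  { apply ccont_mult; auto. apply (ccont_comp Cconj K); auto.
    intros e E. exists e. split; auto. intros w Hw. rewrite <- Cmod_conj in Hw.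
    rewrite Cminus_conj in Hw. exact Hw. }
  destruct (H2 eps He) as [d [Hd D]]. exists d. split; auto. intros w Hw. specialize (D w Hw).
  assert (E : forall u, (K u * Cconj (K u))%C = RtoC (nsq (K u))).
  { intros u. unfold nsq, Cconj, Cmult, RtoC. simpl. f_equal; ring. }
  rewrite !E, <- RtoC_minus, Cmod_R in D. exact D.
Qed.

(** The sign condition says that the Laplacian of [Phi (|K|^2)] is nonnegative. The circular mean is
    then convex in [ln r], and its limit as [r] tends to 0 is the left-hand side. *)
Lemma submean (Phi Phi1 Phi2 : R -> R) K z rho r :
  (forall x, 0 <= x -> is_derive Phi x (Phi1 x)) ->
  (forall x, 0 <= x -> is_derive Phi1 x (Phi2 x)) ->
  (forall x, 0 <= x -> continuity_pt Phi2 x) ->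
  (forall x, 0 <= x -> 0 <= Phi1 x + x * Phi2 x) ->
  holo K z rho -> 0 < r < rho ->
  2 * PI * Phi (nsq (K z)) <= rmean (fun w => Phi (nsq (K w))) z r.
Proof.
  intros D1 D2 C2 Pos HK Hr. pose proof two_PI_pos as HP.
  destruct (holo_C_derive K z rho HK) as [DK HK1].
  destruct (holo_C_derive _ z rho HK1) as [DK1 HK2].
  set (K1 := C_derive K) in *. set (K2 := C_derive K1) in *.
  set (S := ln rho).
  set (k := fun w => K (z + cexp w)%C).
  set (k1 := fun w => (K1 (z + cexp w) * cexp w)%C).
  set (k2 := fun w => (K2 (z + cexp w) * cexp w * cexp w + K1 (z + cexp w) * cexp w)%C).
  assert (In : forall w, fst w < S -> Cmod (z + cexp w - z) < rho).
  { intros w Hw. replace (z + cexp w - z)%C with (cexp w) by ring. rewrite Cmod_cexp.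
    rewrite <- (exp_ln rho) by lra. apply exp_increasing. auto. }
  assert (Dz : forall w, cderiv (fun w => (z + cexp w)%C) w (cexp w)).
  { intros w. replace (cexp w) with (0 + cexp w)%C by ring. apply cderiv_plus; [apply cderiv_const|].
    replace (0 + cexp w)%C with (cexp w) by ring. apply cderiv_cexp. }
  assert (Dk : forall w, fst w < S -> cderiv k w (k1 w)).
  { intros w Hw. apply (cderiv_comp K (fun w => (z + cexp w)%C)); auto. }
  assert (Dk1 : forall w, fst w < S -> cderiv k1 w (k2 w)).
  { intros w Hw. apply (cderiv_mult (fun w => K1 (z + cexp w)%C) cexp).
    - apply (cderiv_comp K1 (fun w => (z + cexp w)%C)); auto.
    - apply cderiv_cexp. }
  assert (Cz : forall w, ccont (fun w => (z + cexp w)%C) w) by (intros; eapply cderiv_ccont; eauto).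
  assert (Cc : forall w, ccont cexp w) by (intros; eapply cderiv_ccont, cderiv_cexp).
  assert (Ck2 : forall w, fst w < S -> ccont k2 w).
  { intros w Hw. apply ccont_plus.
    - apply ccont_mult; auto. apply ccont_mult; auto. apply (ccont_comp K2 (fun w => (z + cexp w)%C)); auto.
      apply (holo_ccont K2 z rho); auto.
    - apply ccont_mult; auto. apply (ccont_comp K1 (fun w => (z + cexp w)%C)); auto.
      apply (holo_ccont K1 z rho); auto. }
  assert (Pk : forall s, k (s, 2 * PI) = k (s, 0)) by (intros s; unfold k; rewrite cexp_period; auto).
  assert (Pk1 : forall s, k1 (s, 2 * PI) = k1 (s, 0)) by (intros s; unfold k1; rewrite cexp_period; auto).
  pose proof (logpolar_mean k k1 k2 S Phi Phi1 Phi2 Dk Dk1 Ck2 Pk Pk1 D1 D2 C2) as LM.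
  assert (E : rmean (fun w => Phi (nsq (K w))) z r = RInt (fun t => Phi (nsq (k (ln r, t)))) 0 (2 * PI)).
  { apply RInt_ext. intros t _. unfold k. rewrite cexp_cis. simpl. rewrite exp_ln by lra. reflexivity. }
  rewrite E.
  refine (convex_ge_limit (fun s => RInt (fun t => Phi (nsq (k (s, t)))) 0 (2 * PI)) _ _ S _
    (fun s Hs => proj1 (LM s Hs)) (fun s Hs => proj2 (LM s Hs)) _ _ (ln r) _).
  - intros s Hs. apply RInt_ge_0; [lra|apply (ex_RInt_logpolar_density k k1 k2 S); auto|].
    intros t _. unfold logpolar_density. apply Rmult_le_pos.
    + pose proof (nsq_pos (k1 (s, t))). lra.
    + apply Pos, nsq_pos.
  - intros eps He.
    assert (CPhi : continuity_pt Phi (nsq (K z))) by (eapply is_derive_continuity_pt, D1, nsq_pos).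
    destruct (CPhi (eps / (2 * PI))) as [d [Hd CP]]; [apply Rdiv_lt_0_compat; lra|].
    destruct (nsq_ccont K z) with (eps := d) as [d' [Hd' CN]]; auto.
    { apply (holo_ccont K z rho); auto. rewrite Cmod_sub_self. lra. }
    set (m := Rmin d' rho / 2). assert (M0 : 0 < Rmin d' rho) by (apply Rmin_pos; lra).
    assert (M1 : m < d' /\ m < rho /\ 0 < m).
    { unfold m. pose proof (Rmin_l d' rho). pose proof (Rmin_r d' rho). lra. }
    exists (ln m). intros s Hs.
    assert (Es : exp s <= m).
    { rewrite <- (exp_ln m) by lra. destruct Hs as [Hs| ->]; [left; apply exp_increasing; auto|lra]. }
    assert (HsS : s < S).
    { apply exp_lt_inv. unfold S. rewrite exp_ln by lra. lra. }
    assert (Ek : forall t, Rabs (Phi (nsq (k (s, t))) - Phi (nsq (K z))) <= eps / (2 * PI)).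
    (* [continuity_pt] speaks only about points different from the base point, so equal values are
       treated apart. *)
    { intros t. destruct (Req_dec (nsq (k (s, t))) (nsq (K z))) as [Eq|Nq].
      - rewrite Eq, Rminus_diag, Rabs_R0. left. apply Rdiv_lt_0_compat; lra.
      - left. apply (CP (nsq (k (s, t)))). split; [split; [exact I|auto]|].
        apply CN. replace (z + cexp (s, t) - z)%C with (cexp (s, t)) by ring. rewrite Cmod_cexp. simpl. lra. }
    assert (EI := ex_RInt_logpolar k k1 S Phi Phi1 Dk D1 s HsS).
    apply Rabs_le. split.
    + assert (B : RInt (fun _ => Phi (nsq (K z)) - eps / (2 * PI)) 0 (2 * PI) <=
      RInt (fun t => Phi (nsq (k (s, t)))) 0 (2 * PI)).
      { apply RInt_le; [lra|apply ex_RInt_const|auto|].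
        intros t _. specialize (Ek t). apply Rabs_le_between in Ek. lra. }
      rewrite RInt_const in B. change (scal (2 * PI - 0) (Phi (nsq (K z)) - eps / (2 * PI)))
        with ((2 * PI - 0) * (Phi (nsq (K z)) - eps / (2 * PI))) in B.
      replace ((2 * PI - 0) * (Phi (nsq (K z)) - eps / (2 * PI))) with (2 * PI * Phi (nsq
        (K z)) - eps) in B by (field; lra). lra.
    + assert (B : RInt (fun t => Phi (nsq (k (s,
      t)))) 0 (2 * PI) <= RInt (fun _ => Phi (nsq (K z)) + eps / (2 * PI)) 0 (2 * PI)).
      { apply RInt_le; [lra|auto|apply ex_RInt_const|].
        intros t _. specialize (Ek t). apply Rabs_le_between in Ek. lra. }
      rewrite RInt_const in B. change (scal (2 * PI - 0) (Phi (nsq (K z)) + eps / (2 * PI)))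
        with ((2 * PI - 0) * (Phi (nsq (K z)) + eps / (2 * PI))) in B.
      replace ((2 * PI - 0) * (Phi (nsq (K z)) + eps / (2 * PI))) with (2 * PI * Phi (nsq
        (K z)) + eps) in B by (field; lra). lra.
  - unfold S. apply ln_increasing; lra.
Qed.

(** The shift [e > 0] smooths out the logarithm at zeros of [K]. It is 1 for the quotient [H] and
    arbitrarily small for [G]. *)
Lemma submean_ln e K z rho r : 0 < e -> holo K z rho -> 0 < r < rho ->
  2 * PI * ln (nsq (K z) + e) <= rmean (fun w => ln (nsq (K w) + e)) z r.
Proof.
  intros He HK Hr.
  apply (submean (fun x => ln (x + e)) (fun x => / (x + e)) (fun x => - / (x + e) ^ 2) K z rho r); auto;
    intros x Hx.
  - auto_derive; [lra|field; lra].
  - auto_derive; [lra|field; lra].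
  - apply (is_derive_continuity_pt _ _ (2 / (x + e) ^ 3)). auto_derive; [|field; lra].
    apply Rgt_not_eq. assert (0 < x + e) by lra. nra.
  - replace (/ (x + e) + x * - / (x + e) ^ 2) with (e / (x + e) ^ 2) by (field; lra).
    apply Rmult_le_pos; [lra|]. left. apply Rinv_0_lt_compat. assert (0 < x + e) by lra. nra.
Qed.

(** * Regularised poles and the choice of a circle *)

Fixpoint fsum (f : nat -> R) (N : nat) : R :=
  match N with O => 0 | S n => fsum f n + f n end.

(** A smooth substitute for [1 / |w|]: at least [1 / (2 |w|)] once [|w| >= d], and at least
    [1 / (2 d)] closer to 0. *)
Definition soft_kernel (d : R) (w : C) : R := / sqrt (nsq w + d * d).

Lemma soft_arg_pos d w : 0 < d -> 0 < nsq w + d * d.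
Proof. intros Hd. pose proof (nsq_pos w). nra. Qed.

Lemma soft_kernel_pos d w : 0 < d -> 0 < soft_kernel d w.
Proof. intros Hd. apply Rinv_0_lt_compat, sqrt_lt_R0, soft_arg_pos, Hd. Qed.

Lemma logpolar_soft z t d : 0 < d -> exists V V' : R -> R, forall s,
  is_derive V s (V' s) /\ Rabs (V s) <= 2 * PI * exp s /\
  ex_RInt (fun th => soft_kernel d (z + RtoC (exp s) * cis th - t)%C) 0 (2 * PI) /\
  exp s * exp s * rmean (fun w => soft_kernel d (w - t)%C) z (exp s) <= V' s.
Proof.
  intros Hd. pose proof two_PI_pos as HP.
  set (k := fun w => (z - t + cexp w)%C).
  set (Phi := fun x => sqrt (x + d * d)).
  set (Phi1 := fun x => / (2 * sqrt (x + d * d))).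
  set (Phi2 := fun x => - / (4 * ((x + d * d) * sqrt (x + d * d)))).
  assert (Dd : 0 < d * d) by nra.
  assert (D1 : forall x, 0 <= x -> is_derive Phi x (Phi1 x)).
  { intros x Hx. unfold Phi, Phi1. auto_derive; [lra|]. field.
    apply Rgt_not_eq, sqrt_lt_R0. lra. }
  assert (D2 : forall x, 0 <= x -> is_derive Phi1 x (Phi2 x)).
  { intros x Hx. assert (0 < sqrt (x + d * d)) by (apply sqrt_lt_R0; lra).
    unfold Phi1, Phi2. auto_derive; [split; [lra|split; [lra|auto]]|].
    assert (Q : sqrt (x + d * d) * sqrt (x + d * d) = x + d * d) by (apply sqrt_sqrt; lra).
    set (q := sqrt (x + d * d)) in *. replace ((x + d * d) * q) with (q * q * q) by (rewrite Q; ring).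
    field. lra. }
  assert (C2 : forall x, 0 <= x -> continuity_pt Phi2 x).
  { intros x Hx. assert (0 < sqrt (x + d * d)) by (apply sqrt_lt_R0; lra).
    apply continuity_pt_opp, continuity_pt_inv.
    - apply continuity_pt_mult; [apply continuity_pt_const; intros a b; reflexivity|].
      apply continuity_pt_mult; eapply is_derive_continuity_pt; [auto_derive;
        [exact I|reflexivity]|apply D1, Hx].
    - assert (0 < (x + d * d) * sqrt (x + d * d)) by (apply Rmult_lt_0_compat; lra). lra. }
  assert (Dk : forall S w, fst w < S -> cderiv k w (cexp w)).
  { intros S w _. pose proof (cderiv_plus _ _ _ _ _ (cderiv_const (z - t)%C w) (cderiv_cexp w)) as H.
    replace (0 + cexp w)%C with (cexp w) in H by ring. exact H. }
  assert (Dc : forall S w, fst w < S -> cderiv cexp w (cexp w)) by (intros; apply cderiv_cexp).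
  assert (Cc : forall S w, fst w < S -> ccont cexp w) by (intros; eapply cderiv_ccont, cderiv_cexp).
  assert (Pk : forall s, k (s, 2 * PI) = k (s, 0)) by (intros s; unfold k; rewrite cexp_period; auto).
  exists (fun s => RInt (logpolar_slope k cexp Phi1 s) 0 (2 * PI)),
    (fun s => RInt (logpolar_density k cexp Phi1 Phi2 s) 0 (2 * PI)).
  intros s. set (S := s + 1). assert (Hs : s < S) by (unfold S; lra).
  assert (Ek : forall th, (z + RtoC (exp s) * cis th - t)%C = k (s, th)).
  { intros th. unfold k. rewrite cexp_cis. simpl. ring. }
  assert (Ec : forall th, nsq (cexp (s, th)) = exp s * exp s).
  { intros th. rewrite nsq_Cmod, Cmod_cexp. reflexivity. }
  pose proof (exp_pos s) as Ps.
  assert (EK : ex_RInt (fun th => soft_kernel d (z + RtoC (exp s) * cis th - t)%C) 0 (2 * PI)).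
  { apply (ex_RInt_ext (fun th => 2 * Phi1 (nsq (k (s, th))))).
    - intros th _. rewrite Ek. pose proof (sqrt_lt_R0 _ (soft_arg_pos d (k (s, th)) Hd)).
      change (2 * / (2 * sqrt (nsq (k (s, th)) + d * d)) = / sqrt (nsq (k (s, th)) + d * d)). field. lra.
    - apply (ex_RInt_scal (V := R_NormedModule)). 
      apply (ex_RInt_section (fun s th => Phi1 (nsq (k (s, th)))) s); [lra|].
      intros th _. apply (Phi1_x_continuous k cexp S Phi1 Phi2); auto. apply Dk. }
  split; [|split; [|split]].
  - apply (logpolar_mean k cexp cexp S Phi Phi1 Phi2); auto; [apply Dk|apply Dc|apply Cc|intros;
    apply cexp_period].
  - assert (EX := ex_RInt_logpolar_slope k cexp cexp S Phi1 Phi2 (Dk S) (Dc S) D2 s Hs).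
    assert (Bs : forall th, Rabs (logpolar_slope k cexp Phi1 s th) <= exp s).
    { intros th. unfold logpolar_slope, Phi1. set (K := k (s, th)). set (E := cexp (s, th)).
      assert (E2 : nsq E = exp s * exp s) by apply Ec.
      assert (Pq := sqrt_lt_R0 _ (soft_arg_pos d K Hd)). set (q := sqrt (nsq K + d * d)) in *.
      assert (Q : q * q = nsq K + d * d) by (apply sqrt_sqrt; left; apply soft_arg_pos, Hd).
      set (I := fst K * fst E + snd K * snd E).
      (* Cauchy-Schwarz for [I], the real inner product of [K] and [E]; [d * d] only helps. *)
      assert (I2 : I * I <= (q * exp s) * (q * exp s)).
      { replace (q * exp s * (q * exp s)) with ((q * q) * (exp s * exp s)) by ring. rewrite Q, <- E2.
        unfold I, nsq. clearbody K E. pose proof (Rle_0_sqr (fst K * snd E - snd K * fst E)) as CS.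
        unfold Rsqr in CS.
        pose proof (nsq_pos E) as NE. unfold nsq in NE.
        assert (0 <= d * d * (fst E * fst E + snd E * snd E)) by (apply Rmult_le_pos; lra). lra. }
      assert (IA : Rabs I <= q * exp s).
      { apply Rsqr_incr_0_var; [|apply Rmult_le_pos; lra].
        unfold Rsqr. rewrite <- Rabs_mult, Rabs_pos_eq by nra. exact I2. }
      change (Rabs (/ (2 * q) * (2 * I)) <= exp s).
      replace (/ (2 * q) * (2 * I)) with (I * / q) by (field; lra).
      rewrite Rabs_mult, (Rabs_pos_eq (/ q)) by (left; apply Rinv_0_lt_compat; auto).
      apply Rmult_le_reg_r with q; auto. rewrite Rmult_assoc, Rinv_l by lra. lra. }
    eapply Rle_trans; [apply (abs_RInt_le_const _ 0 (2 * PI) (exp s)); auto; lra|]. lra.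
  - exact EK.
  - assert (EX := ex_RInt_logpolar_density k cexp cexp S Phi1 Phi2 (Dk S) (Dc S) (Cc S) D2 C2 s Hs).
    unfold rmean. rewrite <- (RInt_scal (V := R_CompleteNormedModule)) by exact EK.
    apply RInt_le; [lra|apply (ex_RInt_scal (V := R_NormedModule)); exact EK|exact EX|].
    intros th _. unfold logpolar_density. rewrite Ek, Ec. 
    change (exp s * exp s * soft_kernel d (k (s, th)) <= 4 * (exp s * exp s) * (Phi1 (nsq (k (s,
      th))) + nsq (k (s, th)) * Phi2 (nsq (k (s, th))))).
    rewrite (Rmult_comm 4), (Rmult_assoc (exp s * exp s) 4).
    apply Rmult_le_compat_l; [apply Rmult_le_pos; lra|].
    unfold soft_kernel, Phi1, Phi2. set (K := k (s, th)).
    assert (Pq := sqrt_lt_R0 _ (soft_arg_pos d K Hd)). pose proof (soft_arg_pos d K Hd) as Pa.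
    pose proof (nsq_pos K) as Pn.
    set (x := nsq K) in *. set (q := sqrt (x + d * d)) in *.
    (* The planar Laplacian of [sqrt (x + d^2)]; the bracket is at least 1. *)
    replace (4 * (/ (2 * q) + x * - / (4 * ((x + d * d) * q)))) with (/ q * (2 - x / (x + d * d))) by (field;
      lra).
    rewrite <- (Rmult_1_r (/ q)) at 1. apply Rmult_le_compat_l; [left; apply Rinv_0_lt_compat; auto|].
    assert (x / (x + d * d) <= 1); [|lra].
    apply Rmult_le_reg_r with (x + d * d); auto. unfold Rdiv. rewrite Rmult_assoc, Rinv_l by lra. lra.
Qed.

Lemma logpolar_soft_sum z (t : nat -> C) (sg : nat -> R) d N : 0 < d -> (forall n, 0 <= sg n) ->
  exists V V' : R -> R, forall s,
  is_derive V s (V' s) /\ Rabs (V s) <= 2 * PI * exp s * fsum sg N /\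
  ex_RInt (fun th => fsum (fun n => sg n * soft_kernel d (z + RtoC (exp s) * cis th - t n)%C) N) 0 (2 * PI) /\
  exp s * exp s * rmean (fun w => fsum (fun n => sg n * soft_kernel d (w - t n)%C) N) z (exp s) <= V' s.
Proof.
  intros Hd Hsg. pose proof two_PI_pos as HP. induction N as [|N [V [V' IH]]].
  - exists (fun _ => 0), (fun _ => 0). intros s. simpl. split; [|split; [|split]].
    + apply is_derive_Rconst.
    + rewrite Rabs_R0. lra.
    + apply ex_RInt_const.
    + unfold rmean. rewrite RInt_const. change (scal (2 * PI - 0) 0) with ((2 * PI - 0) * 0). lra.
  - destruct (logpolar_soft z (t N) d Hd) as [W [W' HW]].
    exists (fun s => V s + sg N * W s), (fun s => V' s + (0 * W s + sg N * W' s)). intros s.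
    destruct (IH s) as [A1 [A2 [A3 A4]]]. destruct (HW s) as [B1 [B2 [B3 B4]]].
    specialize (Hsg N). split; [|split; [|split]].
    + apply is_derive_Rplus; auto. apply is_derive_Rmult; auto. apply is_derive_Rconst.
    + simpl. eapply Rle_trans; [apply Rabs_triang|]. rewrite Rabs_mult, (Rabs_pos_eq (sg N)) by auto.
      assert (sg N * Rabs (W s) <= sg N * (2 * PI * exp s)) by (apply Rmult_le_compat_l; auto). lra.
    + simpl. apply (ex_RInt_plus (V := R_NormedModule) _ (fun th => sg N * soft_kernel d
      (z + exp s * cis th - t N)%C) 0 (2 * PI) A3).
      apply (ex_RInt_scal (V := R_NormedModule)). exact B3.
    + assert (E : rmean (fun w => fsum (fun n => sg n * soft_kernel d (w - t n)%C) (S N)) z (exp s) =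
        rmean (fun w => fsum (fun n => sg n * soft_kernel d (w - t n)%C) N) z (exp s) +
        sg N * rmean (fun w => soft_kernel d (w - t N)%C) z (exp s)).
      { apply is_RInt_unique. apply (is_RInt_plus (V := R_NormedModule)).
        - apply (RInt_correct (V := R_CompleteNormedModule)), A3.
        - apply (is_RInt_scal (V := R_NormedModule)). apply (RInt_correct (V := R_CompleteNormedModule)), B3. }
      rewrite E. apply (Rmult_le_compat_l (sg N)) in B4; auto. lra.
Qed.

Lemma fsum_le f g N : (forall n, (n < N)%nat -> f n <= g n) -> fsum f N <= fsum g N.
Proof.
  induction N as [|N IH]; intros H; simpl; [lra|].
  specialize (IH ltac:(auto with arith)). specialize (H N ltac:(lia)). lra.
Qed.

Lemma fsum_pos f N : (forall n, (n < N)%nat -> 0 <= f n) -> 0 <= fsum f N.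
Proof.
  induction N as [|N IH]; intros H; simpl; [lra|].
  specialize (IH ltac:(auto with arith)). specialize (H N ltac:(lia)). lra.
Qed.

Lemma fsum_term f N m : (forall n, (n < N)%nat -> 0 <= f n) -> (m < N)%nat -> f m <= fsum f N.
Proof.
  induction N as [|N IH]; intros H Hm; simpl; [lia|].
  destruct (Nat.eq_dec m N) as [->|Ne].
  - pose proof (fsum_pos f N ltac:(auto with arith)). lra.
  - specialize (IH ltac:(auto with arith) ltac:(lia)). specialize (H N ltac:(lia)). lra.
Qed.

Lemma fsum_affine (b : nat -> R) c N : fsum (fun n => 2 * b n + c) N = 2 * fsum b N + INR N * c.
Proof. induction N as [|N IH]; [simpl; ring|]. rewrite S_INR. simpl fsum. rewrite IH. ring. Qed.

(* A radius on which a sum of poles has small mean: integrate the Laplacian of [sqrt (|w - t|^2 + d^2)],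
   which dominates the regularised pole, over the annulus and apply the mean value theorem. The parameter
   [d] is so small that near a pole the regularised pole already exceeds the bound [B]. *)
Lemma good_circle (t : nat -> C) (b : nat -> R) N z R P B C0 tau : 0 < R -> 0 < tau -> 0 <= C0 ->
  (forall n, 0 <= b n) ->
  (forall r, R <= r <= 3 * R -> ex_RInt (fun th => P (z + RtoC r * cis th)%C) 0 (2 * PI)) ->
  (forall w, Cmod (w - z) <= 3 * R -> 0 <= P w <= B) ->
  (forall w, Cmod (w - z) <= 3 * R -> (forall n, (n < N)%nat -> w <> t n) ->
     P w <= C0 + fsum (fun n => b n / Cmod (w - t n)) N) ->
  exists r, R <= r <= 3 * R /\ rmean P z r <= 2 * PI * (C0 + 8 * (fsum b N / R) + tau).
Proof.
  intros HR Ht HC0 Hb Hex HB HP. pose proof two_PI_pos as HPI.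
  assert (PB : 0 <= B).
  { destruct (HB z); [rewrite Cmod_sub_self; lra|lra]. }
  pose proof (pos_INR N) as PN.
  (* A small extra weight for each pole, so that even a pole with [b n = 0] can dominate [B] nearby.
     In [4 * W / R] the [N] extra weights cost at most [tau]. *)
  set (sg := tau * R / (4 * (INR N + 1))).
  assert (Psg : 0 < sg) by (apply Rdiv_lt_0_compat; nra).
  (* Within distance [d] of a pole the extra weight alone contributes at least
     [sg / (2 d) = B + 1]. *)
  set (d := sg / (2 * (B + 1))).
  assert (Pd : 0 < d) by (apply Rdiv_lt_0_compat; lra).
  (* The factor 2 makes up for replacing [1 / |w - t|] by the regularised pole at distance at least
     [d]. *)
  set (wt := fun n => 2 * b n + sg).
  assert (Pw : forall n, 0 <= wt n) by (intros n; specialize (Hb n); unfold wt; lra).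
  assert (Hpt : forall w,
    Cmod (w - z) <= 3 * R -> P w <= C0 + fsum (fun n => wt n * soft_kernel d (w - t n)%C) N).
  { intros w Hw. 
    assert (Pterm : forall n, (n < N)%nat -> 0 <= wt n * soft_kernel d (w - t n)%C).
    { intros n _. apply Rmult_le_pos; auto. left. apply soft_kernel_pos, Pd. }
    destruct (classic (exists m, (m < N)%nat /\ Cmod (w - t m) < d)) as [[m [Hm Hd]]|Far].
    - pose proof (fsum_term _ N m Pterm Hm) as T. 
      assert (K : B + 1 <= sg * soft_kernel d (w - t m)%C).
      { replace (B + 1) with (sg * / (2 * d)) by (unfold d; field; split; lra).
        apply Rmult_le_compat_l; [lra|]. unfold soft_kernel.
        apply Rinv_le_contravar; [apply sqrt_lt_R0, soft_arg_pos, Pd|].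
        rewrite <- (sqrt_square (2 * d)) by lra. apply sqrt_le_1_alt. rewrite nsq_Cmod.
        pose proof (Cmod_ge_0 (w - t m)). nra. }
      assert (K2 : sg * soft_kernel d (w - t m)%C <= wt m * soft_kernel d (w - t m)%C).
      { apply Rmult_le_compat_r; [left; apply soft_kernel_pos, Pd|]. specialize (Hb m). unfold wt. lra. }
      specialize (HB w Hw). simpl in T. lra.
    - assert (Far' : forall n, (n < N)%nat -> d <= Cmod (w - t n)).
      { intros n Hn. apply Rnot_lt_le. intros L. apply Far. exists n. auto. }
      eapply Rle_trans; [apply HP; auto|].
      + intros n Hn ->. specialize (Far' n Hn). rewrite Cmod_sub_self in Far'. lra.
      + apply Rplus_le_compat_l, fsum_le. intros n Hn. specialize (Far' n Hn).
        set (c := Cmod (w - t n)) in *.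
        assert (K : / (2 * c) <= soft_kernel d (w - t n)%C).
        { unfold soft_kernel. apply Rinv_le_contravar; [apply sqrt_lt_R0, soft_arg_pos, Pd|].
          rewrite <- (sqrt_square (2 * c)) by lra. apply sqrt_le_1_alt. rewrite nsq_Cmod. fold c. nra. }
        pose proof (soft_kernel_pos d (w - t n)%C Pd).
        replace (b n / c) with (2 * b n * / (2 * c)) by (field; lra). unfold wt. specialize (Hb n).
        assert (2 * b n * / (2 * c) <= 2 * b n * soft_kernel d (w - t n)%C) by (apply Rmult_le_compat_l;
        lra). nra. }
  destruct (logpolar_soft_sum z t wt d N Pd Pw) as [V [V' HV]].
  (* A unit step in the logarithm: the radius lies between [R] and [e R <= 3 R], and [|V|] at both
     ends adds up to at most [2 PI (3 R + R) W], the source of the constant 4. *)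
  destruct (mean_value V V' (ln R) (ln R + 1)) as [s [Hs E]]; [lra|intros; apply HV|].
  assert (Es : R <= exp s <= 3 * R).
  { rewrite <- (exp_ln R) at 1 by auto. split.
    - destruct (proj1 Hs) as [L|<-]; [left; apply exp_increasing; auto|lra].
    - apply Rle_trans with (exp (ln R + 1)).
      + destruct (proj2 Hs) as [L|<-]; [left; apply exp_increasing; auto|lra].
      + rewrite exp_plus, exp_ln by auto. pose proof exp_le_3. nra. }
  exists (exp s). split; auto.
  destruct (HV s) as [_ [_ [X3 X4]]].
  destruct (HV (ln R)) as [_ [Y1 _]]. destruct (HV (ln R + 1)) as [_ [Y2 _]].
  rewrite exp_plus, exp_ln in Y2 by auto. rewrite exp_ln in Y1 by auto.
  set (W := fsum wt N) in *. assert (PW : 0 <= W) by (apply fsum_pos; auto).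
  set (J := rmean (fun w => fsum (fun n => wt n * soft_kernel d (w - t n)%C) N) z (exp s)) in *.
  assert (PJ : 0 <= J).
  { apply RInt_ge_0; [lra|exact X3|]. intros th _. apply fsum_pos. intros n _. apply Rmult_le_pos; auto.
    left. apply soft_kernel_pos, Pd. }
  assert (BJ : J <= 2 * PI * (4 * W / R)).
  { apply Rmult_le_reg_l with (R * R); [nra|].
    replace (R * R * (2 * PI * (4 * W / R))) with (2 * PI * (R * 3) * W + 2 * PI * R * W) by (field; lra).
    apply Rle_trans with (exp s * exp s * J).
    - apply Rmult_le_compat_r; auto. apply Rmult_le_compat; lra.
    - replace (ln R + 1 - ln R) with 1 in E by ring. rewrite Rmult_1_r in E.
      apply Rabs_le_between in Y1. apply Rabs_le_between in Y2.
      assert (R * exp 1 <= R * 3) by (apply Rmult_le_compat_l; [lra|apply exp_le_3]).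
      assert (2 * PI * (R * exp 1) * W <= 2 * PI * (R * 3) * W).
      { apply Rmult_le_compat_r; auto. apply Rmult_le_compat_l; lra. }
      lra. }
  apply Rle_trans with (2 * PI * C0 + J).
  - assert (EJ : 2 * PI * C0 + J =
    RInt (fun th => C0 + fsum (fun n => wt n * soft_kernel d (z + exp s * cis th - t n)%C) N) 0 (2 * PI)).
    { symmetry. apply is_RInt_unique. apply (is_RInt_plus (V := R_NormedModule)).
      - replace (2 * PI * C0) with (scal (V := R_NormedModule) (2 * PI - 0) C0)
          by (change ((2 * PI - 0) * C0 = 2 * PI * C0); ring).
        apply (is_RInt_const (V := R_NormedModule)).
      - apply (RInt_correct (V := R_CompleteNormedModule)), X3. }
    rewrite EJ. apply RInt_le; [lra|apply Hex; auto|apply (ex_RInt_plus (V := R_NormedModule));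
    [apply ex_RInt_const|exact X3]|].
    intros th _. apply Hpt. rewrite Cmod_circle, Rabs_pos_eq; lra.
  - assert (EW : 4 * W / R <= 8 * (fsum b N / R) + tau).
    { unfold W, wt. rewrite fsum_affine. unfold sg.
      replace (4 * (2 * fsum b N + INR N * (tau * R / (4 * (INR N + 1)))) / R) with
        (8 * (fsum b N / R) + tau * (INR N / (INR N + 1))) by (field; lra).
      assert (INR N / (INR N + 1) <= 1).
      { apply Rmult_le_reg_r with (INR N + 1); [lra|]. unfold Rdiv. rewrite Rmult_assoc, Rinv_l by lra. lra. }
      nra. }
    nra.
Qed.

(** * Growth of a quotient *)

Lemma rcont_ln_nsq g e t : 0 < e -> rcont g t -> continuous (fun s => ln (nsq (g s) + e)) t.
Proof.
  intros He Hg. apply continuity_pt_filterlim.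
  apply (continuity_pt_comp (fun s => nsq (g s)) (fun x => ln (x + e))).
  - intros eps Heps. apply rcont_ccont in Hg.
    destruct (nsq_ccont _ _ Hg eps Heps) as [d [Hd K]]. exists d. split; auto.
    intros s [_ Hs]. apply (K (RtoC s)). rewrite <- RtoC_minus, Cmod_R. exact Hs.
  - pose proof (nsq_pos (g t)). apply (is_derive_continuity_pt _ _ (/ (nsq (g t) + e))).
    auto_derive; [lra|field; lra].
Qed.

Lemma rcont_Cmod g t : rcont g t -> continuous (fun s => Cmod (g s)) t.
Proof.
  intros Hg. apply continuity_pt_filterlim. intros eps He.
  destruct (Hg eps He) as [d [Hd K]]. exists d. split; auto.
  intros s [_ Hs]. apply Rle_lt_trans with (Cmod (g s - g t)); [|apply K; auto].
  simpl. unfold Rdist. apply Rabs_le.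
  pose proof (Cmod_triangle_inv (g s) (g t)). pose proof (Cmod_triangle_inv (g t) (g s)) as H1.
  rewrite Cmod_sub_sym in H1. lra.
Qed.

Lemma ex_RInt_circle (h : R -> R) : (forall t, continuous h t) -> ex_RInt h 0 (2 * PI).
Proof. intros H. apply (ex_RInt_continuous (V := R_CompleteNormedModule)). intros t _. apply H. Qed.

Lemma RInt_Rplus (f g : R -> R) a b : ex_RInt f a b -> ex_RInt g a b ->
  RInt (fun t => f t + g t) a b = RInt f a b + RInt g a b.
Proof. intros Hf Hg. apply (RInt_plus (V := R_CompleteNormedModule) f g a b Hf Hg). Qed.

Lemma RInt_circle_const c : RInt (fun _ => c) 0 (2 * PI) = 2 * PI * c.
Proof. rewrite RInt_const. change ((2 * PI - 0) * c = 2 * PI * c). ring. Qed.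

Lemma rcont_entire_circle f z c t : entire f -> rcont (fun t => f (z + c * cis t)%C) t.
Proof.
  intros Hf. apply (rcont_comp f (fun t => (z + c * cis t)%C)); [|apply entire_ccont; auto].
  apply (rcont_comp (fun w => (z + c * w)%C) cis).
  - eapply rderiv_rcont, rderiv_cis.
  - apply ccont_plus; [apply ccont_const|]. apply ccont_mult; [apply ccont_const|apply ccont_id].
Qed.

Lemma ex_RInt_ln_circle f z c e : 0 < e -> entire f ->
  ex_RInt (fun t => ln (nsq (f (z + c * cis t)%C) + e)) 0 (2 * PI).
Proof.
  intros He Hf. apply ex_RInt_circle. intros t.
  apply (rcont_ln_nsq (fun t => f (z + c * cis t)%C)); auto. apply rcont_entire_circle; auto.
Qed.

(** * A Harnack inequality through a disc automorphism *)

Lemma cis_plus a b : cis (a + b) = (cis a * cis b)%C.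
Proof. unfold cis, Cmult; simpl. rewrite cos_plus, sin_plus. f_equal; ring. Qed.

(** The action on angles of the disc automorphism [(2 w + 1) / (w + 2)]. For [|w| = 1] the numerator
    is [w] times the conjugate of [w + 2], so the argument of the image is that of [w] minus twice
    that of [w + 2]. *)
Definition mobius_angle (t : R) : R := t - 2 * atan (sin t / (2 + cos t)).

Lemma two_cos_pos t : 0 < 2 + cos t.
Proof. pose proof (COS_bound t). lra. Qed.

Lemma mobius_cis t : ((2 * cis t + 1) * / (cis t + 2))%C = cis (mobius_angle t).
Proof.
  pose proof (two_cos_pos t) as P. set (x := sin t / (2 + cos t)).
  set (S := sqrt (1 + Rsqr x)). set (b := atan x).
  assert (Sp : 0 < S) by (apply sqrt_lt_R0; pose proof (Rle_0_sqr x); lra).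
  assert (Cb : cos b = 1 / S) by apply cos_atan.
  assert (Sb : sin b = x / S) by apply sin_atan.
  assert (Ex : (2 + cos t) * x = sin t) by (unfold x; field; lra).
  assert (N : (cis t + 2)%C <> 0%C).
  { intros E. apply (f_equal fst) in E. simpl in E. lra. }
  assert (Q : (cis t + 2)%C = (RtoC ((2 + cos t) * S) * cis b)%C).
  { unfold cis, Cplus, Cmult, RtoC; simpl. rewrite Cb, Sb, <- Ex. f_equal; field; lra. }
  assert (Q' : ((2 + cos t, - sin t)%R : C) = (RtoC ((2 + cos t) * S) * cis (- b))%C).
  { unfold cis, Cplus, Cmult, RtoC; simpl. rewrite cos_neg, sin_neg, Cb, Sb, <- Ex. f_equal; field; lra. }
  assert (E0 : (cis (- b) * cis b)%C = 1%C).
  { rewrite <- cis_plus, Rplus_opp_l. unfold cis. rewrite cos_0, sin_0. reflexivity. }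
  assert (E1 : cis (mobius_angle t) = (cis t * cis (- b) * cis (- b))%C).
  { rewrite <- !cis_plus. f_equal. unfold mobius_angle. fold x b. ring. }
  assert (E2 : (2 * cis t + 1)%C = (cis t * ((2 + cos t, - sin t)%R : C))%C).
  { pose proof (sin2_cos2 t) as SC. unfold Rsqr in SC.
    unfold cis, Cplus, Cmult, RtoC; simpl. f_equal; lra. }
  rewrite E2, Q', E1.
  replace (cis t * (((2 + cos t) * S)%R * cis (- b)))%C with (cis t * cis (- b) * cis (- b) * (cis t + 2))%C.
  - field. exact N.
  - rewrite Q. replace (cis t * cis (- b) * cis (- b) * (((2 + cos t) * S)%R * cis b))%C
      with (cis t * (((2 + cos t) * S)%R * cis (- b)) * (cis (- b) * cis b))%C by ring.
    rewrite E0. ring.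
Qed.

Lemma mobius_angle_derive t : is_derive mobius_angle t (3 / (5 + 4 * cos t)).
Proof.
  pose proof (two_cos_pos t) as P. pose proof (COS_bound t). unfold mobius_angle.
  pose proof (sin2_cos2 t) as SC. unfold Rsqr in SC.
  auto_derive; [lra|].
  assert (E : 1 + (sin t * / (2 + cos t)) ^ 2 = (5 + 4 * cos t) / (2 + cos t) ^ 2).
  { apply Rmult_eq_reg_r with ((2 + cos t) ^ 2); [|nra]. field_simplify; [|lra|lra]. lra. }
  unfold Rdiv in *. 
  match goal with |- context [/ (1 + ?y)] => replace (1 + y) with ((5 + 4 * cos t) * / (2 + cos t) ^ 2) end.
  field_simplify; [|lra|split; lra]. f_equal. nra.
Qed.

(** The automorphism sends 0 to 1/2, so the mean inequality at the centre for the composite becomes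
    one at half radius. The change of angle has density [3 / (5 + 4 cos t) >= 1/3], a Poisson
    kernel, which gives the factor 3; the pole at -2 leaves the composite holomorphic on the disc of
    radius 2. *)
Lemma harnack H z0 b : entire H ->
  2 * PI * ln (nsq (H (z0 + b * (1 / 2))%C) + 1) <=
    3 * RInt (fun t => ln (nsq (H (z0 + b * cis t)%C) + 1)) 0 (2 * PI).
Proof.
  intros HH. pose proof two_PI_pos as HP.
  set (K := fun w => H (z0 + b * ((2 * w + 1) * / (w + 2)))%C).
  assert (HK : holo K 0%C 2).
  { intros w Hw. replace (w - 0)%C with w in Hw by ring.
    assert (N : (w + 2)%C <> 0%C).
    { intros E. assert (E' : w = (- RtoC 2)%C) by (replace w with (w + 2 - 2)%C by ring; rewrite E; ring).
      rewrite E', Cmod_opp, Cmod_R, Rabs_pos_eq in Hw; lra. }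
    destruct (proj1 (entire_cderiv H) HH (z0 + b * ((2 * w + 1) * / (w + 2)))%C) as [l Hl].
    eexists. apply (cderiv_comp H (fun w => (z0 + b * ((2 * w + 1) * / (w + 2)))%C)); [|exact Hl].
    apply cderiv_plus; [apply cderiv_const|]. apply cderiv_scal. apply cderiv_mult.
    - apply cderiv_plus; [apply cderiv_scal, cderiv_id|apply cderiv_const].
    - apply (cderiv_inv (fun w => (w + 2)%C)); auto. apply cderiv_plus; [apply cderiv_id|apply cderiv_const]. }
  pose proof (submean_ln 1 K 0%C 2 1 ltac:(lra) HK ltac:(lra)) as SM.
  replace (K 0%C) with (H (z0 + b * (1 / 2))%C) in SM.
  2:{ unfold K. f_equal. f_equal. f_equal. field. }
  eapply Rle_trans; [exact SM|]. unfold rmean.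
  set (g := fun a => ln (nsq (H (z0 + b * cis a)%C) + 1)).
  assert (Cg : forall a, continuous g a).
  { intros a. apply (rcont_ln_nsq (fun a => H (z0 + b * cis a)%C)); [lra|]. apply rcont_entire_circle; auto. }
  assert (Pg : forall a, 0 <= g a).
  { intros a. unfold g. rewrite <- ln_1. pose proof (nsq_pos (H (z0 + b * cis a)%C)). apply ln_le; lra. }
  set (dg := fun t => 3 / (5 + 4 * cos t)).
  assert (Pc : forall t, 1 <= 5 + 4 * cos t <= 9) by (intros t; pose proof (COS_bound t); lra).
  assert (Cdg : forall t, continuous dg t).
  { intros t. apply (ex_derive_continuous (V := R_NormedModule)). unfold dg. auto_derive.
    specialize (Pc t). lra. }
  assert (I1 : is_RInt (fun t => scal (dg t) (g (mobius_angle t))) 0 (2 * PI) (RInt g 0 (2 * PI))).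
  { replace (RInt g 0 (2 * PI)) with (RInt g (mobius_angle 0) (mobius_angle (2 * PI))).
    - apply (is_RInt_comp (V := R_CompleteNormedModule) g mobius_angle dg); [intros; apply Cg|].
      intros t _. split; [apply mobius_angle_derive|apply Cdg].
    - f_equal; unfold mobius_angle; rewrite ?sin_0, ?sin_2PI; unfold Rdiv; rewrite Rmult_0_l, atan_0; ring. }
  assert (I2 : is_RInt (fun t => scal 3 (scal (dg t) (g (mobius_angle t)))) 0 (2 * PI) (3 * RInt g 0 (2 * PI))).
  { apply (is_RInt_scal (V := R_NormedModule)), I1. }
  change (RInt (fun t => ln (nsq (H (z0 + b * cis t)%C) + 1)) 0 (2 * PI)) with (RInt g 0 (2 * PI)).
  rewrite <- (is_RInt_unique _ _ _ _ I2). apply RInt_le; [lra| |exists (3 * RInt g 0 (2 * PI)); exact I2|].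
  - apply (ex_RInt_ext (fun t => g (mobius_angle t))).
    + intros t _. unfold g, K. rewrite <- mobius_cis. replace (0 + 1 * cis t)%C with (cis t) by ring.
      reflexivity.
    + apply ex_RInt_circle. intros t. apply (continuous_comp mobius_angle g); [|apply Cg].
      apply (ex_derive_continuous (V := R_NormedModule)). eexists. apply mobius_angle_derive.
  - intros t _. change (ln (nsq (K (0 + 1 * cis t)%C) + 1) <= 3 * (dg t * g (mobius_angle t))).
    replace (ln (nsq (K (0 + 1 * cis t)%C) + 1)) with (g (mobius_angle t)).
    + specialize (Pg (mobius_angle t)). specialize (Pc t).
      assert (1 / 3 <= dg t); [|nra]. unfold dg.
      apply Rmult_le_reg_r with (5 + 4 * cos t); [lra|]. unfold Rdiv. rewrite (Rmult_assoc 3), Rinv_l by lra.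
      lra.
    + unfold g, K. rewrite <- mobius_cis. replace (0 + 1 * cis t)%C with (cis t) by ring. reflexivity.
Qed.

(** Finite order with an integer exponent and a bound at every point, whereas [finite_order] has a
    real exponent and concerns large [Cmod z] only. *)
Definition log_poly_growth (f : C -> C) : Prop :=
  exists (c : R) (k : nat), 0 <= c /\ forall z, Cmod (f z) <= exp (c * (1 + Cmod z) ^ k).

Lemma pow_1_Cmod z k : 1 <= (1 + Cmod z) ^ k.
Proof. apply pow_R1_Rle. pose proof (Cmod_ge_0 z). lra. Qed.

Lemma finite_order_growth f : finite_order f -> log_poly_growth f.
Proof.
  intros [Hf [rho [R0 [Hrho [HR0 HB]]]]].
  destruct (nfloor_ex rho) as [n Hn]; [lra|].
  set (k := S n). assert (Hk : rho <= INR k) by (unfold k; rewrite S_INR; lra).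
  set (c := 2 + Rpower (2 * R0) rho). assert (Pp : 0 < Rpower (2 * R0) rho) by apply exp_pos.
  exists c, k. split; [unfold c; lra|]. intros z. pose proof (pow_1_Cmod z k) as P1.
  pose proof (Cmod_ge_0 z) as Pz.
  destruct (Rle_dec R0 (Cmod z)) as [L|L].
  - eapply Rle_trans; [apply HB, L|].
    assert (Q : Rpower (Cmod z) rho <= (1 + Cmod z) ^ k).
    { apply Rle_trans with (Rpower (1 + Cmod z) rho).
      - apply Rle_Rpower_l; lra.
      - rewrite <- Rpower_pow by lra. apply Rle_Rpower; lra. }
    assert (Q2 : Rpower (Cmod z) rho <= c * (1 + Cmod z) ^ k) by (unfold c; nra).
    destruct Q2 as [Q2|Q2]; [left; apply exp_increasing; auto|rewrite Q2; lra].
  (* Inside [R0] the order bound is silent; the bound on the circle of radius [2 * R0] is pulled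
     inwards, and its factor 2 is absorbed by [exp 1]. *)
  - assert (B : Cmod (f z) <= 2 * exp (Rpower (2 * R0) rho)).
    { apply (holo_bound f 0%C (3 * R0) (2 * R0)).
      - apply entire_holo; auto.
      - lra.
      - replace (z - 0)%C with z by ring. lra.
      - intros u Hu. replace (u - 0)%C with u in Hu by ring. rewrite <- Hu. apply HB. lra. }
    eapply Rle_trans; [exact B|].
    apply Rle_trans with (exp 1 * exp (Rpower (2 * R0) rho)).
    + apply Rmult_le_compat_r; [left; apply exp_pos|]. pose proof (exp_ineq1 1). lra.
    + rewrite <- exp_plus. assert (Q : 1 + Rpower (2 * R0) rho <= c * (1 + Cmod z) ^ k) by (unfold c in *; nra).
      destruct Q as [Q|Q]; [left; apply exp_increasing; auto|rewrite Q; lra].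
Qed.

Lemma pow_affine_Cmod z a k : 0 <= a -> (1 + a * (1 + Cmod z)) ^ k <= (1 + a) ^ k * (1 + Cmod z) ^ k.
Proof.
  intros Ha. rewrite <- Rpow_mult_distr. pose proof (Cmod_ge_0 z). apply pow_incr. split; nra.
Qed.

Lemma quotient_growth F G H z0 : entire F -> entire G -> entire H -> G z0 <> 0%C ->
  (forall z, F z = (H z * G z)%C) -> log_poly_growth F -> log_poly_growth G ->
  exists c k, 0 <= c /\ forall z, ln (nsq (H z) + 1) <= c * (1 + Cmod z) ^ k.
Proof.
  intros HF HG HH Gz E [cF [kF [PF BF]]] [cG [kG [PG BG]]]. pose proof two_PI_pos as HP.
  (* [a] is such that the circle about [z0] through twice the displacement to [z] stays in
     [|w| <= a (1 + |z|)]. *)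
  set (k := max kF kG). set (c := cF + cG). set (a := Cmod z0 + 2 + 2 * Cmod z0).
  pose proof (Cmod_ge_0 z0) as P0.
  assert (Mono : forall w j, (j <= k)%nat -> (1 + Cmod w) ^ j <= (1 + Cmod w) ^ k).
  { intros w j Hj. apply Rle_pow; auto. pose proof (Cmod_ge_0 w). lra. }
  assert (BF' : forall w, Cmod (F w) <= exp (c * (1 + Cmod w) ^ k)).
  { intros w. eapply Rle_trans; [apply BF|]. apply exp_le. unfold c.
    pose proof (Mono w kF ltac:(unfold k; lia)). pose proof (pow_1_Cmod w k). nra. }
  assert (BG' : forall w, Cmod (G w) <= exp (c * (1 + Cmod w) ^ k)).
  { intros w. eapply Rle_trans; [apply BG|]. apply exp_le. unfold c.
    pose proof (Mono w kG ltac:(unfold k; lia)). pose proof (pow_1_Cmod w k). nra. }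
  set (l := Rabs (ln (nsq (G z0)))). assert (Pl : 0 <= l) by apply Rabs_pos.
  assert (PGz : 0 < nsq (G z0)).
  { rewrite nsq_Cmod. assert (0 < Cmod (G z0)) by (apply Cmod_gt_0; auto). nra. }
  exists (3 * (ln 4 + 2 * (c * (1 + a) ^ k) + l)), k.
  assert (L4 : 0 <= ln 4) by (rewrite <- ln_1; apply ln_le; lra).
  assert (Pc : 0 <= c) by (unfold c; lra).
  assert (Pa : 0 <= a) by (unfold a; lra).
  assert (Pak : 1 <= (1 + a) ^ k) by (apply pow_R1_Rle; lra).
  split; [nra|]. intros z. pose proof (Cmod_ge_0 z) as Pz.
  (* Puts [z] at half the radius, where [harnack] applies. *)
  set (b := (2 * (z - z0))%C).
  pose proof (harnack H z0 b HH) as Hk.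
  replace (z0 + b * (1 / 2))%C with z in Hk by (unfold b; field).
  set (Y := c * (1 + a * (1 + Cmod z)) ^ k).
  assert (PY : 0 <= Y).
  { apply Rmult_le_pos; auto. apply pow_le. nra. }
  assert (Circ : forall t, Cmod (z0 + b * cis t) <= a * (1 + Cmod z)).
  { intros t. eapply Rle_trans; [apply Cmod_triangle|]. unfold b.
    rewrite !Cmod_mult, Cmod_cis, Cmod_R, Rabs_pos_eq by lra.
    pose proof (Cmod_triangle_sub z z0). unfold a. nra. }
  assert (Bc : forall f, (forall w, Cmod (f w) <= exp (c * (1 + Cmod w) ^ k)) -> forall t,
    nsq (f (z0 + b * cis t)%C) <= exp Y * exp Y).
  { intros f Hf t. rewrite nsq_Cmod. assert (Cmod (f (z0 + b * cis t)%C) <= exp Y).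
    { eapply Rle_trans; [apply Hf|]. apply exp_le. apply Rmult_le_compat_l; auto. apply pow_incr.
      pose proof (Cmod_ge_0 (z0 + b * cis t)). specialize (Circ t). lra. }
    apply Rmult_le_compat; auto; apply Cmod_ge_0. }
  destruct (rcont_bounded (fun t => H (z0 + b * cis t)%C) 0 (2 * PI)) as [M [PM HM]]; [lra|intros;
    apply rcont_entire_circle; auto|].
  (* On this circle [e (1 + |H|^2) <= 1], so [(|H|^2 + 1) (|G|^2 + e)] is a sum of three terms at
     most [exp (2 Y)]; hence [ln 4]. Although [M] and [e] depend on [z], [e] disappears from the
     lower bound at [z0] below, and the final constants do not involve it. *)
  set (e := / (1 + M * M)). assert (Pe : 0 < e) by (apply Rinv_0_lt_compat; nra).
  assert (Ee : e * (1 + M * M) = 1) by (apply Rinv_l; nra).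
  assert (HJ : RInt (fun t => ln (nsq (H (z0 + b * cis t)%C) + 1)) 0 (2 * PI) + RInt (fun t => ln (nsq (G
    (z0 + b * cis t)%C) + e)) 0 (2 * PI) <= 2 * PI * (ln 4 + 2 * Y)).
  { rewrite <- (RInt_Rplus (fun t => ln (nsq (H (z0 + b * cis t)%C) + 1)) (fun t => ln (nsq (G
    (z0 + b * cis t)%C) + e))) by (apply ex_RInt_ln_circle; auto; lra).
    rewrite <- RInt_circle_const.
    apply RInt_le; [lra| |apply ex_RInt_const|].
    - apply (ex_RInt_plus (V := R_NormedModule) (fun t => ln (nsq (H (z0 + b * cis t)%C) + 1)) (fun t => ln
      (nsq (G (z0 + b * cis t)%C) + e)));
        apply ex_RInt_ln_circle; auto; lra.
    - intros t Ht. set (w := (z0 + b * cis t)%C).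
      change (ln (nsq (H w) + 1) + ln (nsq (G w) + e) <= ln 4 + 2 * Y).
      pose proof (nsq_pos (H w)) as NH. pose proof (nsq_pos (G w)) as NG.
      assert (NM : nsq (H w) <= M * M).
      { rewrite nsq_Cmod. specialize (HM t ltac:(lra)). fold w in HM.
        apply Rmult_le_compat; auto; apply Cmod_ge_0. }
      assert (NF : nsq (F w) = nsq (H w) * nsq (G w)) by (rewrite E, !nsq_Cmod, Cmod_mult; ring).
      rewrite <- ln_mult by lra.
      replace (2 * Y) with (ln (exp Y * exp Y)) by (rewrite <- exp_plus, ln_exp; ring).
      rewrite <- ln_mult; [|lra|apply Rmult_lt_0_compat; apply exp_pos].
      apply ln_le; [apply Rmult_lt_0_compat; lra|].
      pose proof (Bc F BF' t) as X1. pose proof (Bc G BG' t) as X2. fold w in X1, X2.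
      assert (X3 : 1 <= exp Y) by (rewrite <- exp_0; apply exp_le; lra).
      assert (X4 : e * nsq (H w) <= e * (M * M)) by (apply Rmult_le_compat_l; lra). nra. }
  assert (HG0 : 2 * PI * ln (nsq (G z0)) <= RInt (fun t => ln (nsq (G (z0 + b * cis t)%C) + e)) 0 (2 * PI)).
  { destruct (Req_dec (Cmod b) 0) as [Zb|Zb].
    - rewrite <- RInt_circle_const.
      apply RInt_le; [lra|apply ex_RInt_const|apply ex_RInt_ln_circle; auto|].
      intros t _. rewrite (Cmod_eq_0 b Zb). replace (z0 + 0 * cis t)%C with z0 by ring. apply ln_le; lra.
    - set (G1 := fun w => G (z0 + b * w)%C).
      assert (H1 : holo G1 0%C 2).
      { intros w _. destruct (proj1 (entire_cderiv G) HG (z0 + b * w)%C) as [m Hm]. eexists.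
        apply (cderiv_comp G (fun w => (z0 + b * w)%C)); [|exact Hm].
        apply cderiv_plus; [apply cderiv_const|apply cderiv_scal, cderiv_id]. }
      pose proof (submean_ln e G1 0%C 2 1 Pe H1 ltac:(lra)) as SM. unfold G1 in SM.
      replace (z0 + b * 0)%C with z0 in SM by ring.
      apply Rle_trans with (2 * PI * ln (nsq (G z0) + e)); [apply Rmult_le_compat_l; [lra|]; apply ln_le; lra|].
      eapply Rle_trans; [exact SM|]. right. apply RInt_ext. intros t _.
      replace (z0 + b * (0 + 1 * cis t))%C with (z0 + b * cis t)%C by ring. reflexivity. }
  assert (Fin : ln (nsq (H z) + 1) <= 3 * (ln 4 + 2 * Y - ln (nsq (G z0)))).
  { apply Rmult_le_reg_l with (2 * PI); auto. lra. }
  eapply Rle_trans; [exact Fin|].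
  assert (QY : Y <= c * (1 + a) ^ k * (1 + Cmod z) ^ k).
  { unfold Y. rewrite Rmult_assoc. apply Rmult_le_compat_l; auto. apply pow_affine_Cmod; auto. }
  pose proof (Rle_abs (- ln (nsq (G z0)))) as AL. rewrite Rabs_Ropp in AL. fold l in AL.
  pose proof (pow_1_Cmod z k). nra.
Qed.

(** * Cauchy transforms *)

Lemma fsum_sum_n f N : fsum f (S N) = sum_n f N.
Proof.
  induction N as [|N IH].
  - rewrite sum_O. simpl. ring.
  - rewrite sum_Sn, <- IH. reflexivity.
Qed.

Lemma fsum_mono f N M : (forall n, 0 <= f n) -> (N <= M)%nat -> fsum f N <= fsum f M.
Proof. intros Hf H. induction H; simpl; [lra|]. specialize (Hf m). lra. Qed.

Lemma fsum_plus f g N : fsum (fun n => f n + g n) N = fsum f N + fsum g N.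
Proof. induction N as [|N IH]; simpl; [ring|rewrite IH; ring]. Qed.

Lemma fsum_scal c f N : fsum (fun n => c * f n) N = c * fsum f N.
Proof. induction N as [|N IH]; simpl; [ring|rewrite IH; ring]. Qed.

Lemma fsum_ext f g N : (forall n, (n < N)%nat -> f n = g n) -> fsum f N = fsum g N.
Proof.
  induction N as [|N IH]; intros H; simpl; auto. rewrite IH, H; auto.
Qed.

Lemma fsum_trunc f N M : (N <= M)%nat ->
  fsum (fun n => if (n <? N)%nat then f n else 0) M = fsum f N.
Proof.
  intros H. induction H as [|M H IH].
  - apply fsum_ext. intros n Hn. apply Nat.ltb_lt in Hn. rewrite Hn. reflexivity.
  - simpl. rewrite IH. replace (M <? N)%nat with false; [ring|]. symmetry. apply Nat.ltb_ge. exact H.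
Qed.

Lemma fsum_tail_cut f N M : (N <= M)%nat ->
  fsum f M = fsum f N + fsum (fun n => if (n <? N)%nat then 0 else f n) M.
Proof.
  intros H. rewrite <- (fsum_trunc f N M H), <- fsum_plus. apply fsum_ext. intros n _.
  destruct (n <? N)%nat; ring.
Qed.

(** Tails are expressed as finite sums of a truncated sequence, so that everything later remains an
    [fsum]. *)
Lemma series_tail (e : nat -> R) eta : (forall n, 0 <= e n) -> ex_series e -> 0 < eta ->
  exists N, forall M, fsum (fun n => if (n <? N)%nat then 0 else e n) M <= eta.
Proof.
  intros He [l Hl] Heta.
  assert (LS : is_lim_seq (sum_n e) l) by exact Hl.
  assert (Up : forall n, sum_n e n <= l).
  { intros n. apply is_lim_seq_incr_compare; auto. intros m. rewrite sum_Sn.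
    change (sum_n e m <= sum_n e m + e (S m)). specialize (He (S m)). lra. }
  apply is_lim_seq_spec in LS. destruct (LS (mkposreal eta Heta)) as [N HN].
  exists (S N). intros M.
  apply Rle_trans with (fsum (fun n => if (n <? S N)%nat then 0 else e n) (max M (S N))).
  - apply fsum_mono; [|lia]. intros n. destruct (n <? S N)%nat; [lra|auto].
  - pose proof (fsum_tail_cut e (S N) (max M (S N)) ltac:(lia)) as E.
    specialize (HN N (le_n N)). rewrite <- fsum_sum_n in HN. simpl pos in HN. apply Rabs_def2 in HN.
    assert (fsum e (max M (S N)) <= l).
    { destruct (max M (S N)) as [|m] eqn:Em; [lia|]. rewrite fsum_sum_n. auto. }
    lra.
Qed.

(** The threshold [R1] depends on [t], [b] and [eps] alone, not on [P], [B], [C0] or [L]; the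
    iteration relies on this uniformity. The variable [X] ranges over bounds of the partial sums, so
    convergence of the sum of poles at [w] is never at issue. *)
Lemma transform_circle (t : nat -> C) (b : nat -> R) eps :
  is_lim_seq (fun n => Cmod (t n)) p_infty -> (forall n, 0 <= b n) ->
  ex_series (fun n => b n / (Cmod (t n) + 1)) -> 0 < eps ->
  exists R1, 1 <= R1 /\ forall R z P B C0 L, R1 <= R -> Cmod z <= R -> 0 <= C0 -> 0 <= L ->
    (forall r, R <= r <= 3 * R -> ex_RInt (fun th => P (z + RtoC r * cis th)%C) 0 (2 * PI)) ->
    (forall w, Cmod (w - z) <= 3 * R -> 0 <= P w <= B) ->
    (forall w X, Cmod (w - z) <= 3 * R -> ~ in_range t w ->
       (forall m, fsum (fun n => b n / Cmod (w - t n)) m <= X) -> P w <= C0 + L * X) ->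
    exists r, R <= r <= 3 * R /\ rmean P z r <= 2 * PI * (C0 + (L + 1) * eps).
Proof.
  intros Hinf Hb Hser Heps.
  set (e := fun n => b n / (Cmod (t n) + 1)) in *.
  assert (Pt : forall n, 0 <= Cmod (t n)) by (intros; apply Cmod_ge_0).
  assert (He : forall n, 0 <= e n).
  { intros n. specialize (Pt n). apply Rmult_le_pos; auto. left. apply Rinv_0_lt_compat. lra. }
  assert (Eb : forall n, b n = e n * (Cmod (t n) + 1)).
  { intros n. specialize (Pt n). unfold e. field. lra. }
  (* The tail enters with coefficient 2 from far poles and [8 * 10] from near ones:
     [82 * eta = eps / 2]. *)
  set (eta := eps / 164). assert (Peta : 0 < eta) by (unfold eta; lra).
  destruct (series_tail e eta He Hser Peta) as [N0 HN0].
  set (B0 := fsum b N0). assert (PB0 : 0 <= B0) by (apply fsum_pos; auto).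
  (* Makes [8 * (B0 / R)] at most [eps / 2], the other half of the budget. *)
  exists (1 + 16 * B0 / eps). 
  assert (Q0 : 0 <= 16 * B0 / eps) by (apply Rmult_le_pos; [lra|left; apply Rinv_0_lt_compat; auto]).
  split; [lra|]. intros R z P B C0 L HR Hz HC0 HL Hex HB HP.
  set (g := fun n => if (n <? N0)%nat then 0 else e n) in *.
  assert (Pg : forall n, 0 <= g n) by (intros n; unfold g; destruct (n <? N0)%nat; [lra|auto]).
  set (Q := 4 * R). assert (PQ : 0 < Q) by (unfold Q; lra).
  apply is_lim_seq_spec in Hinf. destruct (Hinf (2 * Q + 1)) as [N1 HN1].
  set (N := max N0 N1).
  (* The first [N0] poles keep their weights; beyond [N0], a pole with [|t n| <= 2 Q + 1] has
     [b n <= (2 Q + 2) * e n]. Far poles of index below [N] get the same weight, a harmless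
     overestimate. *)
  set (be := fun n => if (n <? N0)%nat then b n else (2 * Q + 2) * e n).
  assert (Pbe : forall n, 0 <= be n).
  { intros n. unfold be. destruct (n <? N0)%nat; auto. apply Rmult_le_pos; auto. unfold Q. lra. }
  assert (Hw : forall w, Cmod (w - z) <= 3 * R -> Cmod w <= Q).
  { intros w Hw. pose proof (Cmod_triangle (w - z) z) as T. replace (w - z + z)%C with w in T by ring.
    unfold Q. lra. }
  destruct (good_circle t (fun n => L * be n) N z R P B (C0 + L * (2 * eta)) eps) as [r [Hr HI]]; auto; try lra.
  - assert (0 <= L * (2 * eta)) by (apply Rmult_le_pos; lra). lra.
  - intros n. apply Rmult_le_pos; auto.
  - intros w Hwz Hne. specialize (Hw w Hwz).
    assert (Hne' : forall n, w <> t n).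
    { intros n E. destruct (Nat.lt_ge_cases n N) as [H|H]; [apply (Hne n H E)|].
      specialize (HN1 n ltac:(unfold N in H; lia)). rewrite <- E in HN1. lra. }
    set (X := 2 * eta + fsum (fun n => be n / Cmod (w - t n)) N).
    apply Rle_trans with (C0 + L * X).
    + apply HP; auto.
      { intros [n E]. apply (Hne' n E). }
      intros m. set (M := max m N).
      assert (Pd : forall n, 0 < Cmod (w - t n)) by (intros n; apply Cmod_pos_sub; auto).
      apply Rle_trans with (fsum (fun n => b n / Cmod (w - t n)) M).
      { apply fsum_mono; [|unfold M; lia]. intros n. apply Rmult_le_pos; auto. left.
        apply Rinv_0_lt_compat; auto. }
      apply Rle_trans with (fsum (fun n => 2 * g n + (if (n <? N)%nat then be n / Cmod (w - t n) else 0)) M).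
      * apply fsum_le. intros n _. specialize (Pd n).
        assert (Pi : 0 < / Cmod (w - t n)) by (apply Rinv_0_lt_compat; auto).
        unfold g, be. destruct (n <? N0)%nat eqn:C1.
        { apply Nat.ltb_lt in C1.
          replace (n <? N)%nat with true by (symmetry; apply Nat.ltb_lt; unfold N; lia). lra. }
        (* For [|w| <= Q] and [|t n| >= 2 Q + 1] the distance is at least [(|t n| + 1) / 2], so the
           term is at most [2 * e n]. *)
        destruct (Rle_dec (2 * Q + 1) (Cmod (t n))) as [Far|Near].
        { pose proof (Cmod_triangle_inv (t n) w) as T. rewrite Cmod_sub_sym in T.
          assert (b n / Cmod (w - t n) <= 2 * e n).
          { apply Rmult_le_reg_r with (Cmod (w - t n)); auto. unfold Rdiv.
            rewrite Rmult_assoc, Rinv_l, Rmult_1_r, Eb by lra.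
            specialize (He n). nra. }
          destruct (n <? N)%nat; [|lra].
          assert (0 <= (2 * Q + 2) * e n / Cmod (w - t n)); [|lra].
          apply Rmult_le_pos; [|lra]. apply Rmult_le_pos; auto. unfold Q; lra. }
        { assert (LN : (n < N)%nat).
          { destruct (Nat.lt_ge_cases n N) as [H|H]; auto. exfalso. apply Near. left. apply HN1.
            unfold N in H; lia. }
          apply Nat.ltb_lt in LN. rewrite LN. specialize (He n).
          assert (b n / Cmod (w - t n) <= (2 * Q + 2) * e n / Cmod (w - t n)); [|lra].
          apply Rmult_le_compat_r; [lra|]. rewrite Eb, Rmult_comm. apply Rmult_le_compat_r; lra. }
      * rewrite fsum_plus, fsum_scal, (fsum_trunc (fun n => be n / Cmod (w - t n))) by (unfold M; lia).
        specialize (HN0 M). unfold X. lra.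
    + right. unfold X. rewrite Rmult_plus_distr_l, <- fsum_scal, Rplus_assoc. f_equal. f_equal.
      apply fsum_ext. intros n _. unfold Rdiv. ring.
  - exists r. split; auto. eapply Rle_trans; [exact HI|].
    apply Rmult_le_compat_l; [pose proof two_PI_pos; lra|].
    rewrite fsum_scal.
    assert (SB : fsum be N <= B0 + (2 * Q + 2) * eta).
    { rewrite (fsum_tail_cut be N0 N) by (unfold N; lia). apply Rplus_le_compat.
      - right. apply fsum_ext. intros n Hn. apply Nat.ltb_lt in Hn. unfold be. rewrite Hn. reflexivity.
      - apply Rle_trans with (fsum (fun n => (2 * Q + 2) * g n) N).
        + right. apply fsum_ext. intros n _. unfold be, g. destruct (n <? N0)%nat; ring.
        + rewrite fsum_scal. apply Rmult_le_compat_l; auto. unfold Q; lra. }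
    assert (SR : fsum be N / R <= B0 / R + 10 * eta).
    { apply Rmult_le_reg_r with R; [lra|]. unfold Rdiv. rewrite Rmult_assoc, Rinv_l, Rmult_1_r by lra.
      replace ((B0 * / R + 10 * eta) * R) with (B0 + 10 * eta * R) by (field; lra).
      unfold Q in SB. nra. }
    assert (SB0 : B0 / R <= eps / 16).
    { apply Rmult_le_reg_r with R; [lra|]. unfold Rdiv. rewrite Rmult_assoc, Rinv_l, Rmult_1_r by lra.
      assert (B0 = eps * / 16 * (16 * B0 / eps)) by (field; lra).
      rewrite H at 1. apply Rmult_le_compat_l; lra. }
    assert (SL : L * fsum be N / R <= L * (eps / 16 + 10 * eta)).
    { unfold Rdiv at 1. rewrite Rmult_assoc. apply Rmult_le_compat_l; auto. fold (fsum be N / R). lra. }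
    unfold eta in *. nra.
Qed.

Lemma is_cseries_bound u s X : is_cseries u s -> (forall m, fsum (fun n => Cmod (u n)) m <= X) -> Cmod s <= X.
Proof.
  intros Hs HX. apply Rnot_lt_le. intros N.
  (* Half of the gap, because a ball of radius [eps] only guarantees modulus below [sqrt 2 * eps],
     still less than the gap. *)
  set (eps := (Cmod s - X) / 2). assert (Pe : 0 < eps) by (unfold eps; lra).
  assert (L : locally (T := C_UniformSpace) s (fun y => Cmod (y - s) < sqrt 2 * eps)).
  { exists (mkposreal eps Pe). intros y Hy. apply (C_NormedModule_mixin_compat2 s y (mkposreal eps Pe)).
    exact Hy. }
  destruct (Hs _ L) as [n Hn]. specialize (Hn n (le_n n)).
  assert (B : Cmod (sum_n (G := C_NormedModule) u n) <= fsum (fun n => Cmod (u n)) (S n)).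
  { clear. induction n as [|n IH].
    - rewrite sum_O. simpl. lra.
    - rewrite sum_Sn. eapply Rle_trans; [apply Cmod_triangle|]. simpl in *. lra. }
  specialize (HX (S n)).
  pose proof (Cmod_triangle_inv s (sum_n (G := C_NormedModule) u n)) as T. rewrite Cmod_sub_sym in T.
  assert (S2 : sqrt 2 < 2).
  { rewrite <- (sqrt_square 2) at 2 by lra. apply sqrt_lt_1; lra. }
  assert (sqrt 2 * eps < 2 * eps) by (apply Rmult_lt_compat_r; auto). unfold eps in *.
  change (Cmod (sum_n (G := C_NormedModule) u n - s) < sqrt 2 * ((Cmod s - X) / 2)) in Hn. lra.
Qed.

Lemma entire_bounded f r : entire f -> 0 < r -> exists M, 0 <= M /\ forall w, Cmod w <= r -> Cmod (f w) <= M.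
Proof.
  intros Hf Hr. destruct (circle_bounded f 0%C (2 * r)) as [M [PM HM]]; [lra|intros; apply entire_ccont; auto|].
  exists (2 * M). split; [lra|]. intros w Hw. apply (holo_bound f 0%C (3 * r) (2 * r)); auto; try lra.
  - apply entire_holo; auto.
  - replace (w - 0)%C with w by ring. lra.
Qed.

(* The element of the space whose only nonzero coefficient is the first one is a multiple of A(z) /
(z - t_0). *)
Lemma generator_growth T A mu : entire A -> (forall n, 0 < mu n) ->
  (forall z, A z = 0%C <-> in_range T z) -> CdB_finite_order T A mu -> log_poly_growth A.
Proof.
  intros HA Hmu HZ Hfin.
  destruct (entire_factor A (T 0%nat) HA) as [g [Hg E]].
  assert (A0 : A (T 0%nat) = 0%C) by (apply HZ; exists 0%nat; reflexivity).
  assert (Pm : 0 < sqrt (mu 0%nat)) by (apply sqrt_lt_R0, Hmu).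
  set (F := fun z => (RtoC (sqrt (mu 0%nat)) * g z)%C).
  assert (HF : in_CdB T A mu F).
  { split.
    - apply entire_cderiv. intros z. destruct (proj1 (entire_cderiv g) Hg z) as [l Hl].
      eexists. apply cderiv_scal. exact Hl.
    - exists (fun n => match n with O => 1%C | S _ => 0%C end). split.
      + apply ex_series_incr_1. apply (ex_series_ext (fun _ => 0)).
        * intros n. rewrite Cmod_0. simpl. ring.
        * exists 0. apply (filterlim_ext (fun _ => 0)); [|apply filterlim_const].
          intros n. symmetry. induction n as [|n IH]; [apply sum_O|].
          rewrite sum_Sn, IH. apply (plus_zero_l (G := R_AbelianGroup)).
      + intros z Hz. assert (N : (z - T 0%nat)%C <> 0%C).
        { apply Csub_neq_0. intros ->. apply Hz. exists 0%nat. reflexivity. }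
        apply (is_series_decr_1 (V := C_NormedModule)).
        match goal with |- is_series _ ?l => assert (El : l = zero) end.
        { change ((F z + - (A z * (1 * RtoC (sqrt (mu 0%nat))) / (z - T 0%nat)))%C = 0%C).
          unfold F. rewrite (E z), A0. field. auto. }
        rewrite El. apply (filterlim_ext (fun _ => zero)); [|apply filterlim_const].
        intros n. symmetry. induction n as [|n IH].
        * rewrite sum_O. change ((A z * (0 * RtoC (sqrt (mu 1%nat))) / (z - T 1%nat))%C = 0%C). unfold Cdiv.
          ring.
        * rewrite sum_Sn, IH.
          change ((0 + A z * (0 * RtoC (sqrt (mu (S (S n))))) / (z - T (S (S n))))%C = 0%C). unfold Cdiv.
          ring. }
  destruct (finite_order_growth F (Hfin F HF)) as [c [k [Pc HB]]].
  (* Recovering [A] multiplies by [|z - t_0| / sqrt (mu 0) <= D (1 + |z|)], which is absorbed into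
     the exponential at the price of one more degree. *)
  set (D := (1 + Cmod (T 0%nat)) / sqrt (mu 0%nat)).
  pose proof (Cmod_ge_0 (T 0%nat)) as PT.
  assert (PD : 0 <= D) by (apply Rmult_le_pos; [lra|left; apply Rinv_0_lt_compat; auto]).
  exists (D + 1 + c), (S k). split; [lra|]. intros z.
  pose proof (Cmod_ge_0 z) as Pz. pose proof (pow_1_Cmod z k) as P1.
  assert (EA : A z = ((z - T 0%nat) * F z * / RtoC (sqrt (mu 0%nat)))%C).
  { rewrite (E z), A0. unfold F. field. intros Eq. apply RtoC_inj in Eq. lra. }
  rewrite EA, !Cmod_mult, Cmod_inv, Cmod_R, (Rabs_pos_eq (sqrt (mu 0%nat))) by (try lra; intros Eq;
    apply RtoC_inj in Eq; lra).
  apply Rle_trans with (D * (1 + Cmod z) * exp (c * (1 + Cmod z) ^ k)).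
  - replace (Cmod (z - T 0%nat) * Cmod (F z) * / sqrt (mu 0%nat)) with (Cmod (z - T 0%nat) * / sqrt
    (mu 0%nat) * Cmod (F z)) by ring.
    apply Rmult_le_compat; auto; try apply Cmod_ge_0.
    + apply Rmult_le_pos; [apply Cmod_ge_0|left; apply Rinv_0_lt_compat; auto].
    + unfold D, Rdiv. rewrite Rmult_assoc, (Rmult_comm (/ _)), <- Rmult_assoc.
      apply Rmult_le_compat_r; [left; apply Rinv_0_lt_compat; auto|].
      pose proof (Cmod_triangle_sub z (T 0%nat)). nra.
  - apply Rle_trans with (exp D * exp (1 + Cmod z) * exp (c * (1 + Cmod z) ^ k)).
    + apply Rmult_le_compat_r; [left; apply exp_pos|]. pose proof (exp_ineq1_le D).
      pose proof (exp_ineq1_le (1 + Cmod z)).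
      apply Rmult_le_compat; lra.
    + rewrite <- !exp_plus. apply exp_le. simpl.
      set (p := (1 + Cmod z) ^ k) in *.
      assert (1 <= (1 + Cmod z) * p) by nra.
      assert (1 + Cmod z <= (1 + Cmod z) * p) by nra.
      assert (D <= D * ((1 + Cmod z) * p)) by nra.
      assert (c * p <= c * ((1 + Cmod z) * p)) by (apply Rmult_le_compat_l; nra). lra.
Qed.

(** The product [|c n| * (sqrt (mu n) / (|T n| + 1))] is at most the sum of the squares of its
    factors, and [(|T n| + 1)^2 >= |T n|^2 + 1] brings in the summability of [mu]. *)
Lemma coefficient_series (T : nat -> C) (mu : nat -> R) (a c : nat -> C) :
  (forall n, 0 < mu n) ->
  ex_series (fun n => mu n / (Cmod (T n) ^ 2 + 1)) -> ex_series (fun n => Cmod (c n) ^ 2) ->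
  ex_series (fun n => Cmod (a n) / (Cmod (T n) + 1)) ->
  ex_series (fun n => (Cmod (c n) * sqrt (mu n) + Cmod (a n)) / (Cmod (T n) + 1)).
Proof.
  intros Hmu H1 H2 H3.
  apply (ex_series_le (K := R_AbsRing) (V := R_CompleteNormedModule) _
    (fun n => (mu n / (Cmod (T n) ^ 2 + 1) + Cmod (c n) ^ 2) + Cmod (a n) / (Cmod (T n) + 1))).
  - intros n. change (Rabs ((Cmod (c n) * sqrt (mu n) + Cmod (a n)) / (Cmod (T n) + 1)) <=
      (mu n / (Cmod (T n) ^ 2 + 1) + Cmod (c n) ^ 2) + Cmod (a n) / (Cmod (T n) + 1)).
    pose proof (Cmod_ge_0 (T n)) as PT. pose proof (Cmod_ge_0 (c n)) as Pc. pose proof (Cmod_ge_0 (a n)) as Pa.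
    pose proof (sqrt_pos (mu n)) as Ps. specialize (Hmu n).
    set (x := Cmod (T n)) in *. set (y := Cmod (c n)) in *. set (s := sqrt (mu n)) in *.
    assert (Pi : 0 < / (x + 1)) by (apply Rinv_0_lt_compat; lra).
    rewrite Rabs_pos_eq by (apply Rmult_le_pos; [nra|lra]).
    unfold Rdiv. rewrite Rmult_plus_distr_r. apply Rplus_le_compat_r.
    assert (Es : s * s = mu n) by (apply sqrt_sqrt; lra).
    set (j := / (x + 1)) in *.
    assert (J : mu n * (j * j) <= mu n * / (x ^ 2 + 1)).
    { apply Rmult_le_compat_l; [lra|]. unfold j. rewrite <- Rinv_mult. apply Rinv_le_contravar; simpl; nra. }
    assert (0 <= (s * j - y) * (s * j - y)) by apply Rle_0_sqr.
    assert (0 <= y * (s * j)) by (apply Rmult_le_pos; [auto|apply Rmult_le_pos; lra]).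
    assert (s * j * (s * j) = mu n * (j * j)) by (rewrite <- Es; ring).
    simpl in *. nra.
  - apply (ex_series_plus (V := R_NormedModule)); auto. apply (ex_series_plus (V := R_NormedModule)); auto.
Qed.

(** * The uniqueness theorem *)

Lemma ex_RInt_Cmod_circle f z c : entire f -> ex_RInt (fun t => Cmod (f (z + c * cis t)%C)) 0 (2 * PI).
Proof.
  intros Hf. apply ex_RInt_circle. intros t.
  apply (rcont_Cmod (fun t => f (z + c * cis t)%C)). apply rcont_entire_circle; auto.
Qed.

(** The triangle inequality in the mean value formula, the exceptional point being the centre. *)
Lemma submean_Cmod f z r : entire f -> 0 <= r -> 2 * PI * Cmod (f z) <= rmean (fun w => Cmod (f w)) z r.
Proof.
  intros Hf Hr. pose proof two_PI_pos.
  assert (E : cmean f z r = (RtoC (2 * PI) * f z)%C).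
  { apply (cmean_value f z z (r + 1)); try lra.
    - intros; apply entire_ccont; auto.
    - intros w _ _. apply entire_cderiv, Hf. }
  replace (2 * PI * Cmod (f z)) with (Cmod (RtoC (2 * PI) * f z)).
  2:{ rewrite Cmod_mult, Cmod_R, Rabs_pos_eq by lra. reflexivity. }
  rewrite <- E, <- norm_Cmod. unfold cmean.
  apply (norm_RInt_le (V := CR) (fun t => f (z + RtoC r * cis t)%C) (fun t => Cmod (f
    (z + RtoC r * cis t)%C)) 0 (2 * PI)).
  - lra.
  - intros t _. rewrite norm_Cmod. lra.
  - apply RInt_correct, ex_cint_circle. intros; apply entire_ccont; auto.
  - apply (RInt_correct (V := R_CompleteNormedModule)), ex_RInt_Cmod_circle; auto.
Qed.

Lemma term_le_fsum (u : nat -> C) (b : nat -> R) (M : R) m :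
  (forall n, Cmod (u n) <= M * b n) -> fsum (fun n => Cmod (u n)) m <= M * fsum b m.
Proof. intros H. rewrite <- fsum_scal. apply fsum_le. auto. Qed.

(** The series for [G / A] cannot be bounded near [T], but [|G|] is subharmonic: a good circle about
    [z] bounds its mean, hence [|G z|], by a multiple of the maximum of [|A|] nearby. *)
Lemma generated_growth (T : nat -> C) (b : nat -> R) A G gamma : entire A -> entire G ->
  log_poly_growth A -> is_lim_seq (fun n => Cmod (T n)) p_infty -> (forall n, 0 <= b n) ->
  ex_series (fun n => b n / (Cmod (T n) + 1)) ->
  (forall w X, ~ in_range T w -> (forall m, fsum (fun n => b n / Cmod (w - T n)) m <= X) ->
     Cmod (G w) <= Cmod (A w) * (Cmod gamma + X)) ->
  log_poly_growth G.
Proof.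
  intros HA HG [c [k [Pc BA]]] Hinf Hb Hser HGb. pose proof two_PI_pos as HP.
  destruct (transform_circle T b 1 Hinf Hb Hser Rlt_0_1) as [R1 [HR1 TC]].
  pose proof (Cmod_ge_0 gamma) as Pg.
  exists (Cmod gamma + 2 + c * (1 + (4 * R1 + 4)) ^ k), k.
  assert (Pk : 0 <= c * (1 + (4 * R1 + 4)) ^ k) by (apply Rmult_le_pos; auto; apply pow_le; lra).
  split; [lra|]. intros z. pose proof (Cmod_ge_0 z) as Pz.
  set (R := R1 + Cmod z).
  set (E := exp (c * (1 + 4 * R) ^ k)).
  assert (P1 : 1 <= E).
  { apply Rle_trans with (exp 0); [rewrite exp_0; lra|]. apply exp_le. apply Rmult_le_pos; auto.
    apply pow_le. unfold R. lra. }
  assert (AE : forall w, Cmod (w - z) <= 3 * R -> Cmod (A w) <= E).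
  { intros w Hw. eapply Rle_trans; [apply BA|]. apply exp_le, Rmult_le_compat_l; auto. apply pow_incr.
    pose proof (Cmod_ge_0 w). pose proof (Cmod_triangle (w - z) z) as T0.
    replace (w - z + z)%C with w in T0 by ring.
    unfold R in *. lra. }
  destruct (entire_bounded G (4 * R) HG) as [B [PB HB]]; [unfold R; lra|].
  (* With [eps = 1] this yields [|G z| <= E (|gamma| + 1) + 1 <= E (|gamma| + 2)]. The crude bound
     [B] on [|G|] leaves no trace in the result. *)
  destruct (TC R z (fun w => Cmod (G w)) B (E * Cmod gamma) E) as [r [Hr HI]]; try (unfold R; lra); try nra.
  - intros r _. apply ex_RInt_Cmod_circle; auto.
  - intros w Hw. split; [apply Cmod_ge_0|]. apply HB.
    pose proof (Cmod_triangle (w - z) z) as T0. replace (w - z + z)%C with w in T0 by ring. unfold R in *. lra.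
  - intros w X Hw HwT HX. rewrite <- Rmult_plus_distr_l.
    assert (PX : 0 <= X) by apply (HX 0%nat).
    eapply Rle_trans; [apply HGb; eauto|]. apply Rmult_le_compat_r; [lra|]. auto.
  - pose proof (submean_Cmod G z r HG ltac:(unfold R in *; lra)) as SM.
    assert (F : Cmod (G z) <= E * Cmod gamma + (E + 1) * 1) by (apply Rmult_le_reg_l with (2 * PI); lra).
    apply Rle_trans with (exp (Cmod gamma + 2) * E).
    + pose proof (exp_ineq1_le (Cmod gamma + 2)). nra.
    + unfold E. rewrite <- exp_plus. apply exp_le. pose proof (pow_1_Cmod z k) as Pk1.
      assert (Q : c * (1 + 4 * R) ^ k <= c * (1 + (4 * R1 + 4)) ^ k * (1 + Cmod z) ^ k).
      { rewrite Rmult_assoc. apply Rmult_le_compat_l; auto.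
        eapply Rle_trans; [|apply pow_affine_Cmod; lra]. apply pow_incr. unfold R. nra. }
      nra.
Qed.

(** Each step enlarges the radius by 4, hence the growth bound by about [4^k]; the factor
    [/ (2 * 4^k)] leaves a net decay of [2^(-j)]. *)
Lemma geometric_decay (c x : R) k : 0 <= c -> 1 <= x -> forall eps, 0 < eps ->
  exists j, (/ (2 * 4 ^ k)) ^ j * (c * (1 + 4 ^ j * x) ^ k) <= eps.
Proof.
  intros Hc Hx eps He.
  assert (Pq : 0 <= c * (1 + x) ^ k) by (apply Rmult_le_pos; auto; apply pow_le; lra).
  destruct (pow_lt_1_zero (/ 2)) with (y := eps / (c * (1 + x) ^ k + 1)) as [j Hj].
  - rewrite Rabs_pos_eq; lra.
  - apply Rdiv_lt_0_compat; lra.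
  - exists j. specialize (Hj j (le_n j)).
    assert (P2 : 0 < (/ 2) ^ j) by (apply pow_lt; lra). rewrite Rabs_pos_eq in Hj by lra.
    assert (P4 : 1 <= 4 ^ j) by (apply pow_R1_Rle; lra).
    assert (P4k : 0 < 4 ^ k) by (apply pow_lt; lra).
    assert (PK : 0 < (/ (2 * 4 ^ k)) ^ j) by (apply pow_lt, Rinv_0_lt_compat; lra).
    apply Rle_trans with ((/ (2 * 4 ^ k)) ^ j * (c * (4 ^ j * (1 + x)) ^ k)).
    + apply Rmult_le_compat_l; [lra|]. apply Rmult_le_compat_l; auto. apply pow_incr. split; nra.
    + replace ((/ (2 * 4 ^ k)) ^ j * (c * (4 ^ j * (1 + x)) ^ k)) with ((/ 2) ^ j * (c * (1 + x) ^ k)).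
      * apply Rmult_lt_compat_r with (r := c * (1 + x) ^ k + 1) in Hj; [|lra].
        replace (eps / (c * (1 + x) ^ k + 1) * (c * (1 + x) ^ k + 1)) with eps in Hj by (field; lra). nra.
      * rewrite Rpow_mult_distr, <- pow_mult, Nat.mul_comm, pow_mult.
        replace (/ 2) with (/ (2 * 4 ^ k) * 4 ^ k) by (field; lra).
        rewrite Rpow_mult_distr. ring.
Qed.

(* Iterating the hypothesis [j] times yields [u <= 4 eta + kappa^j * growth (4^j R)], and the choice
   of [kappa] against the growth exponent makes the last term vanish. *)
Lemma contraction_bound (u : C -> R) c k : 0 <= c -> (forall z, u z <= c * (1 + Cmod z) ^ k) ->
  (forall eta kappa, 0 < eta -> 0 < kappa -> exists R1, 1 <= R1 /\ forall R M, R1 <= R -> 0 <= M ->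
     (forall w, Cmod w <= 4 * R -> u w <= M) -> forall z, Cmod z <= R -> u z <= 2 * eta + kappa * M) ->
  forall z, u z <= 0.
Proof.
  intros Pc Hg Hstep z. apply Rnot_lt_le. intros N.
  (* In the end [u z <= 4 * eta + eta = 5 * eta], which is less than [u z]. *)
  set (eta := u z / 6). assert (Pe : 0 < eta) by (unfold eta; lra).
  assert (P4k : 1 <= 4 ^ k) by (apply pow_R1_Rle; lra).
  set (kap := / (2 * 4 ^ k)).
  assert (Pk : 0 < kap) by (apply Rinv_0_lt_compat; lra).
  assert (Pk2 : kap <= / 2) by (apply Rinv_le_contravar; lra).
  destruct (Hstep eta kap Pe Pk) as [R1 [HR1 St]].
  (* The constant 4 is stable: [2 * eta + kap * (4 * eta) <= 4 * eta] since [kap <= / 2]. *)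
  assert (It : forall j R, R1 <= R -> forall w,
    Cmod w <= R -> u w <= 4 * eta + kap ^ j * (c * (1 + 4 ^ j * R) ^ k)).
  { induction j as [|j IH]; intros R HR w Hw.
    - simpl. rewrite !Rmult_1_l. eapply Rle_trans; [apply Hg|].
      assert (c * (1 + Cmod w) ^ k <= c * (1 + R) ^ k); [|lra].
      apply Rmult_le_compat_l; auto. apply pow_incr. pose proof (Cmod_ge_0 w). lra.
    - set (M := 4 * eta + kap ^ j * (c * (1 + 4 ^ j * (4 * R)) ^ k)).
      assert (PM : 0 <= kap ^ j * (c * (1 + 4 ^ j * (4 * R)) ^ k)).
      { apply Rmult_le_pos; [apply pow_le; lra|]. apply Rmult_le_pos; auto. apply pow_le.
        assert (0 <= 4 ^ j) by (apply pow_le; lra). nra. }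
      assert (Q : u w <= 2 * eta + kap * M).
      { apply (St R M HR); auto; [unfold M; lra|]. intros v Hv. apply (IH (4 * R)); lra. }
      replace (4 ^ S j * R) with (4 ^ j * (4 * R)) by (simpl; ring).
      change (kap ^ S j) with (kap * kap ^ j). unfold M in Q. nra. }
  set (R := R1 + Cmod z). pose proof (Cmod_ge_0 z).
  destruct (geometric_decay c R k Pc ltac:(unfold R; lra) eta Pe) as [j Hj].
  specialize (It j R ltac:(unfold R; lra) z ltac:(unfold R; lra)). fold kap in Hj.
  unfold eta in *. lra.
Qed.

Theorem theorem3p2
  (T : nat -> C) (mu : nat -> R) (A : C -> C)
  (HTinj : forall n m, T n = T m -> n = m)
  (HTinf : is_lim_seq (fun n => Cmod (T n)) p_infty)
  (Hmupos : forall n, 0 < mu n)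
  (Hmusum : ex_series (fun n => mu n / (Cmod (T n) ^ 2 + 1)))
  (HAent : entire A)
  (HAzeros : forall z, A z = 0%C <-> in_range T z)
  (HAsimple : forall n, exists l : C,
      is_derive (K:=C_AbsRing) (V:=C_NormedModule) A (T n) l /\ l <> 0%C)
  (Hfin : CdB_finite_order T A mu)
  (gamma : C) (Hgamma : gamma <> 0%C)
  (a : nat -> C)
  (Hasum : ex_series (fun n => Cmod (a n) / (Cmod (T n) + 1)))
  (G : C -> C) (HGent : entire G)
  (HGdef : forall z, ~ in_range T z ->
      exists s : C, is_cseries (fun n => (a n / (z - T n))%C) s /\
                    G z = (A z * (gamma + s))%C)
  (F : C -> C) (HF : in_CdB T A mu F)
  (HFvan : forall (w : C) (m : nat),
      vanishes_to_order G w m -> vanishes_to_order F w m) :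
  forall z, F z = 0%C.
Proof.
  pose proof two_PI_pos as HP.
  assert (HAg : log_poly_growth A) by (apply (generator_growth T A mu); auto).
  assert (HFg : log_poly_growth F) by (apply finite_order_growth, Hfin, HF).
  destruct HF as [HFent [c [Hc HFdef]]].
  (* One weight for both transforms, so that a single sum of poles controls [F / A] and [G / A] at
     once. *)
  set (b := fun n => Cmod (c n) * sqrt (mu n) + Cmod (a n)).
  assert (Hb : forall n, 0 <= b n).
  { intros n. pose proof (Cmod_ge_0 (c n)). pose proof (Cmod_ge_0 (a n)). pose proof (sqrt_pos (mu n)).
    unfold b. nra. }
  assert (Hser : ex_series (fun n => b n / (Cmod (T n) + 1))) by (apply (coefficient_series T mu a c); auto).
  assert (Hd : forall w n, ~ in_range T w -> 0 < Cmod (w - T n) /\ (w - T n)%C <> 0%C).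
  { intros w n Hw. assert (N : w <> T n) by (intros E; apply Hw; exists n; auto).
    split; [apply Cmod_pos_sub; auto|apply Csub_neq_0; auto]. }
  assert (Fb : forall w X, ~ in_range T w -> (forall m, fsum (fun n => b n / Cmod (w - T n)) m <= X) ->
     Cmod (F w) <= Cmod (A w) * X).
  { intros w X Hw HX. apply (is_cseries_bound _ _ _ (HFdef w Hw)). intros m.
    eapply Rle_trans; [apply (term_le_fsum _ (fun n => b n / Cmod (w - T n)) (Cmod (A w)))|].
    - intros n. destruct (Hd w n Hw) as [D1 D2].
      rewrite Cmod_div, !Cmod_mult, Cmod_R, (Rabs_pos_eq (sqrt (mu n))) by (auto; apply sqrt_pos).
      unfold Rdiv. rewrite Rmult_assoc. apply Rmult_le_compat_l; [apply Cmod_ge_0|].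
      apply Rmult_le_compat_r; [left; apply Rinv_0_lt_compat; auto|]. unfold b. pose proof (Cmod_ge_0 (a n)).
      lra.
    - apply Rmult_le_compat_l; [apply Cmod_ge_0|auto]. }
  assert (Gb : forall w X, ~ in_range T w -> (forall m, fsum (fun n => b n / Cmod (w - T n)) m <= X) ->
     exists s, Cmod s <= X /\ G w = (A w * (gamma + s))%C).
  { intros w X Hw HX. destruct (HGdef w Hw) as [s [Hs E]]. exists s. split; auto.
    apply (is_cseries_bound _ _ _ Hs). intros m.
    eapply Rle_trans; [apply (term_le_fsum _ (fun n => b n / Cmod (w - T n)) 1)|rewrite Rmult_1_l; auto].
    intros n. destruct (Hd w n Hw) as [D1 D2]. rewrite Cmod_div by auto. rewrite Rmult_1_l.
    apply Rmult_le_compat_r; [left; apply Rinv_0_lt_compat; auto|].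
    unfold b. pose proof (Cmod_ge_0 (c n)). pose proof (sqrt_pos (mu n)). nra. }
  assert (HGg : log_poly_growth G).
  { apply (generated_growth T b A G gamma); auto. intros w X Hw HX.
    destruct (Gb w X Hw HX) as [s [Hs E]]. rewrite E, Cmod_mult. apply Rmult_le_compat_l; [apply Cmod_ge_0|].
    eapply Rle_trans; [apply Cmod_triangle|]. lra. }
  (* If [G] is zero it vanishes to every order at 0, hence so does [F], and [flat_zero] applies. *)
  destruct (classic (forall z, G z = 0%C)) as [Z|NZ].
  { apply (flat_zero F 0%C HFent). intros m. apply HFvan. exists (fun _ => 0%C). split.
    - apply entire_cderiv. intros z. exists 0%C. apply cderiv_const.
    - intros z. rewrite Z. ring. }
  apply not_all_ex_not in NZ. destruct NZ as [z0 Hz0].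
  destruct (entire_quotient F G z0 HFent HGent Hz0 HFvan) as [H [HH EH]].
  destruct (quotient_growth F G H z0 HFent HGent HH Hz0 EH HFg HGg) as [cH [kH [PcH BH]]].
  assert (Hu : forall z, ln (nsq (H z) + 1) <= 0).
  { apply (contraction_bound (fun z => ln (nsq (H z) + 1)) cH kH PcH BH).
    intros eta kap Pe Pk. pose proof (proj1 (Cmod_gt_0 gamma) Hgamma) as Pg.
    (* For [X <= lam] the denominator [|gamma + s|] is at least [|gamma| / 2], so
       [|H| <= 2 X / |gamma| <= Rmin 1 eta]. The cap at 1 gives [|H|^2 <= |H|], and then
       [u <= |H|^2 <= eta]. *)
    set (lam := Cmod gamma * Rmin 1 eta / 2).
    assert (Pm : 0 < Rmin 1 eta) by (apply Rmin_pos; lra).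
    assert (Plam : 0 < lam) by (unfold lam; nra).
    pose proof (Rmin_l 1 eta) as M1. pose proof (Rmin_r 1 eta) as M2.
    (* The good circle leaves an error [(M / lam + 1) * eps], to be at most [kap * M + eta]. *)
    set (eps := Rmin eta (kap * lam)).
    assert (Peps : 0 < eps) by (apply Rmin_pos; [auto|apply Rmult_lt_0_compat; auto]).
    assert (E1 : eps <= eta) by apply Rmin_l. assert (E2 : eps <= kap * lam) by apply Rmin_r.
    destruct (transform_circle T b eps HTinf Hb Hser Peps) as [R1 [HR1 TC]].
    exists R1. split; auto. intros R M HR HM HuM z Hz.
    set (u := fun z => ln (nsq (H z) + 1)) in *.
    assert (Pu : forall w, 0 <= u w).
    { intros w. unfold u. rewrite <- ln_1. pose proof (nsq_pos (H w)). apply ln_le; lra. }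
    assert (In : forall w, Cmod (w - z) <= 3 * R -> u w <= M).
    { intros w Hw. apply HuM. pose proof (Cmod_triangle (w - z) z) as T0.
      replace (w - z + z)%C with w in T0 by ring. lra. }
    assert (PL : 0 <= M / lam) by (apply Rmult_le_pos; auto; left; apply Rinv_0_lt_compat; auto).
    destruct (TC R z u M eta (M / lam)) as [r [Hr HI]]; auto; try lra.
    - intros r _. apply ex_RInt_ln_circle; auto; lra.
    - intros w X Hw HwT HX. assert (PX : 0 <= X) by apply (HX 0%nat).
      (* Above the threshold [X / lam >= 1], and the trivial bound [M] is already at most
         [M / lam * X]. *)
      destruct (Rle_dec X lam) as [LX|LX].
      + assert (Q : u w <= eta); [|assert (0 <= M / lam * X) by (apply Rmult_le_pos; auto); lra].
        destruct (Gb w X HwT HX) as [s [Hs EG]]. pose proof (Fb w X HwT HX) as BF.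
        (* Off [T] the factor [A w] is nonzero and can be cancelled between the bounds for [F] and
           [G]. *)
        assert (PA : 0 < Cmod (A w)) by (apply Cmod_gt_0; intros Z; apply HwT, HAzeros, Z).
        pose proof (Cmod_triangle_inv gamma (- s)) as TI.
        replace (gamma - - s)%C with (gamma + s)%C in TI by ring.
        rewrite Cmod_opp in TI.
        assert (HG2 : Cmod gamma / 2 <= Cmod (gamma + s)) by (unfold lam in LX; nra).
        rewrite EH, EG, !Cmod_mult in BF. pose proof (Cmod_ge_0 (H w)) as PH.
        assert (BF' : Cmod (H w) * Cmod (gamma + s) <= X) by (apply Rmult_le_reg_l with (Cmod (A w)); lra).
        assert (HB : Cmod (H w) <= Rmin 1 eta).
        { apply Rmult_le_reg_r with (Cmod gamma / 2); [lra|]. unfold lam in LX. nra. }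
        unfold u. eapply Rle_trans; [|apply M2]. rewrite nsq_Cmod.
        assert (SQ : Cmod (H w) * Cmod (H w) <= Rmin 1 eta) by nra.
        rewrite <- (ln_exp (Rmin 1 eta)). apply ln_le; [nra|]. pose proof (exp_ineq1_le (Rmin 1 eta)). lra.
      + eapply Rle_trans; [apply In, Hw|]. 
        assert (M / lam * lam <= M / lam * X) by (apply Rmult_le_compat_l; lra).
        replace (M / lam * lam) with M in H0 by (field; lra). lra.
    - pose proof (submean_ln 1 H z (r + 1) r ltac:(lra) (entire_holo H z (r + 1) HH) ltac:(lra)) as SM.
      assert (Q : u z <= eta + (M / lam + 1) * eps).
      { apply Rmult_le_reg_l with (2 * PI); [auto|]. eapply Rle_trans; [exact SM|exact HI]. }
      assert (M / lam * eps <= M / lam * (kap * lam)) by (apply Rmult_le_compat_l; auto).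
      replace (M / lam * (kap * lam)) with (kap * M) in H0 by (field; lra).
      change (u z <= 2 * eta + kap * M). lra. }
  intros z. assert (Z : H z = 0%C).
  { apply Cmod_eq_0. specialize (Hu z). pose proof (nsq_pos (H z)) as N.
    assert (L : nsq (H z) + 1 <= 1).
    { apply Rnot_lt_le. intros L. apply ln_increasing in L; [|lra]. rewrite ln_1 in L. lra. }
    rewrite nsq_Cmod in L. pose proof (Cmod_ge_0 (H z)). nra. }
  rewrite EH, Z. ring.
Qed.
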